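(* Let $b_1,\dots,b_m\in C^\infty(\mathbb T^3;\mathbb C)$, $b=(b_1,\dots,b_m):\mathbb T^3\to\mathbb C^m$, and let $\mathscr W_\infty$, $\mathbb A_b$, $\Gamma_b$ be as defined in the context. Then: (i) The cubic saturation space admits the exact algebraic representation $$\mathscr W_\infty=\Bigl\{\sum_{j=1}^m\mathsf A_jb_j:\mathsf A_j\in\mathbb A_b\Bigr\},$$ where $\mathsf A_jb_j$ denotes the pointwise action of the real-linear endomorphism $\mathsf A_j(x)$ on $b_j(x)$. (ii) For every integer $k\ge1$, $$\overline{\mathscr W_\infty}^{\,C^k}=C^k(\mathbb T^3;\mathbb C)\quad\Longleftrightarrow\quad\Gamma_b:\mathbb T^3\to\operatorname{Herm}_m^+\text{ is a smooth embedding}.$$ In particular, if $\Gamma_b$ is a smooth embedding, then the forcing $b_1,\dots,b_m$ is cubic saturating.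
   Context: $\mathbb T^3=(\mathbb R/2\pi\mathbb Z)^3$. Let $\mathsf N(z)=|z|^2z$ and $\mathsf Jz=\mathrm iz$; the third real derivative of $\mathsf N$ is the real trilinear map $D^3\mathsf N[h,k,\ell]=2(hk\bar\ell+h\ell\bar k+k\ell\bar h)$. Put $\mathscr W_0=\operatorname{span}_{\mathbb R}\{b_1,\dots,b_m\}$, $$\mathscr W_{n+1}=\operatorname{span}_{\mathbb R}\bigl(\mathscr W_n\cup\{\mathsf JD^3\mathsf N[\phi,h,k]:\phi\in\mathscr W_n,\ h,k\in\mathscr W_0\}\bigr),\qquad\mathscr W_\infty=\bigcup_{n\ge0}\mathscr W_n.$$ The forcing is cubic saturating if $\mathscr W_\infty$ is dense in $H^1(\mathbb T^3;\mathbb C)$. For $1\le j,k\le m$ let $\mathsf T_{jk}(x)\in\operatorname{End}_{\mathbb R}(\mathbb C)$ be $$\mathsf T_{jk}(x)z=\mathsf JD^3\mathsf N[z,b_j(x),b_k(x)]=2\mathrm i\bigl[(b_j\bar b_k+b_k\bar b_j)z+b_jb_k\bar z\bigr],$$ and let $\mathbb A_b=\operatorname{Alg}_{\mathbb R}\{\operatorname{Id},\mathsf T_{jk}:1\le j,k\le m\}\subset C^\infty(\mathbb T^3;\operatorname{End}_{\mathbb R}(\mathbb C))$ be the unital real algebra generated by these fields under pointwise composition. Put $\Gamma_b(x)=b(x)b(x)^*\in\operatorname{Herm}_m^+$, where $b(x)^*$ is the conjugate transpose and $\operatorname{Herm}_m^+$ is the cone of positive semidefinite Hermitian $m\times m$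 matrices, inside the real vector space of Hermitian $m\times m$ matrices. *)

(* Defs.v *)
From HB Require Import structures.
From mathcomp Require Import all_boot all_order all_algebra.
From mathcomp Require Import generic_quotient complex.
From mathcomp Require Import all_classical all_reals all_analysis.
From mathcomp Require Import ring lra.

Set Implicit Arguments.
Unset Strict Implicit.
Unset Printing Implicit Defensive.

Import Order.TTheory GRing.Theory Num.Theory.
Import numFieldNormedType.Exports.

Local Open Scope classical_set_scope.
Local Open Scope ring_scope.
Local Open Scope quotient_scope.

(* The complex numbers are [Rcomplex R], the library's copy of [R[i]] seen as a
   real vector space with the real-valued modulus as norm. *)

Section ComplexTopology.
Variable R : realType.

HB.instance Definition _ :=
  PseudoMetric.copy (Rcomplex R) (pseudoMetric_normed (Rcomplex R)).

HB.instance Definition _ := isPointed.Build (Rcomplex R) 0.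

Let Rcomplex_normrZ (l : R) (x : Rcomplex R) : `| l *: x | = `| l | * `| x |.
Proof.
case: x => a b; rewrite /Num.norm /= !exprMn -mulrDr sqrtrM ?sqr_ge0//.
by rewrite sqrtr_sqr.
Qed.

HB.instance Definition _ :=
  NormedZmod_PseudoMetric_eq.Build R (Rcomplex R) erefl.
HB.instance Definition _ :=
  PseudoMetricNormedZmod_Lmodule_isNormedModule.Build R (Rcomplex R)
    Rcomplex_normrZ.

End ComplexTopology.

Section Torus.
Variable R : realType.

Definition eqmod2pi (x y : R) : bool :=
  `[< exists n : int, x - y = n%:~R * (2 * pi) >].

Let eqmod2pi_refl : reflexive eqmod2pi.
Proof. by move=> x; apply/asboolP; exists 0; rewrite subrr mul0r. Qed.

Let eqmod2pi_sym : symmetric eqmod2pi.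
Proof.
suff H x y : eqmod2pi x y -> eqmod2pi y x by move=> x y; apply/idP/idP; exact: H.
move=> /asboolP[n xy]; apply/asboolP; exists (- n).
by rewrite -opprB xy mulrNz mulNr.
Qed.

Let eqmod2pi_trans : transitive eqmod2pi.
Proof.
move=> y x z /asboolP[n xy] /asboolP[k yz]; apply/asboolP; exists (n + k).
by rewrite intrD mulrDl -xy -yz addrA subrK.
Qed.

Definition eqmod2pi_equiv :=
  EquivRel eqmod2pi eqmod2pi_refl eqmod2pi_sym eqmod2pi_trans.

Definition circle := {eq_quot eqmod2pi_equiv}.
HB.instance Definition _ := Topological.copy circle (quotient_topology circle).
HB.instance Definition _ := Quotient.on circle.

Definition torus3 : Type := (circle * circle * circle)%type.

Definition torus_pi (p : R * R * R) : torus3 :=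
  (\pi_circle p.1.1, \pi_circle p.1.2, \pi_circle p.2).

End Torus.

Section Calculus.
Variable R : realType.
Local Notation C := (Rcomplex R).
Local Notation T3 := (torus3 R).
Implicit Types (F : R * R * R -> C) (f w u g : T3 -> C).

(* Functions on the torus are differentiated through the covering map: [tlift f]
   is the periodic function on R^3 representing [f]. *)
Definition tlift f : R * R * R -> C := f \o @torus_pi R.

Definition axis (i : 'I_3) : R * R * R :=
  ((i == 0)%:R, (i == 1)%:R, (i == 2)%:R).

Definition partial (i : 'I_3) F : R * R * R -> C := fun p => 'D_(axis i) F p.

Fixpoint class_C (k : nat) F : Prop :=
  continuous F /\
  (if k is k'.+1 then
     forall i : 'I_3,
       (forall p, derivable F p (axis i)) /\ class_C k' (partial i F)
   else True).

Definition torus_C (k : nat) : set (T3 -> C) := [set f | class_C k (tlift f)].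

Definition torus_Cinfty : set (T3 -> C) := [set f | forall k, torus_C k f].

(* [iter_partial [:: i1; ..; is] F] is the partial derivative of order s of [F]
   in the directions i1, .., is. *)
Definition iter_partial (s : seq 'I_3) F : R * R * R -> C :=
  foldr partial F s.

(* Closure in the Banach space C^k(T^3; C), whose norm is the supremum of all
   partial derivatives of order at most k. *)
Definition closure_C (k : nat) (W : set (T3 -> C)) : set (T3 -> C) :=
  [set f | torus_C k f /\
    forall e : R, 0 < e -> exists w, [/\ W w, torus_C k w &
      forall s : seq 'I_3, (size s <= k)%N ->
        forall p, `| iter_partial s (tlift (f - w)) p | < e] ].

(* A smooth immersion that is a homeomorphism onto its image.  The image of
   the maps considered lies in the real subspace of Hermitian matrices of
   'M_m(C), which carries the induced topology and linear structure. *)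
Definition smooth_embedding (m : nat) (G : T3 -> 'M[C]_m) : Prop :=
  [/\ forall i j, torus_Cinfty (fun x => G x i j),
      forall p v : R * R * R,
        (forall i j, 'D_v (tlift (fun x => G x i j)) p = 0) -> v = 0,
      injective G,
      continuous G &
      forall U : set T3, open U ->
        exists2 V : set 'M[C]_m, open V & G @` U = V `&` range G].

Local Notation mR := (measurableTypeR R).

Definition lebesgue3 : {measure set (mR * mR * mR) -> \bar R} :=
  ((@lebesgue_measure R \x @lebesgue_measure R) \x @lebesgue_measure R)%E.

Definition cell : set (mR * mR * mR) :=
  `[0, 2 * pi] `*` `[0, 2 * pi] `*` `[0, 2 * pi].

Definition cintegral F : C :=
  Complex (\int[lebesgue3]_(p in cell) complex.Re (F p))
          (\int[lebesgue3]_(p in cell) complex.Im (F p)).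

Definition L2_sqnorm u : \bar R :=
  (\int[lebesgue3]_(p in cell) (`| tlift u p | ^+ 2)%:E)%E.

Definition torus_L2 : set (T3 -> C) :=
  [set u | [/\ measurable_fun cell (fun p => complex.Re (tlift u p)),
               measurable_fun cell (fun p => complex.Im (tlift u p)) &
               (L2_sqnorm u < +oo)%E] ].

Definition weak_partial (i : 'I_3) u g : Prop :=
  forall phi, torus_Cinfty phi ->
    cintegral (fun p => tlift u p * partial i (tlift phi) p) =
    - cintegral (fun p => tlift g p * tlift phi p).

Definition torus_H1 : set (T3 -> C) :=
  [set u | torus_L2 u /\
           forall i, exists2 g, torus_L2 g & weak_partial i u g].

(* Weak derivatives are unique up to a null set, so that the choice made by
   [get] does not affect [H1_sqnorm]. *)
Definition weak_derivative (i : 'I_3) u : T3 -> C :=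
  get [set g | torus_L2 g /\ weak_partial i u g].

Definition H1_sqnorm u : \bar R :=
  (L2_sqnorm u + \sum_(i < 3) L2_sqnorm (weak_derivative i u))%E.

Definition dense_in_H1 (W : set (T3 -> C)) : Prop :=
  W `<=` torus_H1 /\
  forall u, torus_H1 u -> forall e : R, 0 < e ->
    exists2 w, W w & (H1_sqnorm (u - w)%R < (e ^+ 2)%:E)%E.

End Calculus.

Section RealSpan.
Variables (R : realType) (V : lmodType R).

Definition real_span (S : set V) : set V :=
  [set v | exists (n : nat) (c : 'I_n -> R) (w : 'I_n -> V),
     (forall i, S (w i)) /\ v = \sum_(i < n) c i *: w i].

End RealSpan.

Section Cubic.
Variable R : realType.
Local Notation C := (Rcomplex R).
Local Notation T3 := (torus3 R).

Definition cubicN (z : C) : C := (`|z| ^+ 2) *: z.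

Definition J (z : C) : C := Complex 0 1 * z.

Definition D3N (h k l : C) : C :=
  2 * (h * k * conjc l + h * l * conjc k + k * l * conjc h).

(* [D3N] is symmetric, hence determined by its diagonal, which for the third
   derivative of a homogeneous cubic map is 3! times the map. *)
Lemma D3N_diag (h : C) : D3N h h h = 6%:R *: cubicN h.
Proof.
case: h => x y; rewrite /cubicN /Num.norm /= sqr_sqrtr ?addr_ge0 ?sqr_ge0//.
by rewrite /D3N mulr2n mulrDl !mul1r; simpc; congr Complex; ring.
Qed.

Variables (m : nat) (b : 'I_m -> T3 -> C).

Definition sat_space0 : set (T3 -> C) := real_span (range b).

Fixpoint sat_space (n : nat) : set (T3 -> C) :=
  if n is n'.+1 then
    real_span (sat_space n' `|`
      [set f | exists phi h k, [/\ sat_space n' phi, sat_space0 h,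
         sat_space0 k & f = fun x => J (D3N (phi x) (h x) (k x))]])
  else sat_space0.

Definition sat_limit : set (T3 -> C) := \bigcup_n sat_space n.

Definition cubic_saturating : Prop := dense_in_H1 sat_limit.

Definition Tfield (j k : 'I_m) : T3 -> C -> C :=
  fun x z => J (D3N z (b j x) (b k x)).

Lemma TfieldE j k x z : Tfield j k x z =
  2 * Complex 0 1 * ((b j x * conjc (b k x) + b k x * conjc (b j x)) * z
                     + b j x * b k x * conjc z).
Proof. by rewrite /Tfield /J /D3N; ring. Qed.

Definition unital_subalgebra (S : set (T3 -> C -> C)) : Prop :=
  [/\ S (fun=> idfun),
      forall (c : R) A B, S A -> S B -> S (fun x z => c *: A x z + B x z) &
      forall A B, S A -> S B -> S (fun x => A x \o B x)].

Definition Tfield_algebra : set (T3 -> C -> C) :=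
  smallest unital_subalgebra [set Tfield j k | j in setT & k in setT].

Lemma Tfield_algebra_linear A x : Tfield_algebra A -> linear (A x).
Proof.
move=> AA; apply: (AA [set B | forall y, linear (B y)]); split; first split.
- by move=> y c u v.
- move=> c B D lB lD y a u v; rewrite lB lD !scalerDr !scalerA (mulrC c a).
  by rewrite -!addrA; congr (_ + _); rewrite addrCA.
- by move=> B D lB lD y a u v /=; rewrite lD lB.
- move=> _ [j _ [k _ <-]] y a [u1 u2] [v1 v2]; rewrite !TfieldE.
  move: (b j y) (b k y) => [? ?] [? ?].
  by rewrite mulr2n mulrDl !mul1r; simpc; congr Complex; ring.
Qed.

Definition Gamma (x : T3) : 'M[C]_m :=
  let v : 'cV[C]_m := \col_j b j x in v *m map_mx (@conjc R) v^T.

Definition Herm_pos : set 'M[C]_m :=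
  [set M | map_mx (@conjc R) M^T = M /\
    forall v : 'cV[C]_m, exists2 r : R, 0 <= r &
      (map_mx (@conjc R) v^T *m M *m v) 0 0 = Complex r 0].

Lemma Gamma_Herm_pos x : Herm_pos (Gamma x).
Proof.
have conjcM (z w : C) : conjc (z * w) = conjc z * conjc w.
  by case: z w => [? ?] [? ?]; simpc; congr Complex; ring.
have conjcD (z w : C) : conjc (z + w) = conjc z + conjc w.
  by case: z w => [? ?] [? ?]; simpc; congr Complex; ring.
have conjcKK (z : C) : conjc (conjc z) = z by case: z => ? ?; rewrite /= opprK.
have conjc0 : conjc (0 : C) = 0 by rewrite /= oppr0.
split=> [|v].
  apply/matrixP => i j; rewrite !mxE !big_ord1 !mxE.
  by rewrite conjcM conjcKK mulrC.
pose s : C := \sum_j conjc (v j 0) * b j x.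
have -> : (map_mx (@conjc R) v^T *m Gamma x *m v) 0 0 = s * conjc s.
  rewrite /Gamma mulmxA -mulmxA mxE big_ord1; congr (_ * _).
    by rewrite mxE; apply: eq_bigr => j _; rewrite !mxE.
  rewrite /s (big_morph _ conjcD conjc0) mxE; apply: eq_bigr => j _.
  by rewrite !mxE conjcM conjcKK mulrC.
case: s => p q; exists (p ^+ 2 + q ^+ 2); first by rewrite addr_ge0 ?sqr_ge0.
by simpc; congr Complex; ring.
Qed.

End Cubic.

(* Main.v *)
(* Everything is reduced to real functions on R^3 that are 2 pi-periodic.

   Part (i) is the minimality of both descriptions, D^3 N being symmetric.

   Density in C^k from the embedding: write b_j conj(b_k) = g_jk - i w_jk.  The
   anticommutators of the fields T_jk are scalars, so all products g g' and
   w w' map W_infinity into itself; the products theta = r g w, with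
   r = sum_l g_ll, only satisfy theta b_n, theta g_nn (i b_n) in W_infinity.
   The scalars s + sum s' theta nevertheless form an algebra of smooth
   functions, which separates points and tangent vectors when Gamma does, and
     f = sum_n (f conj(b_n) g_nn / sum_l g_ll^2) b_n
   reduces density in W_infinity to Nachbin's theorem for that algebra.
   Nachbin's theorem is proved by convolution with the kernels
   (1 - |H(x) - H(y)|^2 / M)^n of a local chart H made of elements of the
   algebra, a partition of unity, and polynomial approximation of the cut-offs
   max(0, u)^(k+1).

   Conversely, Gamma determines f conj(b_k) for each f in W_infinity, to first
   order as well, so a failure of injectivity or immersivity of Gamma is
   inherited by every function in the closure.

   For H^1, the same kernels built from cos x_i and sin x_i are convolution
   kernels, so they commute with weak derivatives; they contract L^2 and
   converge on continuous functions, which are dense in L^2. *)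
Require Import Defs.
From HB Require Import structures.
From mathcomp Require Import all_boot all_order all_algebra.
From mathcomp Require Import generic_quotient complex.
From mathcomp Require Import all_classical all_reals all_analysis.
From mathcomp Require Import measurable_realfun.
From mathcomp Require Import ring lra.

Set Implicit Arguments.
Unset Strict Implicit.
Unset Printing Implicit Defensive.

Import Order.TTheory GRing.Theory Num.Theory.
Import numFieldNormedType.Exports.

Local Open Scope classical_set_scope.
Local Open Scope ring_scope.

(** * Calculus of periodic functions *)

(** The local averages are divided by the integral of a cut-off against the kernel, not by the total
    mass. The kernel is translation invariant in the chart variables only, so moving a derivative
    from x to y brings in an inverse Jacobian that exists on the chart alone. Numerator and
    denominator, both confined to the chart, then obey the same differentiation formula, and
    convergence in C^k reduces order by order to uniform convergence. Kernels are kept as finite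
    sums of products, so that the averages belong to the algebra exactly and only the normalisation
    needs a limit.

    The saturation space is merely real linear. Multiplication by i is recovered on one generator at
    a time, from [T_nn b_n = 6 g_nn (i b_n)], which is why the weight g_nn accompanies i b_n
    everywhere. The real parts g_jk alone do not distinguish Gamma from its complex conjugate; the
    functions theta are there to reach the imaginary parts w_jk. *)

Section RealCalculus.
Variable R : realType.
Local Notation P := (R * R * R)%type.
Local Notation ax i := (axis R i).
Implicit Types (F G : P -> R) (p q v : P) (i : 'I_3) (k : nat) (A : set P).

Definition dpar i F : P -> R := fun p => 'D_(ax i) F p.

Fixpoint Creg k F : Prop :=
  continuous F /\
  (if k is k'.+1 then
     forall i, (forall p, derivable F p (ax i)) /\ Creg k' (dpar i F)
   else True).

(** One bound [M] serves for all partial derivatives of order at most [k]. They are derivatives in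
    the whole space, evaluated on [A], so [A] may be closed, as it is for the set where a cut-off
    vanishes. *)
Fixpoint bnd A k (M : R) F : Prop :=
  (forall p, A p -> `|F p| <= M) /\
  (if k is k'.+1 then forall i, bnd A k' M (dpar i F) else True).

Lemma Creg_cont k F : Creg k F -> continuous F.
Proof. by case: k => [|k] []. Qed.

Lemma Creg_der k F i p : Creg k.+1 F -> derivable F p (ax i).
Proof. by move=> [_ /(_ i)[]]. Qed.

Lemma Creg_dpar k F i : Creg k.+1 F -> Creg k (dpar i F).
Proof. by move=> [_ /(_ i)[]]. Qed.

Lemma CregW k F : Creg k.+1 F -> Creg k F.
Proof.
elim: k F => [|k IH] F /= [cF dF]; split=> // i.
by have [dFi rF] := dF i; split=> //; apply: IH.
Qed.

Lemma Creg_le k l F : (k <= l)%N -> Creg l F -> Creg k F.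
Proof.
move=> /subnK <-; elim: (l - k)%N => [//|d IH]; rewrite addSn => /CregW.
exact: IH.
Qed.

Lemma dpar_cst (c : R) i : dpar i (fun=> c) = fun=> 0.
Proof. by apply/funext => p; rewrite /dpar derive_cst. Qed.

Lemma Creg_cst k (c : R) : Creg k (fun=> c).
Proof.
elim: k c => [|k IH] c /=; split=> //; try exact: cst_continuous.
by move=> i; split; [move=> p; exact: derivable_cst | rewrite dpar_cst].
Qed.

Section Pointwise.
Variables (F G : P -> R) (i : 'I_3).
Hypotheses (dF : forall p, derivable F p (ax i))
  (dG : forall p, derivable G p (ax i)).

Lemma dparD : dpar i (fun p => F p + G p) = fun p => dpar i F p + dpar i G p.
Proof. by apply/funext => p; rewrite /dpar (@deriveD _ _ _ F G). Qed.

Lemma dparB : dpar i (fun p => F p - G p) = fun p => dpar i F p - dpar i G p.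
Proof. by apply/funext => p; rewrite /dpar (@deriveB _ _ _ F G). Qed.

Lemma dparZ (c : R) : dpar i (fun p => c * F p) = fun p => c * dpar i F p.
Proof. by apply/funext => p; rewrite /dpar (@deriveZ _ _ _ F c). Qed.

Lemma dparM : dpar i (fun p => F p * G p) =
  fun p => F p * dpar i G p + G p * dpar i F p.
Proof. by apply/funext => p; rewrite /dpar (@deriveM _ _ F G). Qed.

Lemma dparV : (forall p, F p != 0) ->
  dpar i (fun p => (F p)^-1) = fun p => - ((F p)^-1 * (F p)^-1) * dpar i F p.
Proof.
move=> F0; apply/funext => p; rewrite /dpar (@deriveV _ _ F)//.
by rewrite expr2 invfM.
Qed.

Lemma dparX n : dpar i (fun p => F p ^+ n.+1) =
  fun p => n.+1%:R * F p ^+ n * dpar i F p.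
Proof.
apply/funext => p; rewrite /dpar.
have -> : (fun q => F q ^+ n.+1) = F ^+ n.+1.
  by apply/funext => q; rewrite fctE.
by rewrite (@deriveX _ _ F)//= -scalerMnl -scaler_nat !scalerA.
Qed.

End Pointwise.

Lemma CregD k F G : Creg k F -> Creg k G -> Creg k (fun p => F p + G p).
Proof.
elim: k F G => [|k IH] F G [cF dF] [cG dG]; split=> //;
  try by move=> p; apply: continuousD; [exact: cF | exact: cG].
move=> i; split=> [p|].
  by apply: derivableD; [exact: (dF i).1 | exact: (dG i).1].
rewrite dparD; [|exact: (dF i).1|exact: (dG i).1].
by apply: IH; [exact: (dF i).2 | exact: (dG i).2].
Qed.

Lemma CregM k F G : Creg k F -> Creg k G -> Creg k (fun p => F p * G p).
Proof.
elim: k F G => [|k IH] F G [cF dF] [cG dG]; split=> //;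
  try by move=> p; apply: continuousM; [exact: cF | exact: cG].
move=> i; split=> [p|].
  by apply: derivableM; [exact: (dF i).1 | exact: (dG i).1].
rewrite dparM; [|exact: (dF i).1|exact: (dG i).1].
have rF : Creg k F by apply: CregW; split.
have rG : Creg k G by apply: CregW; split.
by apply: CregD; apply: IH => //; [exact: (dG i).2 | exact: (dF i).2].
Qed.

Lemma CregZ k (c : R) F : Creg k F -> Creg k (fun p => c * F p).
Proof. by apply: CregM; exact: Creg_cst. Qed.

Lemma CregN k F : Creg k F -> Creg k (fun p => - F p).
Proof.
move=> /(CregZ (-1)); congr Creg.
by apply/funext => p; rewrite mulN1r.
Qed.

Lemma CregB k F G : Creg k F -> Creg k G -> Creg k (fun p => F p - G p).
Proof. by move=> rF /CregN; exact: CregD. Qed.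

Lemma Creg_sum k (I : Type) (s : seq I) (Pr : pred I) (F : I -> P -> R) :
  (forall l, Pr l -> Creg k (F l)) -> Creg k (fun p => \sum_(l <- s | Pr l) F l p).
Proof.
move=> rF; elim: s => [|a s IH].
  rewrite (_ : (fun p => _) = (fun=> 0)); first exact: Creg_cst.
  by apply/funext => p; rewrite big_nil.
rewrite (_ : (fun p => _) = (fun p => (if Pr a then F a p else 0)
    + \sum_(l <- s | Pr l) F l p)).
  by apply: CregD => //; case Pa: (Pr a); [exact: rF|exact: Creg_cst].
by apply/funext => p; rewrite big_cons; case: ifP => //; rewrite add0r.
Qed.

Lemma Creg_prod k (I : Type) (s : seq I) (Pr : pred I) (F : I -> P -> R) :
  (forall l, Pr l -> Creg k (F l)) -> Creg k (fun p => \prod_(l <- s | Pr l) F l p).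
Proof.
move=> rF; elim: s => [|a s IH].
  rewrite (_ : (fun p => _) = (fun=> 1)); first exact: Creg_cst.
  by apply/funext => p; rewrite big_nil.
rewrite (_ : (fun p => _) = (fun p => (if Pr a then F a p else 1)
    * \prod_(l <- s | Pr l) F l p)).
  by apply: CregM => //; case Pa: (Pr a); [exact: rF|exact: Creg_cst].
by apply/funext => p; rewrite big_cons; case: ifP => //; rewrite mul1r.
Qed.

Lemma CregX k F n : Creg k F -> Creg k (fun p => F p ^+ n).
Proof.
move=> rF; elim: n => [|n IH].
  by rewrite (_ : (fun p => _) = (fun=> 1)) //; exact: Creg_cst.
rewrite (_ : (fun p => _) = (fun p => F p * F p ^+ n)); first exact: CregM.
by apply/funext => p; rewrite exprS.
Qed.

Lemma CregV k F : (forall p, F p != 0) -> Creg k F -> Creg k (fun p => (F p)^-1).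
Proof.
move=> F0; elim: k => [|k IH] [cF dF]; split=> //;
  try by move=> p; apply: continuousV; [exact: F0 | exact: cF].
move=> i; split=> [p|]; first by apply: derivableV => //; exact: (dF i).1.
rewrite dparV//; last exact: (dF i).1.
have rF : Creg k F by apply: CregW; split.
by apply: CregM; [apply/CregN/CregM; exact: IH | exact: (dF i).2].
Qed.

Lemma bnd0 A k M F p : bnd A k M F -> A p -> `|F p| <= M.
Proof. by case: k => [|k] [+ _] => /[apply]. Qed.

Lemma bnd_dpar A k M F i : bnd A k.+1 M F -> bnd A k M (dpar i F).
Proof. by move=> [_ /(_ i)]. Qed.

Lemma bndW A k M F : bnd A k.+1 M F -> bnd A k M F.
Proof.
elim: k F => [|k IH] F /= [cF dF]; split=> // i.
by apply: IH; exact: dF.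
Qed.

Lemma bnd_le A k M N F : M <= N -> bnd A k M F -> bnd A k N F.
Proof.
move=> MN; elim: k F => [|k IH] F [bF dF]; split=> //; try
  by move=> p Ap; exact: le_trans (bF p Ap) MN.
by move=> i; apply: IH; first [exact: dF|exact: eF].
Qed.

Lemma bnd_sub A B k M F : A `<=` B -> bnd B k M F -> bnd A k M F.
Proof.
move=> AB; elim: k F => [|k IH] F [bF dF]; split=> //; try
  by move=> p /AB /bF.
by move=> i; apply: IH; first [exact: dF|exact: eF].
Qed.

Lemma bndU A B k M F : bnd A k M F -> bnd B k M F -> bnd (A `|` B) k M F.
Proof.
elim: k F => [|k IH] F [aF dF] [bF eF]; split=> //; try by move=> p [/aF|/bF].
by move=> i; apply: IH; first [exact: dF|exact: eF].
Qed.

Lemma bnd_cst A k (c M : R) : `|c| <= M -> bnd A k M (fun=> c).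
Proof.
elim: k c => [|k IH] c cM; split=> // i.
by rewrite dpar_cst; apply: IH; rewrite normr0 (le_trans _ cM).
Qed.

Lemma bndD A k M N F G : Creg k F -> Creg k G ->
  bnd A k M F -> bnd A k N G -> bnd A k (M + N) (fun p => F p + G p).
Proof.
elim: k F G => [|k IH] F G rF rG [bF dF] [bG dG]; split=> //; try by move=> p Ap;
  rewrite (le_trans (ler_normD _ _))// lerD ?bF ?bG.
move=> i; rewrite dparD; [|exact: (rF.2 i).1|exact: (rG.2 i).1].
by apply: IH; [exact: Creg_dpar|exact: Creg_dpar|exact: dF|exact: dG].
Qed.

(** Each differentiation doubles the number of Leibniz terms, whence the factor [2 ^+ k]. *)
Lemma bndM A k M N F G : Creg k F -> Creg k G ->
  bnd A k M F -> bnd A k N G -> bnd A k (2 ^+ k * (M * N)) (fun p => F p * G p).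
Proof.
elim: k M N F G => [|k IH] M N F G rF rG bF bG; split=> //; try move=> p Ap.
- by rewrite expr0 mul1r normrM ler_pM// ?(bnd0 bF Ap) ?(bnd0 bG Ap).
- rewrite normrM (@le_trans _ _ (M * N))//.
    by rewrite ler_pM ?(bnd0 bF Ap) ?(bnd0 bG Ap).
  rewrite ler_peMl ?exprn_ege1 ?ler1n//.
  by rewrite mulr_ge0// (le_trans _ (bnd0 bF Ap), le_trans _ (bnd0 bG Ap)).
move=> i; rewrite dparM; [|exact: (rF.2 i).1|exact: (rG.2 i).1].
rewrite exprS [2]mulr2n mulrDl mulrDl mul1r.
rewrite {2}(mulrC M).
have rF' : Creg k F by exact: CregW.
have rG' : Creg k G by exact: CregW.
apply: bndD; try by apply: CregM => //; exact: Creg_dpar.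
  by apply: IH => //; [exact: Creg_dpar|exact: bndW|exact: bnd_dpar].
by apply: IH => //; [exact: Creg_dpar|exact: bndW|exact: bnd_dpar].
Qed.

Lemma bndZ A k (c M : R) F : Creg k F ->
  bnd A k M F -> bnd A k (`|c| * M) (fun p => c * F p).
Proof.
elim: k F => [|k IH] F rF [bF dF]; split=> //;
  try by move=> p Ap; rewrite normrM ler_wpM2l// bF.
move=> i; rewrite dparZ; last exact: (rF.2 i).1.
by apply: IH; [exact: Creg_dpar|exact: dF].
Qed.

Lemma bndN A k M F : Creg k F -> bnd A k M F -> bnd A k M (fun p => - F p).
Proof.
elim: k F => [|k IH] F rF [bF dF]; split=> //; try by move=> p; rewrite normrN; exact: bF.
move=> i; rewrite (_ : dpar i _ = fun p => - dpar i F p).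
  by apply: IH; [exact: Creg_dpar|exact: dF].
by apply/funext => p; rewrite /dpar (@deriveN _ _ _ F)//; exact: (rF.2 i).1.
Qed.

Lemma bndB A k M N F G : Creg k F -> Creg k G ->
  bnd A k M F -> bnd A k N G -> bnd A k (M + N) (fun p => F p - G p).
Proof.
by move=> rF rG bF bG; apply: bndD => //; [exact: CregN|exact: bndN].
Qed.

Lemma bnd_sum A k (n : nat) (M : 'I_n -> R) (F : 'I_n -> P -> R) :
  (forall l, Creg k (F l)) -> (forall l, bnd A k (M l) (F l)) ->
  bnd A k (\sum_(l < n) M l) (fun p => \sum_(l < n) F l p).
Proof.
elim: n M F => [|n IH] M F rF bF.
  rewrite big_ord0 (_ : (fun p => _) = (fun=> 0)).
    by apply: bnd_cst; rewrite normr0.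
  by apply/funext => p; rewrite big_ord0.
rewrite big_ord_recr /= (_ : (fun p => _) =
  (fun p => \sum_(l < n) F (widen_ord (leqnSn n) l) p + F ord_max p)).
  apply: bndD => //; first exact: Creg_sum.
  exact: (IH (fun l => M (widen_ord (leqnSn n) l))).
by apply/funext => p; rewrite big_ord_recr.
Qed.

Lemma is_derive_line F p v t : derivable F (p + t *: v) v ->
  is_derive t 1 (fun s : R => F (p + s *: v)) ('D_v F (p + t *: v)).
Proof.
move=> dF.
have E : (fun h : R => h^-1 *: (((fun s : R => F (p + s *: v)) \o shift t) (h *: 1)
    - F (p + t *: v))) =
  (fun h : R => h^-1 *: ((F \o shift (p + t *: v)) (h *: v) - F (p + t *: v))).
  apply/funext => h /=; congr (_ *: (F _ - _)).
  by rewrite scalerDl [h *: 1]mulr1 addrCA addrC -addrA.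
split; first by rewrite /derivable E.
by rewrite /derive E.
Qed.

(** The mean value theorem on a line; the absolute values allow [t] to be negative. *)
Lemma MVT_line F p v (t : R) : (forall q, derivable F q v) ->
  exists2 s, `|s| <= `|t| & F (p + t *: v) - F p = t * 'D_v F (p + s *: v).
Proof.
move=> dF; pose g s := F (p + s *: v).
have dg (s : R) : is_derive s 1 g ('D_v F (p + s *: v)) by exact: is_derive_line.
have cg a b : {within `[a, b], continuous g}.
  apply: continuous_subspaceT => s; apply: differentiable_continuous.
  by apply/derivable1_diffP; case: (dg s).
have g0 : g 0 = F p by rewrite /g scale0r addr0.
case: (leP 0 t) => [t0|t0].
  have [c] := MVT_segment t0 (fun x _ => dg x) (cg _ _).
  rewrite in_itv /= => /andP[c0 ct] E; exists c; first by rewrite !ger0_norm.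
  by rewrite -[F p]g0 [LHS]E subr0 mulrC.
have [c] := MVT_segment (ltW t0) (fun x _ => dg x) (cg _ _).
rewrite in_itv /= => /andP[tc c0] E; exists c.
  by rewrite !ler0_norm ?lerN2// ltW.
by rewrite -[F p]g0 -opprB [X in - X]E sub0r mulrN opprK mulrC.
Qed.

End RealCalculus.

(** * Complex-valued functions through their real and imaginary parts *)

Section ComplexParts.
Variable R : realType.
Local Notation C := (Rcomplex R).
Local Notation P := (R * R * R)%type.
Local Notation re := (@complex.Re R).
Local Notation im := (@complex.Im R).

Lemma re_norm_le (z : C) : `|re z| <= `|z|.
Proof.
case: z => x y; rewrite [leRHS](_ : _ = Num.sqrt (x ^+ 2 + y ^+ 2))//=.
by rewrite -sqrtr_sqr ler_wsqrtr// lerDl sqr_ge0.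
Qed.

Lemma im_norm_le (z : C) : `|im z| <= `|z|.
Proof.
case: z => x y; rewrite [leRHS](_ : _ = Num.sqrt (x ^+ 2 + y ^+ 2))//=.
by rewrite -sqrtr_sqr ler_wsqrtr// lerDr sqr_ge0.
Qed.

Lemma complex_norm_le (z : C) : `|z| <= `|re z| + `|im z|.
Proof.
case: z => x y; rewrite [leLHS](_ : _ = Num.sqrt (x ^+ 2 + y ^+ 2))//=.
rewrite -(@ler_pXn2r _ 2) ?nnegrE ?sqrtr_ge0 ?addr_ge0//.
rewrite sqr_sqrtr ?addr_ge0 ?sqr_ge0// sqrrD !real_normK ?num_real//.
by rewrite addrAC lerDl mulrn_wge0 // mulr_ge0.
Qed.

Lemma reB (z w : C) : re (z - w) = re z - re w.
Proof. by case: z w => [? ?] []. Qed.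

Lemma imB (z w : C) : im (z - w) = im z - im w.
Proof. by case: z w => [? ?] []. Qed.

Lemma cvg_complexP (T : Type) (F : set_system T) (FF : Filter F)
    (f : T -> C) (l : C) :
  (f x @[x --> F] --> l) <->
  (re (f x) @[x --> F] --> re l /\ im (f x) @[x --> F] --> im l).
Proof.
split=> [fl|[rl il]].
  split; apply/cvgrPdist_lt => e e0;
    move/cvgrPdist_lt : fl => /(_ e e0); apply: filterS => x; apply: le_lt_trans.
    by rewrite -reB re_norm_le.
  by rewrite -imB im_norm_le.
apply/cvgrPdist_lt => e e0.
have e20 : 0 < e / 2 by rewrite divr_gt0.
move/cvgrPdist_lt : rl => /(_ _ e20) rl.
move/cvgrPdist_lt : il => /(_ _ e20) il.
apply: filterS2 rl il => x rx ix.
rewrite (le_lt_trans (complex_norm_le _))// [e]splitr.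
by rewrite reB imB ltrD.
Qed.

Lemma continuous_complexP (T : topologicalType) (f : T -> C) :
  continuous f <-> (continuous (fun x => re (f x)) /\ continuous (fun x => im (f x))).
Proof.
split=> [cf|[cr ci] x].
  by split=> x; have /cvg_complexP[] := cf x.
by apply/cvg_complexP; split; [exact: cr|exact: ci].
Qed.

Section Derivative.
Variables (F : P -> C) (p v : P).

Let quotE (h : R) : h^-1 *: ((F \o shift p) (h *: v) - F p) =
  Complex (h^-1 *: (((fun q => re (F q)) \o shift p) (h *: v) - re (F p)))
          (h^-1 *: (((fun q => im (F q)) \o shift p) (h *: v) - im (F p))).
Proof. by rewrite /=; case: (F _) => a b; case: (F p). Qed.

Lemma is_derive_complex (l : C) : is_derive p v (fun q => re (F q)) (re l) ->
  is_derive p v (fun q => im (F q)) (im l) -> is_derive p v F l.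
Proof.
move=> [dr rE] [di iE].
have FE : h^-1 *: ((F \o shift p) (h *: v) - F p) @[h --> 0^'] --> l.
  apply/cvg_complexP; split.
    rewrite -rE; apply: cvg_trans dr; apply: near_eq_cvg; near=> h.
    by rewrite quotE.
  rewrite -iE; apply: cvg_trans di; apply: near_eq_cvg; near=> h.
  by rewrite quotE.
split; first by apply/cvg_ex; exists l.
exact: cvg_lim FE.
Unshelve. all: by end_near. Qed.

Lemma derivable_complex : derivable F p v ->
  is_derive p v (fun q => re (F q)) (re ('D_v F p)) /\
  is_derive p v (fun q => im (F q)) (im ('D_v F p)).
Proof.
move=> /cvg_complexP[dr di].
have dr' : h^-1 *: (((fun q => re (F q)) \o shift p) (h *: v) - re (F p))
    @[h --> 0^'] --> re ('D_v F p).
  apply: cvg_trans dr; apply: near_eq_cvg; near=> h; by rewrite quotE.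
have di' : h^-1 *: (((fun q => im (F q)) \o shift p) (h *: v) - im (F p))
    @[h --> 0^'] --> im ('D_v F p).
  apply: cvg_trans di; apply: near_eq_cvg; near=> h; by rewrite quotE.
split; split.
- by apply/cvg_ex; eexists; exact: dr'.
- exact: cvg_lim dr'.
- by apply/cvg_ex; eexists; exact: di'.
- exact: cvg_lim di'.
Unshelve. all: by end_near. Qed.

End Derivative.

Lemma re_partial (F : P -> C) i : (forall p, derivable F p (axis R i)) ->
  (fun p => re (partial i F p)) = dpar i (fun p => re (F p)).
Proof.
by move=> dF; apply/funext => p; have [[_ <-] _] := derivable_complex (dF p).
Qed.

Lemma im_partial (F : P -> C) i : (forall p, derivable F p (axis R i)) ->
  (fun p => im (partial i F p)) = dpar i (fun p => im (F p)).
Proof.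
by move=> dF; apply/funext => p; have [_ [_ <-]] := derivable_complex (dF p).
Qed.

Lemma class_CP k (F : P -> C) : class_C k F <->
  (Creg k (fun p => re (F p)) /\ Creg k (fun p => im (F p))).
Proof.
elim: k F => [|k IH] F.
  split=> [[/continuous_complexP[cr ci] _]//|[[cr _] [ci _]]].
  by split=> //; apply/continuous_complexP.
split=> [[/continuous_complexP[cr ci] dF]|[rF iF]].
  split; split=> // i; have [dFi /IH[]] := dF i; rewrite re_partial ?im_partial//
    => rr ii; split=> // p; have [[d1 _] [d2 _]] := derivable_complex (dFi p);
    first [exact: d1|exact: d2].
have cF : continuous F by apply/continuous_complexP; split; [case: rF|case: iF].
split=> // i.
have dFi p : derivable F p (axis R i).
  suff [] : is_derive p (axis R i) F
    (Complex ('D_(axis R i) (fun p => re (F p)) p) ('D_(axis R i) (fun p => im (F p)) p)).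
    by [].
  apply: is_derive_complex => /=.
    by apply: derivableP; exact: (Creg_der rF).
  by apply: derivableP; exact: (Creg_der iF).
split=> //; apply/IH; rewrite re_partial// im_partial//.
by split; exact: Creg_dpar.
Qed.

(** [foldr] applies the last index of the list first, hence the induction from the right end. The
    bound doubles only once, when the modulus is split into real and imaginary parts. *)
Lemma iter_partial_bnd A k (M : R) (F : P -> C) : class_C k F ->
  bnd A k M (fun p => re (F p)) -> bnd A k M (fun p => im (F p)) ->
  forall s : seq 'I_3, (size s <= k)%N ->
    forall p, A p -> `|iter_partial s F p| <= M + M.
Proof.
elim: k F => [|k IH] F rF bR bI s.
  case: s => // _ p Ap /=; rewrite (le_trans (complex_norm_le _))//.
  by rewrite lerD// ?(bnd0 bR) ?(bnd0 bI).
case/lastP : s => [_ p Ap|s i].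
  rewrite (le_trans (complex_norm_le _))//.
  by rewrite lerD// ?(bnd0 bR) ?(bnd0 bI).
rewrite size_rcons ltnS => sk p Ap.
rewrite /iter_partial foldr_rcons; have dF := (rF.2 i).1.
apply: IH => //; first exact: (rF.2 i).2.
  by rewrite re_partial//; exact: bnd_dpar.
by rewrite im_partial//; exact: bnd_dpar.
Qed.

End ComplexParts.

(** * Periodic functions, the covering map and the period cell *)

Section Periodic.
Variable R : realType.
Local Notation C := (Rcomplex R).
Local Notation P := (R * R * R)%type.
Local Notation T3 := (torus3 R).
Local Notation tpi := (@torus_pi R).
Implicit Types (F G : P -> R) (p q v : P) (i : 'I_3) (k : nat).

Definition per (T : Type) (F : P -> T) : Prop :=
  forall p q, tpi p = tpi q -> F p = F q.

Definition descend (T : Type) (F : P -> T) : T3 -> T :=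
  fun x => F (repr x.1.1, repr x.1.2, repr x.2).

Definition lattice (n : int * int * int) : P :=
  (n.1.1%:~R * (2 * pi), n.1.2%:~R * (2 * pi), n.2%:~R * (2 * pi)).

Lemma circleP (x y : R) :
  (\pi_(circle R) x = \pi_(circle R) y)%qT <-> exists n : int, x - y = n%:~R * (2 * pi).
Proof.
split=> [/eqmodP /asboolP//|H]; apply/eqmodP; exact/asboolP.
Qed.

Lemma torus_piP p q : tpi p = tpi q <-> exists n, p = lattice n + q.
Proof.
case: p q => [[p1 p2] p3] [[q1 q2] q3]; split.
  case=> /circleP[n1 E1] /circleP[n2 E2] /circleP[n3 E3].
  exists (n1, n2, n3); rewrite /lattice /= -E1 -E2 -E3.
  by congr (_, _, _); rewrite /= subrK.
case=> -[[n1 n2] n3] [-> -> ->]; rewrite /torus_pi /=.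
by congr (_, _, _); apply/circleP; eexists; rewrite addrK.
Qed.

Lemma torus_pi_repr (x : T3) : tpi (repr x.1.1, repr x.1.2, repr x.2) = x.
Proof. by case: x => [[x y] z]; rewrite /torus_pi /= !reprK. Qed.

Lemma per_tpi (T : Type) (f : T3 -> T) : per (f \o tpi).
Proof. by move=> p q /= ->. Qed.

Lemma descend_tpi (T : Type) (F : P -> T) : per F -> descend F \o tpi = F.
Proof. by move=> pF; apply/funext => p; apply: pF; rewrite torus_pi_repr. Qed.

Lemma per_shift (T : Type) (F : P -> T) n p : per F -> F (lattice n + p) = F p.
Proof. by move=> pF; apply: pF; apply/torus_piP; exists n. Qed.

Lemma perP (T : Type) (F : P -> T) :
  (forall n p, F (lattice n + p) = F p) -> per F.
Proof. by move=> H p q /torus_piP[n ->]; exact: H. Qed.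

Lemma per_dpar i F : per F -> per (dpar i F).
Proof.
move=> pF; apply: perP => n p; rewrite /dpar /derive.
congr (lim _); rewrite /fmap /=.
suff -> : (fun h : R => h^-1 *: (F (h *: axis R i + (lattice n + p)) - F (lattice n + p))) =
  (fun h : R => h^-1 *: (F (h *: axis R i + p) - F p)) by [].
apply/funext => h; rewrite addrCA !per_shift//.
Qed.

Lemma compact_cell : compact (@cell R : set P).
Proof.
apply: (@compact_setX _ _ (`[0, 2 * pi]%classic `*` `[0, 2 * pi]%classic)).
  by apply: compact_setX; exact: segment_compact.
exact: segment_compact.
Qed.

Lemma cell_nonempty : (@cell R : set P) !=set0.
Proof.
by exists (0, 0, 0); rewrite /cell /= !in_itv /= lexx mulr_ge0// pi_ge0.
Qed.

Lemma circle_cell (x : R) : exists n : int, 0 <= n%:~R * (2 * pi) + x <= 2 * pi.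
Proof.
have pi0 : 0 < 2 * pi :> R by rewrite mulr_gt0// pi_gt0.
exists (- Num.floor (x / (2 * pi))).
have /andP[h1 h2] := mem_rg1_floor (x / (2 * pi)).
rewrite intrN mulNr addrC subr_ge0 lerBlDr -ler_pdivlMr// h1 /=.
rewrite -[X in X + _]mul1r -mulrDl -ler_pdivrMr// addrC; exact: ltW.
Qed.

Lemma cell_rep p : exists2 q, (@cell R : set P) q & tpi q = tpi p.
Proof.
case: p => [[p1 p2] p3].
have [n1 h1] := circle_cell p1.
have [n2 h2] := circle_cell p2.
have [n3 h3] := circle_cell p3.
exists (lattice (n1, n2, n3) + (p1, p2, p3)).
  by rewrite /cell /= !in_itv /=.
by apply/torus_piP; eexists.
Qed.

Lemma per_bounded F : continuous F -> per F ->
  exists2 M, 0 < M & forall p, `|F p| <= M.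
Proof.
move=> cF pF.
have cn : {within (@cell R : set P), continuous (fun p => `|F p|)}.
  by apply: continuous_subspaceT => p; apply: continuous_comp;
    [exact: cF|exact: norm_continuous].
have [c _ cM] := compact_EVT_max cell_nonempty compact_cell cn.
exists (`|F c| + 1) => [|p]; first by rewrite ltr_pwDr.
have [q qc qp] := cell_rep p.
by rewrite -(pF _ _ qp) (le_trans (cM q _))// ?inE// lerDl.
Qed.

Lemma per_pos_min F : continuous F -> per F -> (forall p, 0 < F p) ->
  exists2 c, 0 < c & forall p, c <= F p.
Proof.
move=> cF pF F0.
have [c _ cM] := compact_EVT_min cell_nonempty compact_cell (continuous_subspaceT cF).
exists (F c) => [//|p].
have [q qc qp] := cell_rep p.
by rewrite -(pF _ _ qp) cM// inE.
Qed.

Lemma Creg_bnd k F : Creg k F -> per F ->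
  exists2 M, 0 < M & bnd setT k M F.
Proof.
elim: k F => [|k IH] F rF pF; have [M M0 FM] := per_bounded (Creg_cont rF) pF.
  by exists M => //; split=> // p _; exact: FM.
have /choice[N HN] : forall i, exists N, 0 < N /\ bnd setT k N (dpar i F).
  move=> i; have [N N0 bN] := IH _ (Creg_dpar i rF) (per_dpar i pF).
  by exists N.
exists (M + \sum_i N i).
  by rewrite ltr_pwDl// sumr_ge0// => i _; rewrite ltW//; have [] := HN i.
split=> [p _|i].
  rewrite (le_trans (FM _))// lerDl sumr_ge0// => i _.
  by rewrite ltW//; have [] := HN i.
apply: bnd_le (HN i).2; rewrite (bigD1 i)//= addrCA lerDl addr_ge0 ?(ltW M0)//.
by apply: sumr_ge0 => j _; rewrite ltW//; have [] := HN j.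
Qed.

End Periodic.

(** * Vanishing of a double integral from vanishing inner integrals *)

Section FubiniZero.
Context d1 d2 (T1 : measurableType d1) (T2 : measurableType d2) (R : realType).
Variables (m1 : {sigma_finite_measure set T1 -> \bar R})
          (m2 : {sigma_finite_measure set T2 -> \bar R}).
Variables (A : set T1) (B : set T2) (f : T1 * T2 -> R).
Hypotheses (mA : measurable A) (mB : measurable B).
Hypothesis fint : (m1 \x m2)%E.-integrable (A `*` B) (EFin \o f).

Let fpatch : (m1 \x m2)%E.-integrable setT ((EFin \o f) \_ (A `*` B)).
Proof. by apply/(integrable_mkcond _ _).1 => //; exact: measurableX. Qed.

(** The integrand is extended by zero to the whole product, where Fubini's theorem applies; outside
    [A] the inner integral is trivially zero. *)
Lemma fubini_zero12 :
  (forall x, A x -> (\int[m2]_(y in B) (f (x, y))%:E = 0)%E) ->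
  (\int[m1 \x m2]_(z in A `*` B) (f z)%:E = 0)%E.
Proof.
move=> H; rewrite integral_mkcond -integral12_prod_meas1//.
rewrite /fubini_F integral0_eq// => x _.
have [xA|xA] := pselect (A x).
  rewrite -[RHS](H _ xA) [RHS]integral_mkcond; apply: eq_integral => y _.
  by rewrite !patchE /= in_setX (mem_set xA).
rewrite integral0_eq// => y _.
by rewrite patchE /= in_setX memNset.
Qed.

Lemma fubini_zero21 :
  (forall y, B y -> (\int[m1]_(x in A) (f (x, y))%:E = 0)%E) ->
  (\int[m1 \x m2]_(z in A `*` B) (f z)%:E = 0)%E.
Proof.
move=> H; rewrite integral_mkcond -integral21_prod_meas1//.
rewrite /fubini_G integral0_eq// => y _.
have [yB|yB] := pselect (B y).
  rewrite -[RHS](H _ yB) [RHS]integral_mkcond; apply: eq_integral => x _.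
  by rewrite !patchE /= in_setX (mem_set yB) andbT.
rewrite integral0_eq// => x _.
by rewrite patchE /= in_setX andbC memNset.
Qed.

End FubiniZero.

Section PlaneLebesgue.
Variable R : realType.
Local Notation mR := (measurableTypeR R).

(* The library infers the s-finiteness of a product measure for subprobabilities
   only, while Fubini on R^2 * R needs it for the plane Lebesgue measure. *)
Definition plane_lebesgue : set (mR * mR) -> \bar R :=
  (@lebesgue_measure R \x @lebesgue_measure R)%E.

HB.instance Definition _ := Measure.copy plane_lebesgue
  (@lebesgue_measure R \x @lebesgue_measure R)%E.

Let plane_lebesgue_sigma_finite : sigma_finite setT plane_lebesgue.
Proof.
have /sigma_finiteP[F [TF ndF Foo]] := sigma_finiteT (@lebesgue_measure R).
exists (fun n => F n `*` F n) => [|k].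
  rewrite -setXTT TF predeqE => -[x y]; split.
    move=> [/= [n _ Fnx] [k _ Fky]]; exists (maxn n k) => //; split.
    - by move: x Fnx; exact/subsetPset/ndF/leq_maxl.
    - by move: y Fky; exact/subsetPset/ndF/leq_maxr.
  by move=> [n _ []/= ? ?]; split; exists n.
have [mF Fk] := Foo k; split; first exact: measurableX.
rewrite [ltLHS](_ : _ = lebesgue_measure (F k) * lebesgue_measure (F k))%E.
  by rewrite lte_mul_pinfty// ge0_fin_numE.
exact: product_measure1E.
Qed.

HB.instance Definition _ := Measure_isSigmaFinite.Build _ _ _ plane_lebesgue
  plane_lebesgue_sigma_finite.

End PlaneLebesgue.

(** * Integration over the period cell *)

Section CellIntegral.
Variable R : realType.
Local Notation P := (R * R * R)%type.
Local Notation mR := (measurableTypeR R).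
Local Notation mP := (mR * mR * mR)%type.
Local Notation mu := (@lebesgue_measure R).
Local Notation mu3 := (lebesgue3 R).
Local Notation J := (`[0, 2 * pi]%classic : set mR).
Local Notation cellR := (@cell R).
Implicit Types (F G : P -> R).

(** The sigma-algebra of the triple product is generated by boxes, so an open set has to be
    exhibited as the countable union of the rational boxes that it contains. *)
Lemma open3_measurable (U : set P) : open U -> measurable (U : set mP).
Proof.
move=> oU.
pose box (t : rat * rat * (rat * rat) * (rat * rat)) : set mP :=
  (`]ratr t.1.1.1, ratr t.1.1.2[ `*` `]ratr t.1.2.1, ratr t.1.2.2[)
  `*` `]ratr t.2.1, ratr t.2.2[.
have -> : U = \bigcup_(t in [set t | box t `<=` U]) box t.
  apply/seteqP; split=> [p Up|p [t tU /tU//]].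
  have /nbhs_ballP[e /= e0 eU] : nbhs p U by exact: open_nbhs_nbhs.
  case: p Up eU => [[p1 p2] p3] Up eU.
  have pick (x : R) : exists t : rat * rat,
      [/\ x - e < ratr t.1, ratr t.1 < x, x < ratr t.2 & ratr t.2 < x + e].
    have [a] : exists q : rat, ratr q \in `]x - e, x[.
      by apply: rat_in_itvoo; rewrite ltrBlDr ltrDl.
    have [b] : exists q : rat, ratr q \in `]x, x + e[.
      by apply: rat_in_itvoo; rewrite ltrDl.
    by rewrite !in_itv /= => /andP[b1 b2] /andP[a1 a2]; exists (a, b).
  have [t1 [a1 b1 c1 d1]] := pick p1.
  have [t2 [a2 b2 c2 d2]] := pick p2.
  have [t3 [a3 b3 c3 d3]] := pick p3.
  exists (t1, t2, t3); last first.
    by rewrite /box /= !in_itv /= b1 c1 b2 c2 b3 c3.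
  move=> [[q1 q2] q3] /=; rewrite /box /= !in_itv /=.
  move=> [[/andP[l1 r1] /andP[l2 r2]] /andP[l3 r3]].
  by apply: eU; split; [split|]; rewrite /ball /= ltr_norml;
    apply/andP; split; lra.
rewrite bigcup_mkcond; apply: countable_bigcupT_measurable => [|t].
  exact: countableP.
case: ifPn => // _.
by apply: measurableX; [apply: measurableX|]; exact: measurable_itv.
Qed.

Lemma continuous3_measurable F : continuous F -> measurable_fun [set: mP] F.
Proof.
move=> /continuousP cF; apply: (measurability _ (RGenOpens.measurableE R)).
move=> _ [_ [a [b ->] <-]]; rewrite setTI; apply: open3_measurable.
exact/cF/interval_open.
Qed.

Lemma measurable_cell : measurable cellR.
Proof.
by apply: measurableX; [apply: measurableX|]; exact: measurable_itv.
Qed.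

Let mJ : measurable J. Proof. exact: measurable_itv. Qed.

Lemma lebesgueJ : mu J = (2 * pi)%:E.
Proof.
by rewrite /= lebesgue_measure_itv /= lte_fin mulr_gt0 ?pi_gt0// oppr0 adde0.
Qed.

Lemma lebesgue3X (A B D : set mR) : measurable A -> measurable B -> measurable D ->
  mu3 ((A `*` B) `*` D) = (mu A * mu B * mu D)%E.
Proof.
move=> mA mB mD.
transitivity (((mu \x mu)%E (A `*` B)) * mu D)%E.
  by apply: product_measure1E => //; exact: measurableX.
by congr (_ * _)%E; exact: product_measure1E.
Qed.

Lemma lebesgue3_cell : mu3 cellR = ((2 * pi) ^+ 3)%:E.
Proof.
rewrite lebesgue3X// lebesgueJ.
by rewrite -!EFinM !exprS expr0 mulr1 mulrA.
Qed.

Definition cintegrable F := mu3.-integrable cellR (EFin \o F).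

Definition cellint F : R := \int[mu3]_(p in cellR) F p.

Lemma bounded_set (T : Type) (A : set T) (f : T -> R) M :
  (forall x, A x -> `|f x| <= M) -> [bounded f x | x in A].
Proof.
move=> fM; exists M; split; first exact: num_real.
by move=> N MN x /fM/le_trans; apply; exact: ltW.
Qed.

Lemma cintegrable_bounded F M : measurable_fun cellR F ->
  (forall p, (cellR : set P) p -> `|F p| <= M) -> cintegrable F.
Proof.
move=> mF FM; apply: measurable_bounded_integrable => //.
- exact: measurable_cell.
- by rewrite lebesgue3_cell ltry.
- exact: bounded_set FM.
Qed.

Lemma cintegrable_cont F : continuous F -> cintegrable F.
Proof.
move=> cF.
have cn : {within (cellR : set P), continuous (fun p => `|F p|)}.
  by apply: continuous_subspaceT => p; apply: continuous_comp;
    [exact: cF|exact: norm_continuous].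
have [c _ cM] := compact_EVT_max (@cell_nonempty R) (@compact_cell R) cn.
apply: (@cintegrable_bounded _ `|F c|); last first.
  by move=> p cp; apply: cM; rewrite inE.
by apply: measurable_funTS; exact: continuous3_measurable.
Qed.

Lemma cintegrableD F G : cintegrable F -> cintegrable G ->
  cintegrable (fun p => F p + G p).
Proof. by move=> iF iG; apply: (integrableD measurable_cell iF iG). Qed.

Lemma cintegrableZ (c : R) F : cintegrable F -> cintegrable (fun p => c * F p).
Proof. by move=> iF; apply: (integrableZl measurable_cell c iF). Qed.

Lemma cellintD F G : cintegrable F -> cintegrable G ->
  cellint (fun p => F p + G p) = cellint F + cellint G.
Proof. by move=> iF iG; exact: (RintegralD measurable_cell iF iG). Qed.

Lemma cellintB F G : cintegrable F -> cintegrable G ->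
  cellint (fun p => F p - G p) = cellint F - cellint G.
Proof. by move=> iF iG; exact: (RintegralB measurable_cell iF iG). Qed.

Lemma cellintZ (c : R) F : cintegrable F ->
  cellint (fun p => c * F p) = c * cellint F.
Proof. by move=> iF; exact: (RintegralZl c measurable_cell iF). Qed.

Lemma cellint_cst (c : R) : cellint (fun=> c) = c * (2 * pi) ^+ 3.
Proof.
by rewrite /cellint (Rintegral_cst mu3 measurable_cell) lebesgue3_cell.
Qed.

Lemma cintegrable_sum n (F : 'I_n -> P -> R) : (forall l, cintegrable (F l)) ->
  cintegrable (fun p => \sum_(l < n) F l p).
Proof.
elim: n F => [|n IH] F iF.
  rewrite (_ : (fun p => _) = (fun=> 0)).
    by apply: cintegrable_cont; exact: cst_continuous.
  by apply/funext => p; rewrite big_ord0.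
rewrite (_ : (fun p => _) = (fun p => F ord0 p + \sum_(l < n) F (lift ord0 l) p)).
  by apply: cintegrableD => //; exact: IH.
by apply/funext => p; rewrite big_ord_recl.
Qed.

Lemma cellint_sum n (F : 'I_n -> P -> R) : (forall l, cintegrable (F l)) ->
  cellint (fun p => \sum_(l < n) F l p) = \sum_(l < n) cellint (F l).
Proof.
elim: n F => [|n IH] F iF.
  rewrite big_ord0 (_ : (fun p => _) = (fun=> 0)); last first.
    by apply/funext => p; rewrite big_ord0.
  by rewrite cellint_cst mul0r.
rewrite (_ : (fun p => _) = (fun p => F ord0 p + \sum_(l < n) F (lift ord0 l) p)).
  by rewrite cellintD ?IH ?big_ord_recl//; exact: cintegrable_sum.
by apply/funext => p; rewrite big_ord_recl.
Qed.

Lemma cellint_le F G : cintegrable F -> cintegrable G ->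
  (forall p, (cellR : set P) p -> F p <= G p) -> cellint F <= cellint G.
Proof. by move=> iF iG; exact: (le_Rintegral measurable_cell iF iG). Qed.

Lemma cellint_ge0 F : (forall p, (cellR : set P) p -> 0 <= F p) -> 0 <= cellint F.
Proof. by move=> F0; rewrite /cellint /Rintegral fine_ge0// integral_ge0. Qed.

Lemma cellint_norm F : cintegrable F -> `|cellint F| <= cellint (fun p => `|F p|).
Proof. by move=> iF; exact: (le_normr_Rintegral measurable_cell iF). Qed.

(** Supplies a side of length [r] that stays in the period even when [x] is one of its ends: it
    extends to the right of [x] in the first half of the period and to the left in the second. *)
Lemma subinterval (x r : R) : 0 <= x <= 2 * pi -> 0 < r <= pi ->
  exists a, [/\ 0 <= a, a + r <= 2 * pi, x - r <= a & a + r <= x + r].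
Proof.
move=> /andP[x0 xp] /andP[r0 rp].
by have [xpi|xpi] := leP x pi; [exists x|exists (x - r)]; split; lra.
Qed.

(** Once [p0] is moved into the cell, the cell contains a box of positive measure near it on which
    [F] is at least half its value at that point. *)
Lemma cellint_gt0 F p0 : continuous F -> per F -> (forall p, 0 <= F p) ->
  0 < F p0 -> 0 < cellint F.
Proof.
move=> cF pF F0 Fp0.
have [q qc qp] := cell_rep p0; rewrite -(pF _ _ qp) in Fp0.
have : nbhs q (F @^-1` `]F q / 2, +oo[).
  apply: cF; apply: open_nbhs_nbhs; split; first exact: interval_open.
  by rewrite /= in_itv /= andbT; lra.
move=> /nbhs_ballP[e /= e0 eF].
pose r := Num.min (e / 2) pi.
have r0 : 0 < r by rewrite lt_min divr_gt0// pi_gt0.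
have rp : 0 < r <= pi by rewrite r0 ge_min lexx orbT.
have re : r < e.
  by rewrite gt_min; apply/orP; left; lra.
case: q qc {qp Fp0} eF => [[q1 q2] q3] qc eF.
have Fq : 0 < F (q1, q2, q3).
  have : F (q1, q2, q3) \in `]F (q1, q2, q3) / 2, +oo[ by apply: eF; exact: ballxx.
  by rewrite in_itv /= andbT; lra.
move: qc; rewrite /cell /= !in_itv /= => -[[q1c q2c] q3c].
have [a1 [a10 a1p a1q a1q']] := subinterval q1c rp.
have [a2 [a20 a2p a2q a2q']] := subinterval q2c rp.
have [a3 [a30 a3p a3q a3q']] := subinterval q3c rp.
pose B : set mP := (`[a1, a1 + r] `*` `[a2, a2 + r]) `*` `[a3, a3 + r].
have mB : measurable B.
  by apply: measurableX; [apply: measurableX|]; exact: measurable_itv.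
have Bc : B `<=` cellR.
  move=> [[x1 x2] x3]; rewrite /B /cell /= !in_itv /=.
  by move=> [[/andP[? ?] /andP[? ?]] /andP[? ?]]; split; [split|]; lra.
have BF x : B x -> F (q1, q2, q3) / 2 <= F x.
  move: x => [[x1 x2] x3]; rewrite /B /= !in_itv /=.
  move=> [[/andP[? ?] /andP[? ?]] /andP[? ?]].
  suff : F (x1, x2, x3) \in `]F (q1, q2, q3) / 2, +oo[.
    by rewrite in_itv /= andbT => /ltW.
  by apply: eF; split; [split|]; rewrite /ball /= ltr_norml;
    apply/andP; split; lra.
have muB : mu3 B = (r ^+ 3)%:E.
  rewrite /B lebesgue3X//= !lebesgue_measure_itv /= !lte_fin !ltrDl r0.
  by rewrite -!EFinB -!EFinM !(addrC _ r) !addrK !exprS expr0 mulr1 mulrA.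
have : ((F (q1, q2, q3) / 2 * r ^+ 3)%:E <= \int[mu3]_(p in cellR) (F p)%:E)%E.
  rewrite EFinM -muB -integral_cst//.
  apply: (@le_trans _ _ (\int[mu3]_(p in B) (F p)%:E)%E).
    apply: ge0_le_integral => //.
    - by move=> x _; rewrite /cst lee_fin divr_ge0// ltW.
    - apply/measurable_EFinP/measurable_funTS; exact: continuous3_measurable.
  apply: (ge0_subset_integral mu3 mB measurable_cell) => //.
    by apply/measurable_EFinP/measurable_funTS; exact: continuous3_measurable.
  by move=> x _; rewrite lee_fin.
have fin := integrable_fin_num measurable_cell (cintegrable_cont cF).
rewrite -(fineK fin) lee_fin; apply: lt_le_trans.
by rewrite mulr_gt0 ?exprn_gt0// divr_gt0.
Qed.

Lemma ftc_period (g dg : R -> R) : (forall t : R, is_derive t 1 g (dg t)) ->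
  continuous dg -> g 0 = g (2 * pi) -> (\int[mu]_(t in J) (dg t)%:E = 0)%E.
Proof.
move=> gd cdg g0.
have cg : continuous g.
  move=> t; apply: differentiable_continuous; apply/derivable1_diffP.
  by case: (gd t).
rewrite (@continuous_FTC2 _ dg g).
- by rewrite g0 subee.
- by rewrite mulr_gt0// pi_gt0.
- exact: continuous_subspaceT.
- split=> [t _||]; first by case: (gd t).
    by apply: cvg_at_right_filter; exact: cg.
  by apply: cvg_at_left_filter; exact: cg.
- by move=> t _; rewrite derive1E; case: (gd t).
Qed.

Section FubiniCell.
Variables (D : P -> R) (M : R).
Hypotheses (cD : continuous D) (DM : forall p, `|D p| <= M).

Let mJJ : measurable (J `*` J). Proof. exact: measurableX. Qed.

Let section_integrable z :
  (mu \x mu)%E.-integrable (J `*` J) (EFin \o (fun x => D (x, z))).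
Proof.
have fin : ((mu \x mu) (J `*` J) < +oo)%E.
  have -> : ((mu \x mu) (J `*` J) = mu J * mu J)%E by exact: product_measure1E.
  by rewrite lebesgueJ -EFinM ltry.
apply: measurable_bounded_integrable => //.
  apply: measurable_funTS; apply: (@measurable_fun_pair1 _ _ _ _ _ _ D z).
  exact: continuous3_measurable.
by apply: (@bounded_set _ _ _ M) => x _.
Qed.

Let zero3 : (forall x, (J `*` J) x -> \int[mu]_(z in J) (D (x, z))%:E = 0)%E ->
  (\int[mu3]_(p in cellR) (D p)%:E = 0)%E.
Proof. exact: (@fubini_zero12 _ _ _ _ R (@plane_lebesgue R) mu _ _ D mJJ mJ (cintegrable_cont cD)). Qed.

Let zero12 : (forall z, J z -> \int[mu \x mu]_(x in J `*` J) (D (x, z))%:E = 0)%E ->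
  (\int[mu3]_(p in cellR) (D p)%:E = 0)%E.
Proof. exact: (@fubini_zero21 _ _ _ _ R (@plane_lebesgue R) mu _ _ D mJJ mJ (cintegrable_cont cD)). Qed.

(** Integration along axis [i] can always be performed innermost: directly for the third axis, and
    for the first two by Fubini on plane times line followed by Fubini on the plane. *)
Lemma fubini_cell i :
  (forall p, \int[mu]_(t in J) (D (p + t *: axis R i))%:E = 0)%E ->
  (\int[mu3]_(p in cellR) (D p)%:E = 0)%E.
Proof.
have E0 : i = 0 \/ i = 1 \/ i = 2.
  case: i => [[|[|[|//]]] h]; [left|right; left|right; right]; exact: val_inj.
case: E0 => [->|[->|->]] line.
- apply: zero12 => z _.
  apply: (fubini_zero21 mJ mJ (section_integrable z)) => y _.
  rewrite -[RHS](line (0, y, z)); apply: eq_integral => t _; congr ((D _)%:E).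
  by rewrite /axis /=; congr (_, _, _);
    rewrite /= /GRing.scale /= ?mulr1 ?mulr0 ?add0r ?addr0.
- apply: zero12 => z _.
  apply: (fubini_zero12 mJ mJ (section_integrable z)) => x _.
  rewrite -[RHS](line (x, 0, z)); apply: eq_integral => t _; congr ((D _)%:E).
  by rewrite /axis /=; congr (_, _, _);
    rewrite /= /GRing.scale /= ?mulr1 ?mulr0 ?add0r ?addr0.
- apply: zero3 => -[x y] _.
  rewrite -[RHS](line (x, y, 0)); apply: eq_integral => t _; congr ((D _)%:E).
  by rewrite /axis /=; congr (_, _, _);
    rewrite /= /GRing.scale /= ?mulr1 ?mulr0 ?add0r ?addr0.
Qed.

End FubiniCell.

(** The fundamental theorem of calculus over one period on every line parallel to axis [i]. *)
Lemma cellint_dpar F i : Creg 1 F -> per F -> cellint (dpar i F) = 0.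
Proof.
move=> rF pF; have cdF := Creg_cont (Creg_dpar i rF).
have [M _ HM] := per_bounded cdF (per_dpar i pF).
rewrite /cellint /Rintegral (@fubini_cell _ M cdF HM i)// => p.
apply: (@ftc_period (fun t => F (p + t *: axis R i))) => [t|t|].
- by apply: is_derive_line; exact: Creg_der rF.
- apply: (@continuous_comp _ _ _ (fun t : R => p + t *: axis R i : P) (dpar i F)).
    by apply: cvgD; [exact: cvg_cst|apply: cvgZr_tmp; exact: cvg_id].
  by apply: cdF.
- rewrite scale0r addr0; apply: pF; apply/torus_piP.
  (* The signs are negative because the starting point of the line is written as a translate of its
     end point. *)
  exists (- (i == 0)%:R, - (i == 1)%:R, - (i == 2)%:R).
  case: p => [[p1 p2] p3]; rewrite /lattice /axis /= !rmorphN /= !rmorph_nat.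
  by congr (_, _, _) => /=; rewrite /GRing.scale /=; ring.
Qed.

Lemma cellint_by_parts F G i : Creg 1 F -> Creg 1 G -> per F -> per G ->
  cellint (fun p => F p * dpar i G p) = - cellint (fun p => dpar i F p * G p).
Proof.
move=> rF rG pF pG; apply/eqP; rewrite -subr_eq0 opprK; apply/eqP.
have cF := Creg_cont rF; have cG := Creg_cont rG.
have cdF := Creg_cont (Creg_dpar i rF); have cdG := Creg_cont (Creg_dpar i rG).
rewrite -cellintD.
- rewrite -[RHS](@cellint_dpar (fun p => F p * G p) i).
  + by rewrite dparM; [congr cellint; apply/funext => p; rewrite (mulrC (G p))
      |exact: (rF.2 i).1|exact: (rG.2 i).1].
  + exact: CregM.
  + by move=> p q pq; rewrite (pF _ _ pq) (pG _ _ pq).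
- by apply: cintegrable_cont => p; apply: continuousM; [exact: cF|exact: cdG].
- by apply: cintegrable_cont => p; apply: continuousM; [exact: cdF|exact: cG].
Qed.

End CellIntegral.

(** * Composition with functions of one variable *)

Section ChainRule.
Variable R : realType.
Local Notation P := (R * R * R)%type.
Implicit Types (F G u : P -> R) (p q v : P) (i : 'I_3) (k : nat) (s t : R).

Lemma is_derive_chain (phi : R -> R) (d : R) u p v :
  is_derive (u p) 1 phi d -> derivable u p v ->
  is_derive p v (fun q => phi (u q)) (d * 'D_v u p).
Proof.
move=> dphi du; pose g h := u (p + h *: v).
have dg : is_derive (0 : R) 1 g ('D_v u p).
  have := @is_derive_line R u p v 0; rewrite scale0r addr0 => H; exact: H.
have dphi' : is_derive (g 0) 1 phi d by rewrite /g scale0r addr0.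
have [dc cE] := is_derive1_comp dphi' dg.
have E : (fun h : R => h^-1 *: (((fun q => phi (u q)) \o shift p) (h *: v) - phi (u p))) =
    (fun h : R => h^-1 *: (((phi \o g) \o shift 0) (h *: 1) - (phi \o g) 0)).
  apply/funext => h /=; rewrite /g scale0r !addr0 [h *: 1]mulr1.
  by rewrite (addrC p).
split; [by rewrite /derivable E; exact: dc|by rewrite /derive E; exact: cE].
Qed.

Lemma is_derive_horner (p : {poly R}) s : is_derive s 1 (horner p) (p^`()).[s].
Proof.
split; first exact: derivable_horner.
by rewrite -derive1E -derivE.
Qed.

(** Only the origin needs an argument: there the difference quotient is at most [|h| ^+ n.+1] in
    modulus. The exponent starts at two because the positive part itself has a corner. *)
Lemma is_derive_posX n s :
  is_derive s 1 (fun t => Num.max 0 t ^+ n.+2) (n.+2%:R * Num.max 0 s ^+ n.+1).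
Proof.
have [s0|s0|s0] := ltgtP s 0.
- rewrite expr0n /= mulr0.
  apply: (@near_eq_is_derive _ _ _ (fun=> 0 : R)).
  near=> t; rewrite max_l ?expr0n//; apply/ltW; near: t; exact: lt_nbhsl.
- have D : is_derive s 1 (fun t => t ^+ n.+2) (n.+2%:R * s ^+ n.+1).
    split; first exact: exprn_derivable.
    by rewrite exp_derive [_ *: 1]mulr1.
  apply: near_eq_is_derive D.
  near=> t; rewrite max_r//; apply/ltW; near: t; exact: lt_nbhsr.
- rewrite s0 expr0n /= mulr0.
  have H : h^-1 *: (((fun t => Num.max 0 t ^+ n.+2) \o shift (0 : R)) (h *: 1)
      - Num.max 0 (0 : R) ^+ n.+2) @[h --> 0^'] --> (0 : R).
    apply/cvgr0Pnorm_lt => e e0; near=> h.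
    rewrite /= addr0 [h *: 1]mulr1 maxxx expr0n /= subr0.
    have hn0 : h != 0 by near: h; exact: nbhs_dnbhs_neq.
    have he : `|h| < Num.min e 1.
      near: h; apply: dnbhs0_lt; by rewrite lt_min e0 ltr01.
    have /andP[he1 he2] : (`|h| < e) && (`|h| < 1) by rewrite -lt_min.
    rewrite [_ *: _]mulrC normrM normfV normrX ltr_pdivrMr ?normr_gt0//.
    have mh : `|Num.max 0 h| <= `|h|.
      by have [h0|h0] := leP 0 h; rewrite ?normr0.
    apply: (@le_lt_trans _ _ (`|h| ^+ n.+2)); first exact: lerXn2r.
    rewrite exprSr ltr_pM2r ?normr_gt0// (le_lt_trans _ he1)//.
    by rewrite exprS ler_piMr// exprn_ile1// ltW.
  split; first by apply/cvg_ex; eexists; exact: H.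
  exact: cvg_lim H.
Unshelve. all: by end_near. Qed.

Lemma dpar_comp (phi dphi : R -> R) u i : (forall s, is_derive s 1 phi (dphi s)) ->
  (forall p, derivable u p (axis R i)) ->
  dpar i (fun q => phi (u q)) = fun p => dphi (u p) * dpar i u p.
Proof.
move=> dp du; apply/funext => p.
by have [_ E] := is_derive_chain (dp (u p)) (du p); rewrite /dpar E.
Qed.

Lemma derivable_comp (phi dphi : R -> R) u p i : (forall s, is_derive s 1 phi (dphi s)) ->
  derivable u p (axis R i) -> derivable (fun q => phi (u q)) p (axis R i).
Proof.
move=> dp du.
by have [] := is_derive_chain (dp (u p)) du.
Qed.

Lemma continuous_comp_derive (phi dphi : R -> R) u : (forall s, is_derive s 1 phi (dphi s)) ->
  continuous u -> continuous (fun q => phi (u q)).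
Proof.
move=> dp cu p; apply: continuous_comp; first exact: cu.
apply: differentiable_continuous; apply/derivable1_diffP.
by have [] := dp (u p).
Qed.

(** The exponent exceeds the order of regularity by one and each derivative lowers both by one; at
    order zero what is left is the continuous positive part. *)
Lemma Creg_posX k u : Creg k u -> Creg k (fun p => Num.max 0 (u p) ^+ k.+1).
Proof.
elim: k => [|k IH] ru.
  have cm : continuous (fun p => Num.max 0 (u p)).
    by apply: (@max_fun_continuous _ _ R (fun=> 0) u); [exact: cst_continuous|exact: ru.1].
  by split=> //; rewrite (_ : (fun p => _) = fun p => Num.max 0 (u p)).
have dp := is_derive_posX k.
split; first exact: continuous_comp_derive dp (Creg_cont ru).
move=> i; split=> [p|]; first exact: derivable_comp dp (Creg_der ru).
rewrite (dpar_comp dp (@Creg_der _ _ _ _ ^~ ru)).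
apply: CregM; last exact: Creg_dpar.
by apply: CregZ; apply: IH; exact: CregW.
Qed.

Lemma Creg_horner k (p : {poly R}) u : Creg k u -> Creg k (fun q => p.[u q]).
Proof.
move=> ru; rewrite (_ : (fun q => _) = fun q => \sum_(l < size p) p`_l * u q ^+ l).
  by apply: Creg_sum => l _; apply: CregZ; exact: CregX.
by apply/funext => q; rewrite horner_coef.
Qed.

End ChainRule.

(** * Polynomial approximation of powers of the positive part *)

Section PolynomialApproximation.
Variable R : realType.
Local Notation P := (R * R * R)%type.
Implicit Types (u : P -> R) (p : {poly R}) (k : nat) (s t : R).

(* Heron-type iteration: [sqrt t - q_n] contracts by the factor
   [1 - (sqrt t + q_n) / 2 <= 1 - sqrt t / 2] at each step. *)
Fixpoint sqrt_poly (n : nat) : {poly R} :=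
  if n is n'.+1 then sqrt_poly n' + 2^-1 *: ('X - sqrt_poly n' ^+ 2) else 0.

Lemma sqrt_polyE n s : 0 <= s <= 1 ->
  0 <= (sqrt_poly n).[s ^+ 2] <= s /\
  s - (sqrt_poly n).[s ^+ 2] <= s * (1 - s / 2) ^+ n.
Proof.
move=> /andP[s0 s1]; elim: n => [|n [/andP[q0 qs] IH]] /=.
  by rewrite horner0 subr0 expr0 mulr1; split=> //; rewrite lexx s0.
rewrite !hornerE /=; set q := (sqrt_poly n).[_] in q0 qs IH *.
have E : s - (q + 2^-1 * (s ^+ 2 - q ^+ 2)) = (s - q) * (1 - (s + q) / 2) by field.
have h1 : 0 <= s - (q + 2^-1 * (s ^+ 2 - q ^+ 2)).
  by rewrite E mulr_ge0//; lra.
split.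
  apply/andP; split; last by rewrite -subr_ge0.
  rewrite addr_ge0// mulr_ge0 ?invr_ge0// subr_ge0 lerXn2r//.
rewrite E exprSr mulrA; apply: ler_pM => //; rewrite ?subr_ge0//; lra.
Qed.

(** The induction step is [(1 - a) (1 + (n + 1) a) <= 1 + n a], with defect [(n + 1) a ^+ 2]. It
    yields decay of order [1 / n] for the square root iteration. *)
Lemma bernoulli_inv n (a : R) : 0 <= a <= 1 -> (1 - a) ^+ n * (1 + n%:R * a) <= 1.
Proof.
move=> /andP[a0 a1]; elim: n => [|n IH]; first by rewrite expr0 mul0r addr0 mulr1.
apply: le_trans IH; rewrite exprSr -mulrA ler_wpM2l ?exprn_ge0 ?subr_ge0//.
rewrite -subr_ge0 (_ : _ - _ = n.+1%:R * a ^+ 2).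
  by rewrite mulr_ge0// sqr_ge0.
by rewrite -natr1; ring.
Qed.

(** The square root iteration evaluated at [s ^+ 2]. Its error is at most [|s| (1 - |s| / 2) ^+ n],
    hence at most [2 / n], uniformly up to the corner, where the contraction factor tends to 1 but
    [|s|] is small. *)
Lemma abs_poly (e : R) : 0 < e -> exists p, forall s, `|s| <= 1 ->
  `|p.[s] - `|s| | <= e.
Proof.
move=> e0; pose n := (Num.truncn (2 / e)).+1.
have ne : 2 / e < n%:R by rewrite -truncn_le_nat//.
exists ((sqrt_poly n) \Po 'X^2) => s s1.
have s01 : 0 <= `|s| <= 1 by rewrite normr_ge0.
have [/andP[q0 qs] qe] := sqrt_polyE n s01.
rewrite horner_comp hornerXn -(real_normK (num_real s)) distrC.
rewrite [X in X <= _]ger0_norm ?subr_ge0//.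
apply: (le_trans qe).
have b : 0 <= `|s| / 2 <= 1 by lra.
have := bernoulli_inv n b; set r := (_ ^+ n) => H.
have r0 : 0 <= r by rewrite exprn_ge0// subr_ge0; lra.
have : `|s| * r * n%:R <= 2.
  by apply: le_trans (_ : 2 * (r * (1 + n%:R * (`|s| / 2))) <= _); nra.
rewrite -ler_pdivlMr ?ltr0n// => /le_trans; apply.
rewrite ler_pdivrMr ?ltr0n//; move: ne; rewrite ltr_pdivrMr//; nra.
Qed.

Lemma pos_poly (A e : R) : 0 < A -> 0 < e -> exists p, forall s, `|s| <= A ->
  `|p.[s] - Num.max 0 s| <= e.
Proof.
move=> A0 e0; have [|p Hp] := @abs_poly (2 * e / A); first by rewrite divr_gt0// mulr_gt0.
exists (2^-1 *: ('X + A *: (p \Po (A^-1 *: 'X)))) => s sA.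
rewrite !hornerE horner_comp !hornerE.
have sA1 : `|A^-1 * s| <= 1.
  by rewrite normrM normfV (gtr0_norm A0) mulrC ler_pdivrMr// mul1r.
have := Hp _ sA1; rewrite normrM normfV (gtr0_norm A0).
have -> : Num.max 0 s = 2^-1 * (s + `|s|).
  by have [s0|s0] := leP 0 s; rewrite ?(ger0_norm s0) ?(ltr0_norm s0); field.
set y := p.[_] => H.
have -> : 2^-1 * (s + A * y) - 2^-1 * (s + `|s|) = A / 2 * (y - A^-1 * `|s|).
  by field; rewrite gt_eqF.
rewrite normrM ger0_norm; last by rewrite divr_ge0// ltW.
rewrite -ler_pdivlMl; last by rewrite divr_gt0.
apply: le_trans H _; rewrite le_eqVlt; apply/orP; left; apply/eqP; field.
by rewrite gt_eqF.
Qed.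

Definition prim (p : {poly R}) : {poly R} :=
  \poly_(i < (size p).+1) (if i is j.+1 then p`_j / j.+1%:R else 0).

Lemma deriv_prim p : (prim p)^`() = p.
Proof.
apply/polyP => i; rewrite coef_deriv coef_poly ltnS.
case: ltnP => [ip|pi]; last by rewrite mul0rn nth_default.
by rewrite -[LHS]mulr_natr divfK// pnatr_eq0.
Qed.

Lemma prim0 p : (prim p).[0] = 0.
Proof. by rewrite horner_coef0 coef_poly. Qed.

Lemma mvt_bound (h dh : R -> R) (A e : R) : (forall s, is_derive s 1 h (dh s)) ->
  h 0 = 0 -> (forall s, `|s| <= A -> `|dh s| <= e) -> forall s, `|s| <= A -> `|h s| <= A * e.
Proof.
move=> hd h0 he s sA.
have ch a b : {within `[a, b], continuous h}.
  apply: continuous_subspaceT => t; apply: differentiable_continuous.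
  by apply/derivable1_diffP; case: (hd t).
have [s0|s0] := leP 0 s.
  have [c] := MVT_segment s0 (fun x _ => hd x) (ch _ _).
  rewrite in_itv /= h0 !subr0 => /andP[c0 cs] ->; rewrite normrM mulrC ler_pM//.
  by apply: he; rewrite ger0_norm// (le_trans cs)// -(ger0_norm s0).
have [c] := MVT_segment (ltW s0) (fun x _ => hd x) (ch _ _).
rewrite in_itv /= h0 !sub0r => /andP[cs c0].
move=> /(congr1 (fun x : R => `|x|)); rewrite normrN => ->.
rewrite normrM normrN mulrC ler_pM//.
by apply: he; rewrite ler0_norm// (le_trans _ sA)// (ltr0_norm s0) lerN2.
Qed.

(** Up to the factor [k.+2], the next power of the positive part is the primitive of the previous
    one, so the next approximant is obtained by integrating from 0. The mean value theorem controls
    its error at order zero and the chain rule at higher orders; the induction therefore carries the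
    uniform estimate on the interval along with the C^k estimate along [u]. *)
Lemma posX_poly k u (A e : R) : 0 < A -> 0 < e -> Creg k u -> per u ->
  (forall q, `|u q| <= A) -> exists p : {poly R},
  (forall s, `|s| <= A -> `|p.[s] - Num.max 0 s ^+ k.+1| <= e) /\
  bnd setT k e (fun q => p.[u q] - Num.max 0 (u q) ^+ k.+1).
Proof.
move=> A0 + ru pu uA; elim: k ru e => [|k IH] ru e e0.
  have [p Hp] := pos_poly A0 e0.
  by exists p; split=> //; split=> // q _; rewrite Hp.
have [N N0 bN] := Creg_bnd ru pu.
have k2 : 0 < k.+2%:R :> R by rewrite ltr0n.
(* The first term pays for the mean value estimate over a length [A], the second for the Leibniz
   constant and the bound [N] on the derivatives of [u]. *)
pose e' := Num.min (e / (k.+2%:R * A)) (e / (2 ^+ k * (k.+2%:R * N))).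
have e'0 : 0 < e'.
  by rewrite lt_min !divr_gt0 ?mulr_gt0 ?exprn_gt0 ?ltr0n.
have [q [q1 q2]] := IH (CregW ru) e' e'0.
have dq (s : R) : is_derive s 1 (fun s => (k.+2%:R *: prim q).[s] - Num.max 0 s ^+ k.+2)
    (k.+2%:R * (q.[s] - Num.max 0 s ^+ k.+1)).
  rewrite mulrBr; apply: is_deriveB; last exact: is_derive_posX.
  by have := is_derive_horner (k.+2%:R *: prim q) s; rewrite derivZ hornerZ deriv_prim.
have bd s : `|s| <= A -> `|(k.+2%:R *: prim q).[s] - Num.max 0 s ^+ k.+2| <= e.
  move=> sA.
  have : `|(k.+2%:R *: prim q).[s] - Num.max 0 s ^+ k.+2| <= A * (k.+2%:R * e').
    apply: (mvt_bound dq) sA.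
      by rewrite hornerZ prim0 maxxx expr0n mulr0 subr0.
    by move=> t tA; rewrite normrM ger0_norm ?ler0n// ler_wpM2l ?ler0n// q1.
  move=> /le_trans; apply; rewrite mulrCA mulrA mulrC -ler_pdivlMr ?mulr_gt0//.
  by rewrite ge_min lexx.
exists (k.+2%:R *: prim q); split=> //; split=> [p _|i]; first exact: bd.
rewrite (dpar_comp dq (@Creg_der _ _ _ _ ^~ ru)).
have r1 : Creg k (fun z => q.[u z] - Num.max 0 (u z) ^+ k.+1).
  by apply: CregB; [exact/Creg_horner/CregW|exact/Creg_posX/CregW].
apply: (@bnd_le _ _ _ (2 ^+ k * ((`|k.+2%:R| * e') * N))).
  rewrite ger0_norm ?ler0n// mulrAC mulrA -ler_pdivlMl ?mulr_gt0 ?exprn_gt0//.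
  by rewrite mulrC ge_min lexx orbT.
by apply: bndM (bnd_dpar i bN); [exact: CregZ|exact: Creg_dpar|exact: bndZ].
Qed.

End PolynomialApproximation.

(** * Nachbin's theorem for periodic functions *)

Section GeometricDecay.
Variable R : realType.
Local Notation P := (R * R * R)%type.
Implicit Types (g : P -> R) (k n : nat).

Lemma bernoulli (a : R) n : 0 <= a -> 1 + n%:R * a <= (1 + a) ^+ n.
Proof.
move=> a0; elim: n => [|n IH]; first by rewrite mul0r addr0 expr0.
rewrite exprS -natr1; have a1 : 0 <= 1 + a by rewrite addr_ge0.
apply: le_trans (ler_wpM2l a1 IH).
rewrite -subr_ge0 (_ : _ - _ = n%:R * a ^+ 2); last by ring.
by rewrite mulr_ge0// sqr_ge0.
Qed.

(** A larger ratio absorbs the linear factor: for [t = s (1 + a)], Bernoulli's inequality gives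
    [n + 1 <= (1 + a^-1) (1 + a) ^+ n]. *)
Lemma natmul_geometric (s t : R) : 0 <= s -> s < t ->
  exists2 K, 0 < K & forall n, n.+1%:R * s ^+ n <= K * t ^+ n.
Proof.
move=> s0 st; have t0 := le_lt_trans s0 st.
have [s00|s1] := eqVneq s 0.
  exists 1 => // n; rewrite mul1r s00; case: n => [|n].
    by rewrite !expr0 mulr1.
  by rewrite expr0n mulr0 exprn_ge0// ltW.
have {s1}s0' : 0 < s by rewrite lt_neqAle eq_sym s1.
pose a := t / s - 1; have a0 : 0 < a by rewrite subr_gt0 ltr_pdivlMr// mul1r.
have tE : t = s * (1 + a) by rewrite /a addrCA subrr addr0 mulrC divfK// gt_eqF.
exists (1 + a^-1) => [|n]; first by rewrite addr_gt0// invr_gt0.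
rewrite {1}tE exprMn mulrCA [leLHS]mulrC ler_pM2l ?exprn_gt0//.
apply: le_trans (ler_wpM2l _ (bernoulli n (ltW a0))); last first.
  by rewrite addr_ge0// invr_ge0 ltW.
rewrite -natr1 -subr_ge0 (_ : _ - _ = a^-1 + n%:R * a); last first.
  by field; rewrite gt_eqF.
by rewrite addr_ge0 ?invr_ge0 ?mulr_ge0// ltW.
Qed.

Lemma geometric_small (t e : R) : 0 <= t -> t < 1 -> 0 < e ->
  exists n, forall m, (n <= m)%N -> t ^+ m <= e.
Proof.
move=> t0 t1 e0.
have [K K0 HK] := natmul_geometric t0 t1.
exists (Num.truncn (K / e)) => m nm.
have : K / e < m.+1%:R by apply: lt_le_trans (truncnS_gt _) _; rewrite ler_nat.
rewrite ltr_pdivrMr// => Ke.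
have := HK m; rewrite expr1n mulr1 => Hm.
rewrite -(@ler_pM2l _ m.+1%:R) ?ltr0n//; apply: le_trans Hm (ltW Ke).
Qed.

(** Differentiating the power [n.+1] costs a factor [n.+1], absorbed by passing from the
    intermediate ratio [t'] to [t]; this is why room is left between [s] and [t]. *)
Lemma bnd_geometric k g (s t : R) : Creg k g -> per g -> 0 <= s -> s < t ->
  (forall p, `|g p| <= s) ->
  exists2 K, 0 < K & forall n, bnd setT k (K * t ^+ n) (fun p => g p ^+ n).
Proof.
elim: k g s t => [|k IH] g s t rg pg s0 st gs; have t0 := le_lt_trans s0 st.
  exists 1 => // n; split=> // p _; rewrite mul1r normrX lerXn2r ?nnegrE//.
    exact: ltW.
  exact: le_trans (gs p) (ltW st).
pose t' := (s + t) / 2.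
have st' : s < t' by rewrite /t'; lra.
have tt' : t' < t by rewrite /t'; lra.
have t'0 := le_lt_trans s0 st'.
have [K1 K10 HK1] := IH g s t' (CregW rg) pg s0 st' gs.
have [K2 K20 HK2] := natmul_geometric (ltW t'0) tt'.
have [N N0 bN] := Creg_bnd rg pg.
pose K3 := 2 ^+ k * (K1 * (K2 / t) * N).
have K30 : 0 < K3 by rewrite !mulr_gt0 ?exprn_gt0 ?invr_gt0.
exists (1 + K3) => [|n]; first by rewrite addr_gt0.
have tn0 : 0 <= t ^+ n by rewrite exprn_ge0// ltW.
split=> [p _|i].
  apply: (@le_trans _ _ (t ^+ n)); last by rewrite ler_peMl// lerDl ltW.
  rewrite normrX lerXn2r ?nnegrE//; first exact: ltW.
  exact: le_trans (gs p) (ltW st).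
case: n tn0 => [|n] tn0.
  rewrite (_ : (fun p => _) = fun=> 1)// dpar_cst; apply: bnd_cst.
  by rewrite normr0 mulr1 addr_ge0// ltW.
rewrite (dparX (@Creg_der _ _ _ _ ^~ rg)).
have rgn : Creg k (fun p => g p ^+ n) by apply: CregX; exact: CregW.
apply: (@bnd_le _ _ _ (2 ^+ k * ((`|n.+1%:R| * (K1 * t' ^+ n)) * N))); last first.
  by apply: bndM (bnd_dpar i bN); [exact: CregZ|exact: Creg_dpar|exact: bndZ].
apply: (@le_trans _ _ (K3 * t ^+ n.+1)); last first.
  by rewrite ler_wpM2r// lerDr.
rewrite /K3 -[leRHS]mulrA ler_pM2l ?exprn_gt0//.
rewrite (mulrAC _ N) ler_pM2r// ger0_norm ?ler0n// mulrCA -[leRHS]mulrA ler_pM2l//.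
by rewrite exprS mulrA divfK ?gt_eqF.
Qed.

End GeometricDecay.

(** * The closure of a function algebra in C^k, and kernels over the algebra *)

Section Closure.
Variable R : realType.
Local Notation P := (R * R * R)%type.
Variable Q : set (P -> R).
Implicit Types (F G f : P -> R) (k n : nat) (i : 'I_3).

Definition periodic_algebra : Prop :=
  [/\ forall c : R, Q (fun=> c),
      forall F G, Q F -> Q G -> Q (fun p => F p + G p),
      forall F G, Q F -> Q G -> Q (fun p => F p * G p) &
      forall F, Q F -> per F /\ forall k, Creg k F].

Definition clo k F : Prop :=
  [/\ Creg k F, per F & forall e : R, 0 < e ->
      exists2 w, Q w & bnd setT k e (fun p => F p - w p)].

Hypothesis aQ : periodic_algebra.

Let Qc (c : R) : Q (fun=> c). Proof. by case: aQ. Qed.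
Let QD F G : Q F -> Q G -> Q (fun p => F p + G p).
Proof. by case: aQ => _ + _ _; exact. Qed.
Let QM F G : Q F -> Q G -> Q (fun p => F p * G p).
Proof. by case: aQ => _ _ + _; exact. Qed.
Let Qper F : Q F -> per F. Proof. by case: aQ => _ _ _ /[apply] -[]. Qed.
Let Qreg F k : Q F -> Creg k F. Proof. by case: aQ => _ _ _ /[apply] -[]. Qed.

Lemma clo_sub k F : Q F -> clo k F.
Proof.
move=> QF; split; [exact: Qreg|exact: Qper|move=> e e0; exists F => //].
rewrite (_ : (fun p => _) = fun=> 0); last by apply/funext => p; rewrite subrr.
by apply: bnd_cst; rewrite normr0 ltW.
Qed.

Lemma clo_clo k F : Creg k F -> per F ->
  (forall e : R, 0 < e -> exists2 w, clo k w & bnd setT k e (fun p => F p - w p)) ->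
  clo k F.
Proof.
move=> rF pF H; split=> // e e0; have e20 : 0 < e / 2 by rewrite divr_gt0.
have [w [rw pw /(_ _ e20)[v Qv vb]] wb] := H _ e20; exists v => //.
rewrite (_ : (fun p => _) = fun p => (F p - w p) + (w p - v p)).
  by rewrite [e]splitr; apply: bndD => //; apply: CregB => //; exact: Qreg.
by apply/funext => p; rewrite addrA subrK.
Qed.

Lemma cloD k F G : clo k F -> clo k G -> clo k (fun p => F p + G p).
Proof.
move=> [rF pF aF] [rG pG aG]; split; first exact: CregD.
  by move=> p q pq; rewrite (pF _ _ pq) (pG _ _ pq).
move=> e e0; have e20 : 0 < e / 2 by rewrite divr_gt0.
have [w Qw wb] := aF _ e20; have [v Qv vb] := aG _ e20.
exists (fun p => w p + v p); first exact: QD.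
rewrite (_ : (fun p => _) = fun p => (F p - w p) + (G p - v p)).
  by rewrite [e]splitr; apply: bndD => //; apply: CregB => //; exact: Qreg.
by apply/funext => p; rewrite opprD addrACA.
Qed.

Lemma cloM k F G : clo k F -> clo k G -> clo k (fun p => F p * G p).
Proof.
move=> [rF pF aF] [rG pG aG]; split; first exact: CregM.
  by move=> p q pq; rewrite (pF _ _ pq) (pG _ _ pq).
move=> e e0.
have [M M0 bM] := Creg_bnd rF pF; have [N N0 bN] := Creg_bnd rG pG.
have D0 : 0 < 2 ^+ k * (M + N + 1) by rewrite mulr_gt0 ?exprn_gt0// !addr_gt0.
pose d := Num.min 1 (e / (2 ^+ k * (M + N + 1))).
have d0 : 0 < d by rewrite lt_min ltr01 divr_gt0.
have d1 : d <= 1 by rewrite ge_min lexx.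
have de : d * (2 ^+ k * (M + N + 1)) <= e.
  by rewrite -ler_pdivlMr// ge_min lexx orbT.
have [w Qw wb] := aF _ d0; have [v Qv vb] := aG _ d0.
exists (fun p => w p * v p); first exact: QM.
have rw : Creg k w by exact: Qreg.
have rv : Creg k v by exact: Qreg.
have bv : bnd setT k (N + d) v.
  rewrite (_ : v = fun p => G p - (G p - v p)); last first.
    by apply/funext => p; rewrite subKr.
  by apply: bndB => //; exact: CregB.
rewrite (_ : (fun p => _) = fun p => F p * (G p - v p) + (F p - w p) * v p); last first.
  by apply/funext => p; ring.
apply: (@bnd_le _ _ _ (2 ^+ k * (M * d) + 2 ^+ k * (d * (N + d)))).
  apply: le_trans de; rewrite -mulrDr mulrCA ler_pM2l ?exprn_gt0//; nra.
by apply: bndD; [apply: CregM|apply: CregM|apply: bndM|apply: bndM] => //;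
  exact: CregB.
Qed.

Lemma clo_cst k (c : R) : clo k (fun=> c).
Proof. exact: clo_sub. Qed.

Lemma cloZ k (c : R) F : clo k F -> clo k (fun p => c * F p).
Proof. by move=> cF; apply: cloM => //; exact: clo_cst. Qed.

Lemma cloB k F G : clo k F -> clo k G -> clo k (fun p => F p - G p).
Proof.
move=> cF /(cloZ (-1)) cG; have := cloD cF cG; congr clo.
by apply/funext => p; rewrite mulN1r.
Qed.

Lemma clo_sum k n (F : 'I_n -> P -> R) : (forall l, clo k (F l)) ->
  clo k (fun p => \sum_(l < n) F l p).
Proof.
elim: n F => [|n IH] F cF.
  rewrite (_ : (fun p => _) = fun=> 0); first exact: clo_cst.
  by apply/funext => p; rewrite big_ord0.
rewrite (_ : (fun p => _) = (fun p => F ord0 p + \sum_(l < n) F (lift ord0 l) p)).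
  by apply: cloD => //; exact: IH.
by apply/funext => p; rewrite big_ord_recl.
Qed.

Lemma cloX k F n : clo k F -> clo k (fun p => F p ^+ n).
Proof.
move=> cF; elim: n => [|n IH].
  by rewrite (_ : (fun p => _) = fun=> 1)//; exact: clo_cst.
rewrite (_ : (fun p => _) = fun p => F p * F p ^+ n); first exact: cloM.
by apply/funext => p; rewrite exprS.
Qed.

Lemma clo_horner k (p : {poly R}) F : clo k F -> clo k (fun q => p.[F q]).
Proof.
move=> cF; rewrite (_ : (fun q => _) = fun q => \sum_(l < size p) p`_l * F q ^+ l).
  by apply: clo_sum => l; apply: cloZ; exact: cloX.
by apply/funext => q; rewrite horner_coef.
Qed.

Lemma clo_posX k F : clo k F -> clo k (fun p => Num.max 0 (F p) ^+ k.+1).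
Proof.
move=> cF; have [rF pF _] := cF.
have [A A0 FA] := per_bounded (Creg_cont rF) pF.
apply: clo_clo => [||e e0]; first exact: Creg_posX.
  by move=> p q pq; rewrite (pF _ _ pq).
have [p [_ Hp]] := posX_poly A0 e0 rF pF FA.
exists (fun q => p.[F q]); first exact: clo_horner.
rewrite (_ : (fun q => _) = fun q => - (p.[F q] - Num.max 0 (F q) ^+ k.+1)).
  by apply: bndN => //; apply: CregB; [exact: Creg_horner|exact: Creg_posX].
by apply/funext => q; rewrite opprB.
Qed.

(** Neumann series: with [g = 1 - F / C] for an upper bound [C], the inverse of [F] differs from
    [C^-1] times the partial geometric sum by [g ^+ n / F]. A positive lower bound of [F] keeps [g]
    away from 1, so the powers decay in C^k. *)
Lemma cloV k F : clo k F -> (forall p, 0 < F p) -> clo k (fun p => (F p)^-1).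
Proof.
move=> cF F0; have [rF pF _] := cF.
have [C C0 FC] := per_bounded (Creg_cont rF) pF.
have [c c0 Fc] := per_pos_min (Creg_cont rF) pF F0.
have Fn p : F p != 0 by rewrite gt_eqF.
have rV := CregV Fn rF.
have pV : per (fun p => (F p)^-1) by move=> p q pq; rewrite (pF _ _ pq).
pose g p := 1 - C^-1 * F p.
have cg : clo k g by apply: cloB; [exact: clo_cst|exact: cloZ].
have [rg pg _] := cg.
pose s := 1 - c / C.
have FCle p : F p <= C by rewrite (le_trans _ (FC p))// ler_norm.
have cC : c <= C by rewrite (le_trans (Fc 0))// FCle.
have s0 : 0 <= s by rewrite subr_ge0 ler_pdivrMr// mul1r.
have s1 : s < 1 by rewrite gtrBl divr_gt0.
have gs p : `|g p| <= s.
  have h1 : C^-1 * F p <= 1 by rewrite mulrC ler_pdivrMr// mul1r.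
  have h2 : c / C <= C^-1 * F p by rewrite mulrC ler_pM2l ?invr_gt0.
  by rewrite ger0_norm /g /s; lra.
pose t := (s + 1) / 2.
have st : s < t by rewrite /t; lra.
have t1 : t < 1 by rewrite /t; lra.
have [K K0 HK] := bnd_geometric rg pg s0 st gs.
have [N N0 bN] := Creg_bnd rV pV.
apply: clo_clo => // e e0.
have D0 : 0 < 2 ^+ k * (K * N) by rewrite !mulr_gt0 ?exprn_gt0.
have [n Hn] := geometric_small (le_trans s0 (ltW st)) t1 (divr_gt0 e0 D0).
exists (fun p => C^-1 * \sum_(l < n) g p ^+ l).
  by apply: cloZ; apply: clo_sum => l; exact: cloX.
rewrite (_ : (fun p => _) = fun p => g p ^+ n * (F p)^-1); last first.
  apply/funext => p; have := subrX1 (g p) n.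
  rewrite (_ : g p - 1 = - (C^-1 * F p)); last by rewrite /g addrAC subrr sub0r.
  move=> E; have -> : g p ^+ n = 1 - C^-1 * F p * \sum_(i < n) g p ^+ i.
    by rewrite -mulNr -E addrCA subrr addr0.
  by field; rewrite Fn gt_eqF.
apply: (@bnd_le _ _ _ (2 ^+ k * ((K * t ^+ n) * N))); last first.
  by apply: bndM => //; exact: CregX.
have := Hn n (leqnn n); rewrite ler_pdivlMr//; apply: le_trans.
by rewrite le_eqVlt; apply/orP; left; apply/eqP; ring.
Qed.

(* Finite sums of products: integration in one variable then commutes with
   everything done in the other without any Fubini argument. *)
Inductive tensor : (P -> P -> R) -> Prop :=
| tensor0 : tensor (fun _ _ => 0)
| tensorS q r K : Q q -> continuous r -> per r -> tensor K ->
    tensor (fun x y => q x * r y + K x y).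

Let funext2 (K L : P -> P -> R) : (forall x y, K x y = L x y) -> K = L.
Proof. by move=> H; apply/funext => x; apply/funext => y. Qed.

Lemma tensorD K L : tensor K -> tensor L -> tensor (fun x y => K x y + L x y).
Proof.
move=> tK tL; elim: tK => [|q r {}K Qq cr pr _ IH].
  by rewrite (_ : (fun x y => _) = L)//; apply: funext2 => x y; rewrite add0r.
rewrite (_ : (fun x y => _) = fun x y => q x * r y + (K x y + L x y)).
  exact: tensorS.
by apply: funext2 => x y; rewrite addrA.
Qed.

Lemma tensor1 q r : Q q -> continuous r -> per r -> tensor (fun x y => q x * r y).
Proof.
move=> Qq cr pr; rewrite (_ : (fun x y => _) = fun x y => q x * r y + 0).
  exact: (tensorS Qq cr pr tensor0).
by apply: funext2 => x y; rewrite addr0.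
Qed.

Lemma tensorM K L : tensor K -> tensor L -> tensor (fun x y => K x y * L x y).
Proof.
move=> tK tL; elim: tK => [|q r {}K Qq cr pr _ IH].
  rewrite (_ : (fun x y => _) = fun _ _ => 0); first exact: tensor0.
  by apply: funext2 => x y; rewrite mul0r.
rewrite (_ : (fun x y => _) = fun x y => (q x * r y) * L x y + (K x y * L x y)).
  apply: tensorD IH; elim: tL => [|q' r' {}L Qq' cr' pr' _ IH].
    rewrite (_ : (fun x y => _) = fun _ _ => 0); first exact: tensor0.
    by apply: funext2 => x y; rewrite mulr0.
  rewrite (_ : (fun x y => _) =
      fun x y => (q x * q' x) * (r y * r' y) + (q x * r y) * L x y).
    apply: tensorS => //; first exact: QM.
      by move=> p; apply: continuousM; [exact: cr|exact: cr'].
    by move=> p p' pp; rewrite (pr _ _ pp) (pr' _ _ pp).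
  by apply: funext2 => x y; ring.
by apply: funext2 => x y; rewrite mulrDl.
Qed.

Lemma tensorX K n : tensor K -> tensor (fun x y => K x y ^+ n).
Proof.
move=> tK; elim: n => [|n IH].
  rewrite (_ : (fun x y => _) = fun x y => (fun=> 1) x * (fun=> 1) y).
    by apply: tensor1 => //; exact: cst_continuous.
  by apply: funext2 => x y; rewrite expr0 mulr1.
rewrite (_ : (fun x y => _) = fun x y => K x y * K x y ^+ n); first exact: tensorM.
by apply: funext2 => x y; rewrite exprS.
Qed.

Lemma tensor_sum n (K : 'I_n -> P -> P -> R) : (forall l, tensor (K l)) ->
  tensor (fun x y => \sum_(l < n) K l x y).
Proof.
elim: n K => [|n IH] K tK.
  rewrite (_ : (fun x y => _) = fun _ _ => 0); first exact: tensor0.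
  by apply: funext2 => x y; rewrite big_ord0.
rewrite (_ : (fun x y => _) =
    fun x y => K ord0 x y + \sum_(l < n) K (lift ord0 l) x y).
  by apply: tensorD => //; exact: IH.
by apply: funext2 => x y; rewrite big_ord_recl.
Qed.

Lemma tensor_contr K x : tensor K -> continuous (K x).
Proof.
elim=> [|q r {}K Qq cr pr _ IH]; first exact: cst_continuous.
move=> p; apply: (@continuousD _ _ _ (fun y => q x * r y)); last exact: IH.
by apply: continuousM; [exact: cst_continuous|exact: cr].
Qed.

Lemma tensor_perr K x : tensor K -> per (K x).
Proof.
by elim=> [//|q r {}K Qq cr pr _ IH] p p' pp; rewrite (pr _ _ pp) (IH _ _ pp).
Qed.

Lemma tensor_regl K y : tensor K -> Q (K^~ y).
Proof.
elim=> [|q r {}K Qq cr pr _ IH]; first exact: Qc.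
apply: QD => //; rewrite (_ : (fun x => _) = fun x => q x * (fun=> r y) x)//.
exact: QM.
Qed.

(** The integrability needed to integrate [f] against a tensor. It covers continuous [f], for
    density in C^k, and square-integrable [f], for the Sobolev space. *)
Definition pairs_with_continuous f : Prop :=
  forall r, continuous r -> per r -> cintegrable (fun y => f y * r y).

Lemma continuous_pairs f : continuous f -> pairs_with_continuous f.
Proof.
move=> cf r cr _; apply: cintegrable_cont => p.
by apply: continuousM; [exact: cf|exact: cr].
Qed.

Variable f : P -> R.
Hypothesis fadm : pairs_with_continuous f.

Lemma tensor_integrable K x : tensor K -> cintegrable (fun y => f y * K x y).
Proof. by move=> tK; apply: fadm; [exact: tensor_contr|exact: tensor_perr]. Qed.

Let intS q r K x : Q q -> continuous r -> per r -> tensor K ->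
  cellint (fun y => f y * (q x * r y + K x y)) =
  q x * cellint (fun y => f y * r y) + cellint (fun y => f y * K x y).
Proof.
move=> Qq cr pr tK; rewrite -cellintZ; last exact: fadm.
rewrite -cellintD; [|exact/cintegrableZ/fadm|exact: tensor_integrable].
by congr cellint; apply/funext => y; ring.
Qed.

(** For a finite sum of products the integral is a finite linear combination of left factors, so it
    lies in [Q] itself and not only in a closure. *)
Lemma tensor_int K : tensor K -> Q (fun x => cellint (fun y => f y * K x y)).
Proof.
elim=> [|q r {}K Qq cr pr tK IH].
  rewrite (_ : (fun x => _) = fun=> 0)//; apply/funext => x.
  rewrite (_ : (fun y => _) = fun=> 0) ?cellint_cst ?mul0r//.
  by apply/funext => y; rewrite mulr0.
rewrite (_ : (fun x => _) = fun x => (q x * (fun=> cellint (fun y => f y * r y)) x)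
    + cellint (fun y => f y * K x y)).
  by apply: QD => //; exact: QM.
by apply/funext => x; rewrite intS.
Qed.

(** Differentiation under the integral sign reduces to linearity. *)
Lemma tensor_int_dpar K i x : tensor K ->
  cintegrable (fun y => f y * dpar i (K^~ y) x) /\
  dpar i (fun x => cellint (fun y => f y * K x y)) x =
  cellint (fun y => f y * dpar i (K^~ y) x).
Proof.
elim=> [|q r {}K Qq cr pr tK [IH1 IH2]].
  have E : (fun y => f y * dpar i (fun=> 0) x) = fun=> 0.
    by apply/funext => y; rewrite dpar_cst mulr0.
  rewrite E; split; first by apply: cintegrable_cont; exact: cst_continuous.
  rewrite (_ : (fun x => _) = fun=> 0) ?dpar_cst ?cellint_cst ?mul0r//.
  apply/funext => z; rewrite (_ : (fun y => _) = fun=> 0) ?cellint_cst ?mul0r//.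
  by apply/funext => y; rewrite mulr0.
have dq p : derivable q p (axis R i) by exact: Creg_der (Qreg 1 Qq).
have dK y p : derivable (K^~ y) p (axis R i).
  exact: Creg_der (Qreg 1 (tensor_regl y tK)).
have E : (fun y => f y * dpar i (fun x => q x * r y + K x y) x) =
    fun y => dpar i q x * (f y * r y) + f y * dpar i (K^~ y) x.
  apply/funext => y.
  rewrite (@dparD _ (fun x => q x * r y)) => [|p|]; last exact: dK.
    rewrite (_ : (fun x => q x * r y) = fun x => r y * q x); last first.
      by apply/funext => z; rewrite mulrC.
    by rewrite dparZ//; ring.
  by apply: derivableM => //; exact: derivable_cst.
rewrite E; split.
  by apply: cintegrableD => //; apply: cintegrableZ; exact: fadm.
rewrite cellintD//; last by apply: cintegrableZ; exact: fadm.
rewrite cellintZ; last exact: fadm.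
rewrite -IH2 (_ : (fun x => _) = fun x => cellint (fun y => f y * r y) * q x
    + cellint (fun y => f y * K x y)); last first.
  by apply/funext => z; rewrite intS// mulrC.
rewrite dparD => [|p|p].
- by rewrite dparZ// mulrC.
- by apply: derivableM => //; exact: derivable_cst.
- exact: Creg_der (Qreg 1 (tensor_int tK)).
Qed.

End Closure.

(** * Continuity of algebraic expressions *)

Section ContinuousAlgebra.
Variables (R : realType) (T : topologicalType).
Implicit Types F G : T -> R.

Lemma contD F G : continuous F -> continuous G -> continuous (fun p => F p + G p).
Proof. by move=> cF cG p; apply: continuousD; [exact: cF|exact: cG]. Qed.

Lemma contB F G : continuous F -> continuous G -> continuous (fun p => F p - G p).
Proof. by move=> cF cG p; apply: continuousB; [exact: cF|exact: cG]. Qed.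

Lemma contM F G : continuous F -> continuous G -> continuous (fun p => F p * G p).
Proof. by move=> cF cG p; apply: continuousM; [exact: cF|exact: cG]. Qed.

Lemma contX F n : continuous F -> continuous (fun p => F p ^+ n).
Proof.
move=> cF; elim: n => [|n IH]; first exact: cst_continuous.
rewrite (_ : (fun p => _) = fun p => F p * F p ^+ n); first exact: contM.
by apply/funext => p; rewrite exprS.
Qed.

Lemma cont_norm F : continuous F -> continuous (fun p => `|F p|).
Proof.
by move=> cF p; apply: continuous_comp; [exact: cF|exact: norm_continuous].
Qed.

Lemma cont_max0 F : continuous F -> continuous (fun p => Num.max 0 (F p)).
Proof.
by move=> cF; apply: (@max_fun_continuous _ _ R (fun=> 0) F);
  [exact: cst_continuous|exact: cF].
Qed.

Lemma cont_sum n (F : 'I_n -> T -> R) : (forall l, continuous (F l)) ->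
  continuous (fun p => \sum_(l < n) F l p).
Proof.
elim: n F => [|n IH] F cF.
  rewrite (_ : (fun p => _) = fun=> 0); first exact: cst_continuous.
  by apply/funext => p; rewrite big_ord0.
rewrite (_ : (fun p => _) = (fun p => F ord0 p + \sum_(l < n) F (lift ord0 l) p)).
  by apply: contD => //; exact: IH.
by apply/funext => p; rewrite big_ord_recl.
Qed.

End ContinuousAlgebra.

Ltac cont := lazymatch goal with
  | |- continuous (fun=> ?c) => exact: cst_continuous
  | |- continuous (fun p => _ - _) => apply: contB; cont
  | |- continuous (fun p => _ + _) => apply: contD; cont
  | |- continuous (fun p => _ * _) => apply: contM; cont
  | |- continuous (fun p => _ ^+ _) => apply: contX; cont
  | |- continuous (fun p => `|_|) => apply: cont_norm; cont
  | |- continuous (fun p => Num.max 0 _) => apply: cont_max0; cont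
  | |- continuous (fun p => \sum_(l < _) _) => apply: cont_sum => ?; cont
  | _ => match goal with
         | H : continuous _ |- _ => exact: H
         | H : (forall x, continuous (@?f x)) |- _ => solve [apply H]
         end
  end.

(** * Concentration of the kernels on the diagonal *)

Section Concentration.
Variable R : realType.
Local Notation P := (R * R * R)%type.
Variables (d : nat) (h : 'I_d -> P -> R).
Hypotheses (ch : forall a, continuous (h a)) (ph : forall a, per (h a)).

Definition sqdist (x y : P) : R := \sum_(a < d) (h a x - h a y) ^+ 2.

Lemma sqdist_ge0 x y : 0 <= sqdist x y.
Proof. by apply: sumr_ge0 => a _; exact: sqr_ge0. Qed.

Lemma sqdist_contr x : continuous (sqdist x).
Proof.
by apply: cont_sum => a; cont.
Qed.

Lemma sqdist_perl y : per (sqdist^~ y).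
Proof.
by move=> p q pq; apply: eq_bigr => a _; rewrite (ph a pq).
Qed.

Lemma sqdist_perr x : per (sqdist x).
Proof.
by move=> p q pq; apply: eq_bigr => a _; rewrite (ph a pq).
Qed.

Lemma sqdist_cont2 : continuous (fun z : P * P => sqdist z.1 z.2).
Proof.
apply: cont_sum => a; apply: contX; apply: contB => z.
  by apply: (@continuous_comp _ _ _ fst (h a)); [exact: cvg_fst|exact: ch].
by apply: (@continuous_comp _ _ _ snd (h a)); [exact: cvg_snd|exact: ch].
Qed.

Variables (X Y : set P) (eta : P -> R) (M : R).
Hypotheses (cX : closed X) (cY : closed Y) (pX : per X) (pY : per Y).
Hypotheses (ceta : continuous eta) (peta : per eta) (eta0 : forall y, 0 <= eta y).
Hypotheses (etaY : forall y, ~ Y y -> eta y = 0) (etaX : forall x, X x -> 0 < eta x).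
Hypotheses (M0 : 0 < M) (hM : forall x y, sqdist x y < M).

(** A Landau kernel in the variables [h]. It equals 1 on the diagonal, is positive because [M]
    exceeds every squared distance, and is polynomial in the values of [h] at the two points. *)
Definition kern n x y : R := (1 - sqdist x y / M) ^+ n.

Lemma kern_cont n x : continuous (kern n x).
Proof.
rewrite /kern; apply: contX; apply: contB; first exact: cst_continuous.
by apply: contM; [exact: sqdist_contr|exact: cst_continuous].
Qed.

Lemma kern_base_gt0 x y : 0 < 1 - sqdist x y / M.
Proof. by rewrite subr_gt0 ltr_pdivrMr// mul1r. Qed.

Lemma kern_gt0 n x y : 0 < kern n x y.
Proof. by rewrite exprn_gt0// kern_base_gt0. Qed.

Let ieta := cellint eta.
Hypothesis sep : forall x y, X x -> Y y -> sqdist x y = 0 -> torus_pi x = torus_pi y.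

Let cellR := @cell R : set P.

Lemma weight_lower_bound : exists2 c, 0 < c & forall x, X x -> c <= eta x.
Proof.
have kX : compact (cellR `&` X).
  by apply: compact_closedI => //; exact: compact_cell.
have [[z0 Xz0]|X0] := pselect ((cellR `&` X) !=set0); last first.
  exists 1 => // x Xx; exfalso; apply: X0; have [x' cx' xx'] := cell_rep x.
  by exists x'; split=> //; rewrite (pX xx').
have [c Xc cmin] := compact_EVT_min (ex_intro _ z0 Xz0) kX (continuous_subspaceT ceta).
move: Xc; rewrite inE => -[_ Xc].
exists (eta c); first exact: etaX.
move=> x Xx; have [x' cx' xx'] := cell_rep x.
by rewrite -(peta xx'); apply: cmin; rewrite inE; split=> //; rewrite (pX xx').
Qed.

(** On the diagonal the left side is 0 and the right side positive, so by compactness the pairs that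
    violate the strict inequality keep a positive squared distance. The error is relative to
    [eta x * eta y] so that it can be integrated against the kernel and compared with the integral
    of [eta]. *)
Lemma diagonal_bound (f : P -> R) e : continuous f -> per f -> 0 < e ->
  exists2 r, 0 < r & forall x y, X x -> Y y -> sqdist x y < r ->
    `|eta x * f y - f x * eta y| <= e * (eta x * eta y).
Proof.
move=> cf pf e0.
pose F (z : P * P) := `|eta z.1 * f z.2 - f z.1 * eta z.2| - e * (eta z.1 * eta z.2).
have c1 (g : P -> R) : continuous g -> continuous (fun z : P * P => g z.1).
  by move=> cg z; apply: (@continuous_comp _ _ _ fst g); [exact: cvg_fst|exact: cg].
have c2 (g : P -> R) : continuous g -> continuous (fun z : P * P => g z.2).
  by move=> cg z; apply: (@continuous_comp _ _ _ snd g); [exact: cvg_snd|exact: cg].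
have cF : continuous F.
  have ce1 := c1 _ ceta; have ce2 := c2 _ ceta; have cf1 := c1 _ cf; have cf2 := c2 _ cf.
  by rewrite /F; cont.
pose Z : set (P * P) := (cellR `&` X) `*` (cellR `&` Y) `&` F @^-1` [set t | 0 <= t].
have kZ : compact Z.
  apply: compact_closedI.
    by apply: compact_setX; apply: compact_closedI => //; exact: compact_cell.
  by apply: closed_comp => [z _|]; [exact: cF|exact: closed_ge].
have [r r0 Hr] : exists2 r, 0 < r & forall z, Z z -> r <= sqdist z.1 z.2.
  have [[z0 Zz0]|Z0] := pselect (Z !=set0); last first.
    by exists 1 => // z Zz; exfalso; apply: Z0; exists z.
  have [c Zc cmin] := compact_EVT_min (ex_intro _ z0 Zz0) kZ
    (continuous_subspaceT sqdist_cont2).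
  exists (sqdist c.1 c.2) => [|z Zz]; last by apply: cmin; rewrite inE.
  rewrite lt_neqAle sqdist_ge0 andbT; apply/eqP => /esym E.
  move: Zc; rewrite inE => -[[[_ Xc] [_ Yc]]] /=.
  have tc := sep Xc Yc E; rewrite /F -(pf _ _ tc) -(peta tc).
  rewrite [eta _ * _]mulrC subrr normr0 sub0r oppr_ge0 leNgt.
  by rewrite !mulr_gt0// etaX.
exists r => // x y Xx Yy; apply: contraTT; rewrite -!ltNge -leNgt => H.
have [x' cx' xx'] := cell_rep x; have [y' cy' yy'] := cell_rep y.
rewrite -(sqdist_perl y xx') -(sqdist_perr x' yy'); apply: (Hr (x', y')).
split; first by split; split=> //=; rewrite ?(pX xx') ?(pY yy').
rewrite /= /F /= (pf _ _ xx') (pf _ _ yy') (peta xx') (peta yy') subr_ge0.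
exact: ltW.
Qed.

(** As a function of [x] the integral is positive on [X], periodic and continuous, being Lipschitz
    in the values of [h]; compactness gives the bound. It measures the weight available near the
    diagonal. *)
Lemma bump_lower_bound e : 0 < e -> exists2 c, 0 < c &
  forall x, X x -> c <= cellint (fun y => eta y * Num.max 0 (1 - sqdist x y / e)).
Proof.
move=> e0; pose F x := cellint (fun y => eta y * Num.max 0 (1 - sqdist x y / e)).
have cI x : continuous (fun y => eta y * Num.max 0 (1 - sqdist x y / e)).
  apply: contM => //; apply: cont_max0; apply: contB; first exact: cst_continuous.
  by apply: contM; [exact: sqdist_contr|exact: cst_continuous].
have /choice[H HH] : forall a, exists H : R, 0 < H /\ forall p, `|h a p| <= H.
  by move=> a; have [H H0 hH] := per_bounded (@ch a) (@ph a); exists H.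
have dist x x' y : `|sqdist x y - sqdist x' y| <= \sum_(a < d) 4 * H a * `|h a x - h a x'|.
  rewrite /sqdist -sumrB; apply: le_trans (ler_norm_sum _ _ _) _.
  apply: ler_sum => a _.
  rewrite (_ : _ - _ = (h a x + h a x' - 2 * h a y) * (h a x - h a x')); last by ring.
  rewrite normrM ler_wpM2r//.
  have [_ b] := HH a; move: (b x) (b x') (b y); rewrite !ler_norml; lra.
have lip x x' : `|F x - F x'| <= ieta / e * \sum_(a < d) 4 * H a * `|h a x - h a x'|.
  rewrite /F -cellintB; [|exact: cintegrable_cont|exact: cintegrable_cont].
  apply: le_trans (cellint_norm _) _.
    by apply: cintegrable_cont; apply: contB.
  set D := \sum_(a < d) _; rewrite -mulrA mulrC -cellintZ; last exact: cintegrable_cont.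
  apply: cellint_le => [||p _].
  - by apply: cintegrable_cont; apply: cont_norm; apply: contB.
  - by apply: cintegrable_cont; apply: contM => //; exact: cst_continuous.
  rewrite -mulrBr normrM (ger0_norm (eta0 p)) mulrC ler_wpM2r//.
  have : `|(1 - sqdist x p / e) - (1 - sqdist x' p / e)| <= e^-1 * D.
    rewrite (_ : _ - _ = - (e^-1 * (sqdist x p - sqdist x' p))); last by ring.
    by rewrite normrN normrM gtr0_norm ?invr_gt0// ler_pM2l ?invr_gt0// dist.
  apply: le_trans; move: (1 - _ / e) (1 - _ / e) => s t.
  by have [s0|s0] := leP 0 s; have [t0|t0] := leP 0 t;
    rewrite ler_norml; have := ler_norm (s - t); have := ler_norm (t - s);
    rewrite distrC; lra.
have cF : continuous F.
  move=> x; apply/cvgrPdist_lt => r r0.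
  pose D x' := ieta / e * \sum_(a < d) 4 * H a * `|h a x - h a x'|.
  have cD : continuous D.
    apply: contM; first exact: cst_continuous.
    apply: cont_sum => a; apply: contM; first exact: cst_continuous.
    by apply: cont_norm; apply: contB => //; exact: cst_continuous.
  have D0 : D x = 0.
    rewrite /D big1 ?mulr0// => a _; by rewrite subrr normr0 mulr0.
  have /cvgrPdist_lt/(_ _ r0) := cD x; apply: filterS => x'.
  by rewrite D0 sub0r normrN => H'; apply: le_lt_trans (lip x x') _;
    rewrite (le_lt_trans (ler_norm _)).
have pF : per F.
  move=> p q pq; congr cellint; apply/funext => y.
  by rewrite (sqdist_perl y pq).
have F0 x : X x -> 0 < F x.
  move=> Xx; apply: (@cellint_gt0 _ _ x) => //.
  - by move=> p q pq; rewrite (peta pq) (sqdist_perr x pq).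
  - by move=> y; rewrite mulr_ge0// le_max lexx.
  - rewrite mulr_gt0 ?etaX// lt_max (_ : sqdist x x = 0) ?mul0r ?subr0 ?ltr01 ?orbT//.
    by apply: big1 => a _; rewrite subrr expr0n.
have kX : compact (@cell R `&` X : set P).
  by apply: compact_closedI => //; exact: compact_cell.
have [[z0 Xz0]|X0] := pselect ((@cell R `&` X : set P) !=set0); last first.
  exists 1 => // x Xx; exfalso; apply: X0; have [x' cx' xx'] := cell_rep x.
  by exists x'; split=> //; rewrite (pX xx').
have [c Xc cmin] := compact_EVT_min (ex_intro _ z0 Xz0) kX (continuous_subspaceT cF).
move: Xc; rewrite inE => -[_ Xc].
exists (F c); first exact: F0.
move=> x Xx; have [x' cx' xx'] := cell_rep x.
rewrite -[leRHS]/(F x) -(pF _ _ xx'); apply: cmin; rewrite inE; split=> //.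
by rewrite (pX xx').
Qed.

(** The quotient of the two integrals tends to [f x / eta x]; the statement is cleared of
    denominators. At squared distance [e1] or more the kernel is at most [s ^+ n], while points
    within [e1 / 2] already give the denominator a size [c * t ^+ n] with [s < t]. The far part is
    thus negligible, and [diagonal_bound] handles the near part. *)
Lemma concentration (f : P -> R) e : continuous f -> per f -> (forall y, ~ Y y -> f y = 0) ->
  0 < e ->
  exists N, forall n, (N <= n)%N -> forall x, X x ->
  `|eta x * cellint (fun y => f y * kern n x y)
    - f x * cellint (fun y => eta y * kern n x y)|
  <= e * (eta x * cellint (fun y => eta y * kern n x y)).
Proof.
move=> cf pf fY e0.
have e20 : 0 < e / 2 by rewrite divr_gt0.
have [r r0 Hr] := diagonal_bound cf pf e20.
have [b b0 Hb] := weight_lower_bound.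
have [A A0 fA] := per_bounded cf pf.
have [B B0 etaB] := per_bounded ceta peta.
(* At most [M] so that [s] is nonnegative, and at most [r] so that [diagonal_bound] applies. *)
pose e1 := Num.min M r.
have e10 : 0 < e1 by rewrite lt_min M0.
have e1M : e1 <= M by rewrite ge_min lexx.
have e1r : e1 <= r by rewrite ge_min lexx orbT.
pose e2 := e1 / 2.
have e20' : 0 < e2 by rewrite divr_gt0.
have [c c0 Hc] := bump_lower_bound e20'.
pose s := 1 - e1 / M; pose t := 1 - e2 / M.
have s0 : 0 <= s by rewrite subr_ge0 ler_pdivrMr// mul1r.
have st : s < t.
  by rewrite ltrD2l ltrN2 ltr_pM2r ?invr_gt0// /e2; lra.
have t0 := le_lt_trans s0 st.
have st0 : 0 <= s / t by rewrite divr_ge0// ltW.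
have st1 : s / t < 1 by rewrite ltr_pdivrMr// mul1r.
pose D := 2 * A * B * (2 * pi) ^+ 3 : R.
have D0 : 0 < D by rewrite !mulr_gt0 ?exprn_gt0 ?mulr_gt0 ?pi_gt0.
have E0 : 0 < e / 2 * b * c / D by rewrite !mulr_gt0 ?invr_gt0.
have [N HN] := geometric_small st0 st1 E0.
exists N => n Nn x Xx.
set I0 := cellint (fun y => eta y * kern n x y).
have ckern : continuous (kern n x) by exact: kern_cont.
have csq : continuous (sqdist x) by exact: sqdist_contr.
have iK : cintegrable (fun y => eta y * kern n x y) by apply: cintegrable_cont; cont.
have lowI : c * t ^+ n <= I0.
  apply: le_trans (_ : t ^+ n * cellint (fun y => eta y * Num.max 0 (1 - sqdist x y / e2)) <= _).
    by rewrite mulrC ler_wpM2l ?exprn_ge0 ?(ltW t0)// Hc.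
  rewrite -cellintZ; last by apply: cintegrable_cont; cont.
  apply: cellint_le => // [|y _]; first by apply: cintegrable_cont; cont.
  rewrite mulrCA ler_wpM2l//.
  have [h1|h1] := leP e2 (sqdist x y).
    rewrite max_l ?mulr0 ?(ltW (kern_gt0 _ _ _))//.
    by rewrite subr_le0 ler_pdivlMr// mul1r.
  apply: (@le_trans _ _ (t ^+ n)).
    rewrite ler_piMr ?exprn_ge0 ?(ltW t0)// ge_max ler01 /= lerBlDr lerDl.
    by rewrite divr_ge0 ?sqdist_ge0// ltW.
  rewrite lerXn2r ?nnegrE ?(ltW t0) ?(ltW (kern_base_gt0 _ _))//.
  by rewrite lerD2l lerN2 ler_pM2r ?invr_gt0// ltW.
rewrite -cellintZ; last by apply: cintegrable_cont; cont.
rewrite -[f x * _]cellintZ// -cellintB; last first.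
- by apply: cintegrableZ.
- by apply: cintegrable_cont; cont.
apply: le_trans (cellint_norm _) _; first by apply: cintegrable_cont; cont.
have etax := etaX Xx.
apply: (@le_trans _ _ (cellint (fun y => (e / 2 * eta x) * (eta y * kern n x y)
    + (2 * A * B * s ^+ n)))).
  apply: cellint_le => [||y _]; [by apply: cintegrable_cont; cont..|].
  rewrite (_ : _ - _ = (eta x * f y - f x * eta y) * kern n x y); last by ring.
  have kn0 := ltW (kern_gt0 n x y).
  rewrite normrM [X in _ * X]ger0_norm//.
  have c1 : 0 <= 2 * A * B * s ^+ n by rewrite !mulr_ge0 ?exprn_ge0// ltW.
  have c2 : 0 <= e / 2 * eta x * (eta y * kern n x y).
    by rewrite !mulr_ge0 ?invr_ge0// ltW.
  have [Yy|nYy] := pselect (Y y); last first.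
    by rewrite (fY _ nYy) (etaY nYy) !mulr0 subrr normr0 !mul0r mulr0 add0r.
  have [h1|h1] := ltP (sqdist x y) e1.
    apply: (@le_trans _ _ (e / 2 * eta x * (eta y * kern n x y))); last by rewrite lerDl.
    rewrite mulrA ler_wpM2r// -mulrA; apply: Hr => //.
    exact: lt_le_trans h1 e1r.
  apply: (@le_trans _ _ (2 * A * B * s ^+ n)); last by rewrite lerDr.
  apply: ler_pM => //.
    rewrite (le_trans (ler_normB _ _))// !normrM.
    have := ler_pM (normr_ge0 _) (normr_ge0 _) (etaB x) (fA y).
    have := ler_pM (normr_ge0 _) (normr_ge0 _) (fA x) (etaB y); lra.
  rewrite lerXn2r ?nnegrE ?(ltW (kern_base_gt0 _ _))//.
  by rewrite lerD2l lerN2 ler_pM2r ?invr_gt0.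
rewrite cellintD; [|by apply: cintegrable_cont; cont..].
rewrite cellintZ// cellint_cst.
have H2 : D * s ^+ n <= e / 2 * b * I0.
  have := HN _ Nn; rewrite ler_pdivlMr// expr_div_n mulrAC ler_pdivrMr ?exprn_gt0//.
  rewrite mulrC => H3; apply: le_trans H3 _.
  rewrite -[leLHS]mulrA ler_pM2l// mulr_gt0//.
have I00 : 0 <= I0 by rewrite (le_trans _ lowI)// mulr_ge0 ?exprn_ge0// ltW.
have H4 : e / 2 * b * I0 <= e / 2 * (eta x * I0).
  by rewrite -mulrA ler_pM2l// ler_wpM2r// Hb.
have -> : 2 * A * B * s ^+ n * (2 * pi) ^+ 3 = D * s ^+ n by rewrite /D; ring.
have H5 := le_trans H2 H4.
apply: le_trans (_ : e / 2 * (eta x * I0) + e / 2 * (eta x * I0) <= _).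
  by rewrite -[X in X + _]mulrA lerD2l.
by rewrite -mulrDl -splitr.
Qed.

End Concentration.

Lemma kern_tensor (R : realType) (Q : set (R * R * R -> R)) (d : nat)
    (H : 'I_d -> R * R * R -> R) (M : R) n : periodic_algebra Q ->
  (forall a, Q (H a)) -> tensor Q (kern H M n).
Proof.
move=> aQ QH; have [Qc _ _ Qr] := aQ.
have cH a : continuous (H a) by have [_ r] := Qr _ (QH a); exact: (Creg_cont (r 0)).
have pH a : per (H a) by have [] := Qr _ (QH a).
have t1 q : Q q -> tensor Q (fun x y => q x * (fun=> 1) y).
  by move=> Qq; apply: tensor1 => //; exact: cst_continuous.
apply: tensorX => //.
have -> : (fun x y => 1 - sqdist H x y / M) =
    fun x y => (fun=> 1) x * (fun=> 1) y +
      (fun=> - M^-1) x * (fun=> 1) y * \sum_(a < d) (H a x * (fun=> 1) y + (fun=> -1) x * H a y) ^+ 2.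
  apply/funext => x; apply/funext => y; rewrite !mulr1 mulNr [M^-1 * _]mulrC.
  by congr (1 - _ / _); apply: eq_bigr => a _; rewrite !mulr1 mulN1r.
apply: tensorD; first exact: t1.
apply: tensorM => //; first exact: t1.
apply: tensor_sum => a; apply: tensorX => //.
apply: tensorD; first exact: t1.
exact: tensor1.
Qed.

(** * Regular matrices and increments along the axes *)

Section RegularMatrices.
Variable R : realType.
Local Notation P := (R * R * R)%type.
Implicit Types (F : P -> R) (k : nat) (i : 'I_3).

Lemma dpar_sum n (F : 'I_n -> P -> R) i :
  (forall l p, derivable (F l) p (axis R i)) ->
  dpar i (fun p => \sum_(l < n) F l p) = fun p => \sum_(l < n) dpar i (F l) p.
Proof.
move=> dF; apply/funext => p; rewrite /dpar -derive_sum//.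
by congr ('D_ _ _ p); apply/funext => q; rewrite fct_sumE.
Qed.

Lemma Creg_det k n (A : P -> 'M[R]_n) : (forall a b, Creg k (fun p => A p a b)) ->
  Creg k (fun p => \det (A p)).
Proof.
move=> rA; apply: Creg_sum => s _; apply: CregM; first exact: Creg_cst.
by apply: Creg_prod.
Qed.

Lemma Creg_adj k n (A : P -> 'M[R]_n) (i j : 'I_n) :
  (forall a b, Creg k (fun p => A p a b)) ->
  Creg k (fun p => (\adj (A p)) i j).
Proof.
move=> rA; rewrite (_ : (fun p => _) = fun p =>
    (-1) ^+ (j + i) * \det (row' j (col' i (A p)))).
  apply: CregZ; apply: Creg_det => i' j'.
  by rewrite (_ : (fun p => _) = fun p => A p (lift j i') (lift i j'))//;
    apply/funext => p; rewrite !mxE.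
by apply/funext => p; rewrite !mxE.
Qed.

Definition coord (i : 'I_3) (p : P) : R :=
  if i == 0 then p.1.1 else if i == 1 then p.1.2 else p.2.

Lemma ball_coord (x p : P) (r : R) : ball x r p <-> forall i, `|coord i x - coord i p| < r.
Proof.
split=> [[[h1 h2] h3] i|H].
  by rewrite /coord; case: ifP => _ //; case: ifP.
by split; [split; [exact: (H 0)|exact: (H 1)]|exact: (H 2)].
Qed.

(** The increment is split along three segments parallel to the axes, so that partial derivatives
    suffice. The intermediate points may leave the ball of radius [r] but remain in that of radius
    [3 * r]. *)
Lemma path_mvt F (x p q : P) (r : R) : (forall i z, derivable F z (axis R i)) ->
  ball x r p -> ball x r q ->
  exists xi : 'I_3 -> P, (forall i, ball x (3 * r) (xi i)) /\
    F p - F q = \sum_(i < 3) (coord i p - coord i q) * dpar i F (xi i).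
Proof.
move=> dF; case: x p q => [[x1 x2] x3] [[p1 p2] p3] [[q1 q2] q3].
move=> [[/= a1 a2] a3] [[/= b1 b2] b3].
have [s1 H1 E1] := MVT_line (q1, q2, q3) (p1 - q1) (dF 0).
have [s2 H2 E2] := MVT_line (p1, q2, q3) (p2 - q2) (dF 1).
have [s3 H3 E3] := MVT_line (p1, p2, q3) (p3 - q3) (dF 2).
exists (fun i => if i == 0 then (q1, q2, q3) + s1 *: axis R 0 else
  if i == 1 then (p1, q2, q3) + s2 *: axis R 1 else (p1, p2, q3) + s3 *: axis R 2).
have tri (x p q s : R) : ball x r p -> ball x r q -> `|s| <= `|p - q| ->
    [/\ `|x - (q + s)| < 3 * r, `|x - p| < 3 * r & `|x - q| < 3 * r].
  rewrite /ball /= => xp xq spq.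
  have pq : `|p - q| < r + r by rewrite (le_lt_trans (ler_distD x p q))// ltrD// distrC.
  have r0 : 0 < r by exact: le_lt_trans (normr_ge0 _) xp.
  split; [|by lra|by lra].
  have := ler_normB (x - q) s; rewrite -addrA -opprD; lra.
have [A1 B1 D1] := tri _ _ _ _ a1 b1 H1.
have [A2 B2 D2] := tri _ _ _ _ a2 b2 H2.
have [A3 B3 D3] := tri _ _ _ _ a3 b3 H3.
split.
  move=> i; case: ifP => _; [|case: ifP => _]; apply/ball_coord => j;
    rewrite /coord /axis /= /GRing.scale /= ?mulr0 ?mulr1 ?addr0;
    by case: ifP => _ //; case: ifP => _.
rewrite !big_ord_recl big_ord0 addr0 /coord /=.
have -> : lift ord0 ord0 = 1 :> 'I_3 by exact: val_inj.
have -> : lift ord0 (lift ord0 ord0) = 2 :> 'I_3 by exact: val_inj.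
move: E1 E2 E3.
have -> : (q1, q2, q3) + (p1 - q1) *: axis R 0 = (p1, q2, q3).
  by rewrite /axis /=; congr (_, _, _);
    rewrite /= /GRing.scale /= ?mulr1 ?mulr0 ?addr0// addrC subrK.
have -> : (p1, q2, q3) + (p2 - q2) *: axis R 1 = (p1, p2, q3).
  by rewrite /axis /=; congr (_, _, _);
    rewrite /= /GRing.scale /= ?mulr1 ?mulr0 ?addr0// addrC subrK.
have -> : (p1, p2, q3) + (p3 - q3) *: axis R 2 = (p1, p2, p3).
  by rewrite /axis /=; congr (_, _, _);
    rewrite /= /GRing.scale /= ?mulr1 ?mulr0 ?addr0// addrC subrK.
rewrite /dpar /= => <- <- <-; ring.
Qed.

End RegularMatrices.

(** * Local charts made of elements of the algebra *)

Section Chart.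
Variable R : realType.
Local Notation P := (R * R * R)%type.
Local Notation tpi := (@torus_pi R).
Variable Q : set (P -> R).
Hypothesis aQ : periodic_algebra Q.
Variables (N : nat) (h : 'I_N -> P -> R).
Hypothesis Qh : forall a, Q (h a).
Hypothesis imm : forall p (v : 'I_3 -> R),
  (forall a, \sum_(i < 3) v i * dpar i (h a) p = 0) -> forall i, v i = 0.
Hypothesis inj : forall p q, (forall a, h a p = h a q) -> tpi p = tpi q.
Variable x0 : P.

Let Qreg k F : Q F -> Creg k F. Proof. by case: aQ => _ _ _ /[apply] -[]. Qed.
Let Qper F : Q F -> per F. Proof. by case: aQ => _ _ _ /[apply] -[]. Qed.

Lemma algebra_sum n (F : 'I_n -> P -> R) : (forall l, Q (F l)) ->
  Q (fun p => \sum_(l < n) F l p).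
Proof.
case: aQ => Qc QD _ _; elim: n F => [|n IH] F QF.
  by rewrite (_ : (fun p => _) = fun=> 0)//; apply/funext => p; rewrite big_ord0.
rewrite (_ : (fun p => _) = (fun p => F ord0 p + \sum_(l < n) F (lift ord0 l) p)).
  by apply: QD => //; exact: IH.
by apply/funext => p; rewrite big_ord_recl.
Qed.

Lemma algebraZ (c : R) F : Q F -> Q (fun p => c * F p).
Proof. by case: aQ => Qc _ QM _ QF; apply: (QM (fun=> c)). Qed.

(** Injectivity of the differential makes the 3 by [N] matrix of partial derivatives row free; its
    right inverse gives the coefficients of three combinations of the [h a] with identity Jacobian
    at [x0]. *)
Lemma chart_exists : exists H : 'I_3 -> P -> R, (forall b, Q (H b)) /\
  forall i b, dpar i (H b) x0 = (i == b)%:R.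
Proof.
pose A : 'M[R]_(3, N) := \matrix_(i, a) dpar i (h a) x0.
have /row_freeP[B AB] : row_free A.
  apply: inj_row_free => v vA; apply/rowP => i; rewrite mxE.
  apply: (@imm x0 (fun j => v 0 j) _ i) => a.
  move/rowP/(_ a) : vA; rewrite !mxE => vA; rewrite -[RHS]vA.
  by apply: eq_bigr => j _; rewrite mxE.
exists (fun b p => \sum_(a < N) B a b * h a p); split=> [b|i b].
  by apply: algebra_sum => a; exact: algebraZ.
have dh l p : derivable (h l) p (axis R i) by exact: Creg_der (Qreg 1 (Qh l)).
rewrite dpar_sum => [|l p]; last by apply: derivableM => //; exact: derivable_cst.
move/matrixP/(_ i b) : AB; rewrite !mxE => <-; apply: eq_bigr => a _.
by rewrite dparZ// mxE mulrC.
Qed.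

Variable H : 'I_3 -> P -> R.
Hypotheses (QH : forall b, Q (H b)) (HI : forall i b, dpar i (H b) x0 = (i == b)%:R).

Definition jacobian (p : P) : 'M[R]_3 := \matrix_(i, b) dpar i (H b) p.

Lemma jacobian_reg k i b : Creg k (fun p => jacobian p i b).
Proof.
rewrite (_ : (fun p => _) = dpar i (H b)); first exact: Creg_dpar (Qreg k.+1 (QH b)).
by apply/funext => p; rewrite mxE.
Qed.

(** The bound 1/4 makes the sum of the three coordinate differences contract by 3/4, which gives
    injectivity; the bound on the determinant makes the inverse Jacobian regular. The factor 3 is
    that of [path_mvt]. *)
Lemma chart_radius : exists2 r, 0 < r & forall p, ball x0 (3 * r) p ->
  (forall i b, `|dpar i (H b) p - (i == b)%:R| <= 4^-1) /\ 2^-1 < \det (jacobian p).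
Proof.
have near1 (i b : 'I_3) : \forall p \near x0, `|dpar i (H b) p - (i == b)%:R| <= 4^-1.
  have /(_ x0)/cvgrPdist_le := Creg_cont (Creg_dpar i (Qreg 1 (QH b))).
  rewrite HI => /(_ 4^-1); rewrite invr_gt0 ltr0n => /(_ isT).
  by apply: filterS => p; rewrite distrC.
have near2 : \forall p \near x0, 2^-1 < \det (jacobian p).
  have /(_ x0)/cvgrPdist_lt := Creg_cont (Creg_det (jacobian_reg 0)).
  have -> : jacobian x0 = 1%:M by apply/matrixP => i b; rewrite !mxE HI.
  rewrite det1 => /(_ 2^-1); rewrite invr_gt0 ltr0n => /(_ isT).
  by apply: filterS => p; rewrite ltr_norml; lra.
have near3 : \forall p \near x0, forall i b, `|dpar i (H b) p - (i == b)%:R| <= 4^-1.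
  apply: (@filter_forall _ _ (fun i p =>
    forall b, `|dpar i (H b) p - (i == b)%:R| <= 4^-1) (nbhs x0) _) => i.
  by apply: (@filter_forall _ _ (fun b p =>
    `|dpar i (H b) p - (i == b)%:R| <= 4^-1) (nbhs x0) _) => b; exact: near1.
have /nbhs_ballP[r /= r0 Hr] : nbhs x0 [set p |
    (forall i b, `|dpar i (H b) p - (i == b)%:R| <= 4^-1) /\ 2^-1 < \det (jacobian p)].
  exact: filterI near3 near2.
exists (r / 3); first by rewrite divr_gt0.
by move=> p; rewrite mulrC divfK// => /Hr.
Qed.

Lemma chart_injective (r : R) p q :
  (forall p, ball x0 (3 * r) p -> forall i b, `|dpar i (H b) p - (i == b)%:R| <= 4^-1) ->
  ball x0 r p -> ball x0 r q -> (forall b, H b p = H b q) -> p = q.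
Proof.
move=> Hr xp xq pq.
pose dd i := coord i p - coord i q.
have bd b : `|dd b| <= \sum_(i < 3) `|dd i| / 4.
  have dH i z : derivable (H b) z (axis R i) by exact: Creg_der (Qreg 1 (QH b)).
  have [xi [xib]] := path_mvt dH xp xq; rewrite pq subrr => E.
  have -> : dd b = \sum_(i < 3) dd i * ((i == b)%:R - dpar i (H b) (xi i)).
    under eq_bigr do rewrite mulrBr; rewrite sumrB -E subr0 (bigD1 b)//= eqxx mulr1.
    by rewrite big1 ?addr0// => i /negPf ->; rewrite mulr0.
  apply: le_trans (ler_norm_sum _ _ _) _; apply: ler_sum => i _.
  by rewrite normrM ler_wpM2l// distrC Hr.
have S0 : \sum_(i < 3) `|dd i| = 0.
  have : \sum_(i < 3) `|dd i| <= 3 / 4 * \sum_(i < 3) `|dd i|.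
    apply: le_trans (ler_sum _ (fun b _ => bd b)) _.
    rewrite sumr_const card_ord -mulr_suml -mulr_natl; lra.
  have : 0 <= \sum_(i < 3) `|dd i| by apply: sumr_ge0.
  lra.
have d0 i : dd i = 0.
  apply/eqP; rewrite -normr_eq0; move/eqP: S0; rewrite psumr_eq0//.
  by move=> /allP/(_ i)/(_ (mem_index_enum _)).
move: (d0 0) (d0 1) (d0 2); rewrite /dd /coord /=.
case: p q {dd d0 xp xq pq bd S0} => [[p1 p2] p3] [[q1 q2] q3] /=.
by move=> /eqP; rewrite subr_eq0 => /eqP -> /eqP; rewrite subr_eq0 => /eqP ->
  /eqP; rewrite subr_eq0 => /eqP ->.
Qed.

(** The functions [h] separate the points of the torus, so the squared distance to [x0] is bounded
    below on the part of the cell outside all lattice translates of the ball. Sublevel sets of an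
    algebra element thus serve as small neighbourhoods. *)
Lemma small_sqdist (r : R) : 0 < r -> exists2 d, 0 < d & forall p,
  sqdist h p x0 <= d -> exists2 p', tpi p' = tpi p & ball x0 r p'.
Proof.
move=> r0.
pose O := \bigcup_(n in [set: int * int * int])
  ((fun p : P => lattice R n + p) @^-1` (ball x0 r : set P)).
have oO : open O.
  apply: bigcup_open => n _; apply: open_comp; last exact: ball_open.
  by move=> p _; apply: cvgD; [exact: cvg_cst|exact: cvg_id].
have ch a : continuous (h a) by exact: Creg_cont (Qreg 0 (Qh a)).
have csq : continuous (fun p => sqdist h p x0).
  by rewrite /sqdist; cont.
have kZ : compact (@cell R `&` ~` O : set P).
  by apply: compact_closedI; [exact: compact_cell|exact: open_closedC].
have inO p : O p -> exists2 p', tpi p' = tpi p & ball x0 r p'.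
  by move=> [n _ /= Hn]; exists (lattice R n + p) => //; apply/torus_piP; exists n.
have [d d0 Hd] : exists2 d, 0 < d & forall p, (@cell R `&` ~` O : set P) p -> d < sqdist h p x0.
  have [[z0 Zz0]|Z0] := pselect ((@cell R `&` ~` O : set P) !=set0); last first.
    by exists 1 => // z Zz; exfalso; apply: Z0; exists z.
  have [c Zc cmin] := compact_EVT_min (ex_intro _ z0 Zz0) kZ (continuous_subspaceT csq).
  have rc : 0 < sqdist h c x0.
    rewrite lt_neqAle sqdist_ge0 andbT; apply/eqP => /esym E.
    move: Zc; rewrite inE => -[_]; apply.
    have tc : tpi c = tpi x0.
      apply: inj => a; apply/eqP; rewrite -subr_eq0 -sqrf_eq0.
      move/eqP : E; rewrite psumr_eq0; last by move=> b _; exact: sqr_ge0.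
      by move=> /allP/(_ a)/(_ (mem_index_enum _)).
    have /esym/torus_piP[k Ek] := tc.
    by exists k => //=; rewrite -Ek; exact: ballxx.
  exists (sqdist h c x0 / 2); first by rewrite divr_gt0.
  by move=> p Zp; have := cmin p; rewrite inE => /(_ Zp); lra.
exists d => // p pd; have [q cq qp] := cell_rep p.
have ph a : per (h a) by exact: Qper.
have [Oq|nOq] := pselect (O q).
  by have [p' E B] := inO _ Oq; exists p' => //; rewrite E.
by have := Hd q (conj cq nOq); rewrite (sqdist_perl ph x0 qp) ltNge pd.
Qed.

End Chart.

(** * Convergence in C^j on an open set, and flatness of cut-offs *)

Section LocalConvergence.
Variable R : realType.
Local Notation P := (R * R * R)%type.
Implicit Types (u v : nat -> P -> R) (l m F W : P -> R) (X : set P) (j k : nat).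

Lemma bnd_open0 X k (M : R) W : open X -> 0 <= M -> (forall p, X p -> W p = 0) ->
  bnd X k M W.
Proof.
move=> oX M0; elim: k W => [|k IH] W W0; split=> //;
  try by move=> p /W0 ->; rewrite normr0.
move=> i; apply: IH => p Xp; rewrite /dpar.
have -> : 'D_(axis R i) W p = 'D_(axis R i) (cst 0 : P -> R) p.
  apply: near_eq_derive; have : nbhs p X by exact: open_nbhs_nbhs.
  by apply: filterS => q /W0 ->.
by rewrite derive_cst.
Qed.

(** The set is closed, so vanishing on it does not by itself control derivatives at its boundary.
    The exponent does: a power of the positive part survives [k] differentiations. *)
Lemma bnd_posX_flat k F : Creg k F -> per F ->
  bnd [set p | F p <= 0] k 0 (fun p => Num.max 0 (F p) ^+ k.+1).
Proof.
elim: k => [|k IH] rF pF; split=> //;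
  try by move=> p /= p0; rewrite max_l// expr0n normr0.
move=> i; rewrite (dpar_comp (is_derive_posX k) (@Creg_der _ _ _ _ ^~ rF)).
have [N N0 bN] := Creg_bnd (Creg_dpar i rF) (per_dpar i pF).
have rp : Creg k (fun p => Num.max 0 (F p) ^+ k.+1) by apply/Creg_posX/CregW.
apply: (@bnd_le _ _ _ (2 ^+ k * ((`|k.+2%:R| * 0) * N))).
  by rewrite mulr0 mul0r mulr0.
apply: bndM; [exact: CregZ|exact: Creg_dpar| |exact: bnd_sub bN].
by apply: bndZ => //; apply: IH => //; exact: CregW.
Qed.

Definition cv X j u l : Prop :=
  [/\ forall n, Creg j (u n), Creg j l, per l &
      forall e : R, 0 < e -> exists N, forall n, (N <= n)%N ->
        bnd X j e (fun p => u n p - l p)].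

Lemma cv_cst X j l : Creg j l -> per l -> cv X j (fun=> l) l.
Proof.
move=> rl pl; split=> // e e0; exists 0 => n _.
rewrite (_ : (fun p => _) = fun=> 0); last by apply/funext => p; rewrite subrr.
by apply: bnd_cst; rewrite normr0 ltW.
Qed.

Lemma cvD_on X j u v l m : cv X j u l -> cv X j v m ->
  cv X j (fun n p => u n p + v n p) (fun p => l p + m p).
Proof.
move=> [ru rl pl ul] [rv rm pm vm]; split=> [n|||e e0].
- exact: CregD.
- exact: CregD.
- by move=> p q pq; rewrite (pl _ _ pq) (pm _ _ pq).
have e20 : 0 < e / 2 by rewrite divr_gt0.
have [N1 H1] := ul _ e20; have [N2 H2] := vm _ e20.
exists (maxn N1 N2) => n; rewrite geq_max => /andP[n1 n2].
rewrite (_ : (fun p => _) = fun p => (u n p - l p) + (v n p - m p)).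
  by rewrite [e]splitr; apply: bndD; [exact: CregB|exact: CregB|exact: H1|exact: H2].
by apply/funext => p; rewrite opprD addrACA.
Qed.

Lemma cvM_on X j u v l m : cv X j u l -> cv X j v m ->
  cv X j (fun n p => u n p * v n p) (fun p => l p * m p).
Proof.
move=> [ru rl pl ul] [rv rm pm vm]; split=> [n|||e e0].
- exact: CregM.
- exact: CregM.
- by move=> p q pq; rewrite (pl _ _ pq) (pm _ _ pq).
have [A A0 bA] := Creg_bnd rl pl; have [B B0 bB] := Creg_bnd rm pm.
have D0 : 0 < 2 ^+ j * (A + B + 1) by rewrite mulr_gt0 ?exprn_gt0// !addr_gt0.
pose d := Num.min 1 (e / (2 ^+ j * (A + B + 1))).
have d0 : 0 < d by rewrite lt_min ltr01 divr_gt0.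
have d1 : d <= 1 by rewrite ge_min lexx.
have de : d * (2 ^+ j * (A + B + 1)) <= e.
  by rewrite -ler_pdivlMr// ge_min lexx orbT.
have [N1 H1] := ul _ d0; have [N2 H2] := vm _ d0.
exists (maxn N1 N2) => n; rewrite geq_max => /andP[n1 n2].
have rul : Creg j (fun p => u n p - l p) by exact: CregB.
have rvm : Creg j (fun p => v n p - m p) by exact: CregB.
have {}bA : bnd X j A l by exact: bnd_sub bA.
have {}bB : bnd X j B m by exact: bnd_sub bB.
rewrite (_ : (fun p => _) = fun p => (u n p - l p) * (v n p - m p) +
    (l p * (v n p - m p) + (u n p - l p) * m p)); last first.
  by apply/funext => p; ring.
apply: (@bnd_le _ _ _ (2 ^+ j * (d * d) + (2 ^+ j * (A * d) + 2 ^+ j * (d * B)))).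
  apply: le_trans de; rewrite -!mulrDr mulrCA ler_pM2l ?exprn_gt0//; nra.
have {}H1 := H1 _ n1; have {}H2 := H2 _ n2.
apply: bndD; [exact: CregM| |exact: bndM|].
  by apply: CregD; exact: CregM.
by apply: bndD; [exact: CregM|exact: CregM|exact: bndM|exact: bndM].
Qed.

Lemma cvB_on X j u v l m : cv X j u l -> cv X j v m ->
  cv X j (fun n p => u n p - v n p) (fun p => l p - m p).
Proof.
move=> cu cv'.
have c1 : cv X j (fun=> fun=> -1) (fun=> -1) by apply: cv_cst => //; exact: Creg_cst.
have := cvD_on cu (cvM_on c1 cv'); congr cv.
  by apply/funext => n; apply/funext => p; rewrite mulN1r.
by apply/funext => p; rewrite mulN1r.
Qed.

Lemma cv_sum_on X j n (u : 'I_n -> nat -> P -> R) (l : 'I_n -> P -> R) :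
  (forall a, cv X j (u a) (l a)) ->
  cv X j (fun t p => \sum_(a < n) u a t p) (fun p => \sum_(a < n) l a p).
Proof.
elim: n u l => [|n IH] u l ul.
  rewrite (_ : (fun t p => _) = fun=> fun=> 0); last first.
    by apply/funext => t; apply/funext => p; rewrite big_ord0.
  rewrite (_ : (fun p => _) = fun=> 0); last by apply/funext => p; rewrite big_ord0.
  by apply: cv_cst => //; exact: Creg_cst.
have := cvD_on (ul ord0) (IH _ _ (fun a => ul (lift ord0 a))); congr cv.
  by apply/funext => t; apply/funext => p; rewrite big_ord_recl.
by apply/funext => p; rewrite big_ord_recl.
Qed.

(** A limit computed by one formula may be replaced by any globally regular function that agrees
    with it on [X]. *)
Lemma cv_eq_on X j u l m : open X -> Creg j m -> per m ->
  (forall p, X p -> l p = m p) -> cv X j u l -> cv X j u m.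
Proof.
move=> oX rm pm lm [ru rl pl ul]; split=> // e e0.
have [N HN] := ul _ e0; exists N => n Nn.
rewrite (_ : (fun p => _) = fun p => (u n p - l p) + (l p - m p)); last first.
  by apply/funext => p; rewrite addrA subrK.
rewrite -[e]addr0; apply: bndD; [exact: CregB|exact: CregB|exact: HN|].
by apply: bnd_open0 => // p Xp; rewrite lm// subrr.
Qed.

Lemma cv_succ X j u l : (forall n, Creg j.+1 (u n)) -> Creg j.+1 l -> per l ->
  (forall e : R, 0 < e -> exists N, forall n, (N <= n)%N -> forall p, X p ->
     `|u n p - l p| <= e) ->
  (forall i, cv X j (fun n => dpar i (u n)) (dpar i l)) -> cv X j.+1 u l.
Proof.
move=> ru rl pl u0 ud; split=> // e e0.
have [N HN] := u0 _ e0.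
have /choice[M HM] : forall i : 'I_3, exists M, forall n, (M <= n)%N ->
    bnd X j e (fun p => dpar i (u n) p - dpar i l p).
  by move=> i; have [_ _ _ /(_ _ e0)] := ud i.
exists (maxn N (\max_i M i)) => n; rewrite geq_max => /andP[n1 n2].
split=> [p Xp|i]; first exact: HN.
rewrite dparB; [|by move=> p; exact: Creg_der (ru n)|exact: (rl.2 i).1].
by apply: HM; rewrite (leq_trans _ n2)// leq_bigmax.
Qed.

End LocalConvergence.

(** * Density near a point *)

Section LocalDensity.
Variable R : realType.
Local Notation P := (R * R * R)%type.
Local Notation tpi := (@torus_pi R).
Variable Q : set (P -> R).
Hypothesis aQ : periodic_algebra Q.
Variables (rho : P -> R) (H : 'I_3 -> P -> R) (d M : R) (k : nat) (x0 : P).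
Hypotheses (Qrho : Q rho) (QH : forall b, Q (H b)).
Hypotheses (d0 : 0 < d) (M0 : 0 < M) (rho_x0 : rho x0 = 0).
Hypothesis hM : forall x y, sqdist H x y < M.
Hypothesis detY : forall y, rho y <= d -> 2^-1 < \det (jacobian H y).
Hypothesis injY : forall x y, rho x <= d -> rho y <= d -> (forall b, H b x = H b y) ->
  tpi x = tpi y.

Let Qreg j F : Q F -> Creg j F. Proof. by case: aQ => _ _ _ /[apply] -[]. Qed.
Let Qper F : Q F -> per F. Proof. by case: aQ => _ _ _ /[apply] -[]. Qed.
Let Qc (c : R) : Q (fun=> c). Proof. by case: aQ. Qed.
Let QD F G : Q F -> Q G -> Q (fun p => F p + G p).
Proof. by case: aQ => _ + _ _; exact. Qed.
Let QM F G : Q F -> Q G -> Q (fun p => F p * G p).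
Proof. by case: aQ => _ _ + _; exact. Qed.
Let cH b : continuous (H b). Proof. exact: Creg_cont (Qreg 0 (QH b)). Qed.
Let pH b : per (H b). Proof. exact: Qper. Qed.
Let crho : continuous rho. Proof. exact: Creg_cont (Qreg 0 Qrho). Qed.

Let X : set P := [set p | rho p < d / 2].
Let Y : set P := [set p | rho p <= d].
Let oX : open X.
Proof.
rewrite (_ : X = rho @^-1` [set t | t < d / 2])//.
by apply: open_comp => [p _|]; [exact: crho|exact: open_lt].
Qed.
Let oY : open (~` Y).
Proof.
rewrite (_ : ~` Y = rho @^-1` [set t | d < t]).
  by apply: open_comp => [p _|]; [exact: crho|exact: open_gt].
by apply/seteqP; split=> p; rewrite /Y /= ltNge => /negP.
Qed.
Let XY p : X p -> Y p. Proof. by rewrite /X /Y /= => h; have := d0; lra. Qed.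

(** Confines the averages to [Y], where the chart is valid. Its own average is the normalisation,
    because that average differentiates by the same formula as the others. *)
Let chi p := Num.max 0 (d - rho p) ^+ k.+1.
Let Qdrho (c : R) : Q (fun p => c - rho p).
Proof.
rewrite (_ : (fun p => _) = fun p => (fun=> c) p + (fun=> -1) p * rho p).
  by apply: QD => //; apply: QM.
by apply/funext => p; rewrite mulN1r.
Qed.
Let rchi : Creg k chi. Proof. by apply: Creg_posX; exact: Qreg. Qed.
Let pchi : per chi. Proof. by move=> p q pq; rewrite /chi (Qper Qrho pq). Qed.
Let cchi : continuous chi. Proof. exact: Creg_cont rchi. Qed.
Let chi0 p : 0 <= chi p. Proof. by rewrite exprn_ge0// le_max lexx. Qed.
Let chiY p : ~ Y p -> chi p = 0.
Proof.
by rewrite /Y /= => /negP; rewrite -ltNge => dp; rewrite /chi max_l ?expr0n// subr_le0 ltW.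
Qed.
Let chi_gt0 p : rho p < d -> 0 < chi p.
Proof. by move=> pd; rewrite exprn_gt0// lt_max subr_gt0 pd orbT. Qed.

(** Agrees with [chi] on [X] but is positive everywhere, so that the limit [f / chih] on [X] extends
    to a regular function on the whole space. *)
Let chih p := chi p + Num.max 0 (rho p - d / 2) ^+ k.+1.
Let rchih : Creg k chih.
Proof.
apply: CregD => //; apply: Creg_posX; apply: CregB; [exact: Qreg|exact: Creg_cst].
Qed.
Let pchih : per chih.
Proof. by move=> p q pq; rewrite /chih (pchi pq) (Qper Qrho pq). Qed.
Let chih_gt0 p : 0 < chih p.
Proof.
have [pd|pd] := ltP (rho p) d.
  by rewrite ltr_pwDl ?chi_gt0// exprn_ge0// le_max lexx.
by rewrite ltr_wpDl// exprn_gt0// lt_max; apply/orP; right; have := d0; lra.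
Qed.
Let chihX p : X p -> chih p = chi p.
Proof.
by rewrite /X /= => pX; rewrite /chih [Num.max 0 _]max_l ?expr0n ?addr0// subr_le0 ltW.
Qed.

Let tensor_kern n : tensor Q (kern H M n) := kern_tensor M n aQ QH.

Let Pn n (f : P -> R) x := cellint (fun y => f y * kern H M n x y).
Let QPn n f : continuous f -> Q (Pn n f).
Proof.
by move=> cf; apply: tensor_int => //; exact: continuous_pairs.
Qed.

Let det y := \det (jacobian H y).
Let rdet j : Creg j det.
Proof. by apply: Creg_det => a b; exact: (jacobian_reg aQ QH). Qed.
Let pjac : per (jacobian H).
Proof.
by move=> p q pq; apply/matrixP => i b; rewrite !mxE (per_dpar i (@pH b) pq).
Qed.

(* [E] inverts the Jacobian wherever the determinant exceeds 1/2, and stays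
   regular where the determinant vanishes. *)
Let den y := det y ^+ 2 + Num.max 0 (2^-1 - det y) ^+ k.+1.
Let den_neq0 y : den y != 0.
Proof.
rewrite gt_eqF//; have [h|h] := ltP (det y) 2^-1.
  by rewrite ltr_wpDl ?sqr_ge0// exprn_gt0// lt_max subr_gt0 h orbT.
rewrite ltr_pwDl ?exprn_ge0 ?le_max ?lexx// exprn_gt0//.
by rewrite (lt_le_trans _ h)// invr_gt0.
Qed.
Let E b j y := (\adj (jacobian H y)) b j * (det y / den y).
Let rE b j : Creg k (E b j).
Proof.
apply: CregM; first by apply: Creg_adj => a c; exact: (jacobian_reg aQ QH).
apply: CregM => //; apply: CregV => //; apply: CregD; first exact: CregX.
by apply: Creg_posX; apply: CregB => //; exact: Creg_cst.
Qed.
Let pE b j : per (E b j).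
Proof. by move=> p q pq; rewrite /E /den /det (pjac pq). Qed.

Let detden y : Y y -> det y * (det y / den y) = 1.
Proof.
move=> Yy; have h := detY Yy; have h0 : det y != 0.
  by rewrite gt_eqF// (lt_trans _ h)// invr_gt0.
rewrite /den [Num.max 0 _]max_l ?expr0n ?addr0; last by rewrite subr_le0 ltW.
by rewrite mulrA -expr2 divff// expf_neq0.
Qed.

Let jacE y i b : jacobian H y i b = dpar i (H b) y. Proof. by rewrite mxE. Qed.

Let E_left y b a : Y y -> \sum_(j < 3) E b j y * dpar j (H a) y = (b == a)%:R.
Proof.
move=> Yy; have /matrixP/(_ b a) := mul_adj_mx (jacobian H y); rewrite [LHS]mxE [RHS]mxE => Eq.
rewrite (_ : (b == a)%:R = (det y / den y) * (det y *+ (b == a))); last first.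
  by rewrite -[det y *+ _]mulr_natr mulrA [_ * det y]mulrC detden// mul1r.
rewrite -Eq mulr_sumr; apply: eq_bigr => j _; rewrite jacE /E; ring.
Qed.

Let E_right y i j : Y y -> \sum_(b < 3) dpar i (H b) y * E b j y = (i == j)%:R.
Proof.
move=> Yy; have /matrixP/(_ i j) := mul_mx_adj (jacobian H y); rewrite [LHS]mxE [RHS]mxE => Eq.
rewrite (_ : (i == j)%:R = (det y / den y) * (det y *+ (i == j))); last first.
  by rewrite -[det y *+ _]mulr_natr mulrA [_ * det y]mulrC detden// mul1r.
rewrite -Eq mulr_sumr; apply: eq_bigr => b _; rewrite jacE /E; ring.
Qed.

(** Up to sign, the formal adjoint of the chart derivative, whose components are [E b j]. *)
Let DD b (f : P -> R) y := \sum_(j < 3) dpar j (fun z => f z * E b j z) y.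

Let DD_reg b j f : (j < k)%N -> Creg j.+1 f -> Creg j (DD b f).
Proof.
move=> jk rf; apply: Creg_sum => l _; apply: Creg_dpar; apply: CregM => //.
exact: Creg_le jk _.
Qed.

Let DD_per b f : per f -> per (DD b f).
Proof.
move=> pf p q pq; apply: eq_bigr => j _; apply: per_dpar pq.
by move=> p' q' pq'; rewrite (pf _ _ pq') (@pE b j _ _ pq').
Qed.

Let DD_off b f : (forall y, ~ Y y -> f y = 0) -> forall y, ~ Y y -> DD b f y = 0.
Proof.
move=> f0 y nY; apply: big1 => j _; apply/eqP; rewrite -normr_le0.
apply: (bnd0 (A := ~` Y) (k := 0)) nY.
apply: bnd_dpar; apply: bnd_open0 => // p nYp.
by rewrite f0// mul0r.
Qed.

Let base_dpar x y i : dpar i (fun x => 1 - sqdist H x y / M) x =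
  - (2 / M) * \sum_(a < 3) (H a x - H a y) * dpar i (H a) x.
Proof.
have dH a p : derivable (H a) p (axis R i) by exact: Creg_der (Qreg 1 (QH a)).
have rHy a : Creg 1 (fun z => H a z - H a y).
  by apply: CregB; [exact: Qreg|exact: Creg_cst].
have dHy a p : derivable (fun z => H a z - H a y) p (axis R i) := Creg_der (rHy a).
have rsq a : Creg 1 (fun z => (H a z - H a y) ^+ 2) by exact: CregX.
have dsq a p : derivable (fun z => (H a z - H a y) ^+ 2) p (axis R i) := Creg_der (rsq a).
have rS : Creg 1 (fun z => \sum_(a < 3) (H a z - H a y) ^+ 2) by exact: Creg_sum.
have dS p : derivable (fun z => \sum_(a < 3) (H a z - H a y) ^+ 2) p (axis R i) := Creg_der rS.
have -> : (fun x => 1 - sqdist H x y / M) =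
    fun x => (fun=> 1) x - M^-1 * (\sum_(a < 3) (H a x - H a y) ^+ 2).
  by apply/funext => z; rewrite mulrC.
rewrite dparB => [|p|p]; last first.
- by apply: derivableM => //; exact: derivable_cst.
- exact: derivable_cst.
rewrite dpar_cst dparZ// dpar_sum// sub0r.
rewrite (_ : \sum_(a < 3) dpar i (fun z => (H a z - H a y) ^+ 2) x =
  2 * \sum_(a < 3) (H a x - H a y) * dpar i (H a) x); first by ring.
rewrite mulr_sumr; apply: eq_bigr => a _.
rewrite (dparX (dHy a)) expr1 (dparB (dH a)) => [|p]; last exact: derivable_cst.
by rewrite dpar_cst subr0 mulrA.
Qed.

Let kern_reg j n x : Creg j (kern H M n x).
Proof.
apply: CregX; apply: CregB; first exact: Creg_cst.
apply: CregM; last exact: Creg_cst.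
apply: Creg_sum => a _; apply: CregX; apply: CregB; first exact: Creg_cst.
exact: Qreg.
Qed.

Let kern_per n x : per (kern H M n x).
Proof. by move=> p q pq; rewrite /kern (sqdist_perr pH x pq). Qed.

(** The kernel depends on [H x - H y] only, so its derivative in [x] is minus its chart derivatives
    in [y], weighted by the Jacobian at [x]. [E] inverts the Jacobian on [Y]; elsewhere the factor
    [f y] is zero. *)
Let kern_dpar f n i x y : (~ Y y -> f y = 0) ->
  f y * dpar i (fun z => kern H M n z y) x =
  \sum_(b < 3) \sum_(j < 3) - dpar i (H b) x *
    ((f y * E b j y) * dpar j (kern H M n x) y).
Proof.
have [Yy _|nY /(_ nY) ->] := pselect (Y y); last first.
  by rewrite mul0r big1// => b _; apply: big1 => j _; rewrite !mul0r mulr0.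
case: n => [|n].
  have E1 (F : P -> R) : (fun z => F z ^+ 0) = fun=> 1 by apply/funext => z.
  rewrite /kern !E1 dpar_cst mulr0 big1// => b _; apply: big1 => j _.
  by rewrite dpar_cst !mulr0.
have sqC z w : sqdist H z w = sqdist H w z.
  by apply: eq_bigr => a _; rewrite -opprB sqrrN.
rewrite /kern dparX => [|p]; last first.
  by apply: (@Creg_der _ 0); rewrite (_ : (fun z => _) = fun z => kern H M 1 y z)//;
    apply/funext => z; rewrite /kern expr1 sqC.
rewrite base_dpar.
have -> : (fun y => (1 - sqdist H x y / M) ^+ n.+1) =
    fun y => (1 - sqdist H y x / M) ^+ n.+1.
  by apply/funext => z; rewrite sqC.
have Ed j : dpar j (fun y => (1 - sqdist H y x / M) ^+ n.+1) y =
    n.+1%:R * (1 - sqdist H x y / M) ^+ n *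
    ((2 / M) * \sum_(a < 3) (H a x - H a y) * dpar j (H a) y).
  rewrite dparX => [|p]; last first.
    by apply: (@Creg_der _ 0); rewrite (_ : (fun z => _) = fun z => kern H M 1 x z)//;
      apply/funext => z; rewrite /kern expr1 sqC.
  rewrite base_dpar sqC mulNr -mulrN -sumrN; congr (_ * (_ * _)).
  by apply: eq_bigr => a _; rewrite -mulNr opprB.
rewrite [RHS](eq_bigr (fun b => \sum_(j < 3) - dpar i (H b) x * (f y * E b j y *
    (n.+1%:R * (1 - sqdist H x y / M) ^+ n *
    ((2 / M) * \sum_(a < 3) (H a x - H a y) * dpar j (H a) y))))); last first.
  by move=> b _; apply: eq_bigr => j _; rewrite Ed.
set c := n.+1%:R * _.
rewrite [LHS](_ : _ = - (f y * c * (2 / M) * \sum_(b < 3) (H b x - H b y) * dpar i (H b) x)).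
  rewrite mulr_sumr -sumrN; apply: eq_bigr => b _.
  have -> : H b x - H b y = \sum_(a < 3) (H a x - H a y) *
      (\sum_(j < 3) E b j y * dpar j (H a) y).
    rewrite (bigD1 b)//= E_left// eqxx mulr1 big1 ?addr0// => a ab.
    by rewrite E_left// eq_sym (negPf ab) mulr0.
  under eq_bigr do rewrite mulr_sumr.
  rewrite exchange_big /= mulr_suml mulr_sumr -sumrN; apply: eq_bigr => j _.
  have -> : \sum_(a < 3) (H a x - H a y) * (E b j y * dpar j (H a) y) =
      E b j y * \sum_(a < 3) (H a x - H a y) * dpar j (H a) y.
    by rewrite mulr_sumr; apply: eq_bigr => a _; ring.
  ring.
ring.
Qed.

(** Integration by parts moves the derivatives from the kernel onto [f], leaving averages with
    coefficients independent of [n]. *)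
Let Pn_dpar f n i x : (0 < k)%N -> Creg 1 f -> per f -> (forall y, ~ Y y -> f y = 0) ->
  dpar i (Pn n f) x = \sum_(b < 3) dpar i (H b) x * Pn n (DD b f) x.
Proof.
move=> k0 rf pf fY.
have [_ ->] := tensor_int_dpar aQ (continuous_pairs (Creg_cont rf)) i x (tensor_kern n).
rewrite [LHS](_ : _ = cellint (fun y => \sum_(b < 3) \sum_(j < 3) - dpar i (H b) x *
    ((f y * E b j y) * dpar j (kern H M n x) y))); last first.
  by congr cellint; apply/funext => y; apply: kern_dpar; exact: fY.
have rG b j : Creg 1 (fun y => f y * E b j y).
  by apply: CregM => //; exact: Creg_le k0 _.
have pG b j : per (fun y => f y * E b j y).
  by move=> p q pq; rewrite (pf _ _ pq) (@pE b j _ _ pq).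
have iG b j : cintegrable (fun y => (f y * E b j y) * dpar j (kern H M n x) y).
  apply: cintegrable_cont; apply: (@Creg_cont _ 0).
  by apply: CregM; [exact: CregW|exact: Creg_dpar (kern_reg 1 n x)].
rewrite cellint_sum => [|b]; last by apply: cintegrable_sum => j; exact: cintegrableZ.
apply: eq_bigr => b _.
rewrite cellint_sum => [|j]; last exact: cintegrableZ.
rewrite /Pn /DD [in RHS](_ : (fun y => _) = fun y => \sum_(j < 3)
    dpar j (fun z => f z * E b j z) y * kern H M n x y); last first.
  by apply/funext => y; rewrite mulr_suml.
rewrite cellint_sum => [|j]; last first.
  apply: cintegrable_cont; apply: (@Creg_cont _ 0).
  by apply: CregM; [exact: Creg_dpar|exact: kern_reg].
rewrite mulr_sumr; apply: eq_bigr => j _.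
by rewrite cellintZ// cellint_by_parts// ?mulrNN.
Qed.

Let cn_gt0 n x : 0 < Pn n chi x.
Proof.
apply: (@cellint_gt0 _ _ x0).
- by apply: contM => //; exact: Creg_cont (kern_reg 0 n x).
- by move=> p q pq; rewrite (pchi pq) (@kern_per n x _ _ pq).
- by move=> p; rewrite mulr_ge0// ltW// kern_gt0.
- by rewrite mulr_gt0 ?chi_gt0 ?rho_x0// kern_gt0.
Qed.

Let Rn n f x := Pn n f x * (Pn n chi x)^-1.

Let Rn_reg j n f : continuous f -> Creg j (Rn n f).
Proof.
move=> cf; apply: CregM; first exact/Qreg/QPn.
by apply: CregV; [move=> p; rewrite gt_eqF|exact/Qreg/QPn].
Qed.

Let Rn_clo j n f : continuous f -> clo Q j (Rn n f).
Proof.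
move=> cf; apply: cloM => //; first exact/clo_sub/QPn.
by apply: cloV => //; exact/clo_sub/QPn.
Qed.

Let Rn_dpar n f i : (0 < k)%N -> Creg 1 f -> per f -> (forall y, ~ Y y -> f y = 0) ->
  dpar i (Rn n f) = fun x => \sum_(b < 3) dpar i (H b) x *
    (Rn n (DD b f) x - Rn n f x * Rn n (DD b chi) x).
Proof.
move=> k0 rf pf fY; have cf := Creg_cont rf.
have dP g p : continuous g -> derivable (Pn n g) p (axis R i).
  by move=> cg; exact: Creg_der (Qreg 1 (QPn n cg)).
have cn0 p : Pn n chi p != 0 by rewrite gt_eqF.
rewrite dparM => [|p|p]; [|exact: dP|by apply: derivableV => //; exact: dP].
rewrite dparV//; last by move=> p; exact: dP.
apply/funext => x; rewrite !Pn_dpar//; last exact: Creg_le k0 rchi.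
rewrite !mulr_sumr -big_split /=; apply: eq_bigr => b _; rewrite /Rn.
move: (Pn n (DD b f) x) (Pn n (DD b chi) x) (Pn n f x) (Pn n chi x) (dpar i (H b) x).
by move=> u v w z t; ring.
Qed.

Let C0_convergence f : continuous f -> per f -> (forall y, ~ Y y -> f y = 0) ->
  forall e : R, 0 < e -> exists N, forall n, (N <= n)%N -> forall x, X x ->
    `|Rn n f x - f x / chih x| <= e.
Proof.
move=> cf pf fY e e0.
pose X2 : set P := [set p | rho p <= d / 2].
have cX2 : closed X2.
  rewrite (_ : X2 = rho @^-1` [set t | t <= d / 2])//.
  by apply: closed_comp => [p _|]; [exact: crho|exact: closed_le].
have cY : closed Y by rewrite -openC.
have pX2 : per X2 by move=> p q pq; rewrite /X2 /= (Qper Qrho pq).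
have pY : per Y by move=> p q pq; rewrite /Y /= (Qper Qrho pq).
have X2chi p : X2 p -> 0 < chi p.
  by rewrite /X2 /= => h; apply: chi_gt0; have := d0; lra.
have sep p q : X2 p -> Y q -> sqdist H p q = 0 -> tpi p = tpi q.
  move=> Xp Yq E0; apply: injY => // [|b].
    by move: Xp; rewrite /X2 /=; have := d0; lra.
  apply/eqP; rewrite -subr_eq0 -sqrf_eq0.
  move/eqP : E0; rewrite psumr_eq0; last by move=> a _; exact: sqr_ge0.
  by move=> /allP/(_ b)/(_ (mem_index_enum _)).
have [N HN] := @concentration R 3 H cH pH X2 Y chi M cX2 cY pX2 pY cchi pchi chi0
  chiY X2chi M0 hM sep f e cf pf fY e0.
exists N => n Nn x Xx.
have X2x : X2 x by move: Xx; rewrite /X /X2 /=; exact: ltW.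
have := HN _ Nn _ X2x; rewrite -!/(Pn _ _ _) chihX// => h.
have c0 := X2chi _ X2x; have p0 := cn_gt0 n x.
rewrite /Rn (_ : _ - _ = (chi x * Pn n f x - f x * Pn n chi x) / (chi x * Pn n chi x)).
  by rewrite normrM normfV (gtr0_norm (mulr_gt0 c0 p0)) ler_pdivrMr// mulr_gt0.
by field; rewrite !gt_eqF.
Qed.

(** By [Rn_dpar] the derivatives of an average are polynomial in averages of functions with one
    derivative less, so uniform convergence propagates from order to order. The limit is recognised
    as the derivative of [f / chih]: the terms in which [E] is differentiated cancel between [f] and
    [chi], and [E_right] recombines the chart derivatives. *)
Let Ck_convergence j : (j <= k)%N -> forall f, Creg j f -> per f ->
  (forall y, ~ Y y -> f y = 0) ->
  cv X j (fun n => Rn n f) (fun x => f x / chih x).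
Proof.
have ch0 p : chih p != 0 by rewrite gt_eqF.
elim: j => [_|j IH jk] f rf pf fY.
  have cf := Creg_cont rf; split=> [n|||e e0].
  - exact: Rn_reg.
  - by apply: CregM => //; apply: CregV => //; exact: Creg_le rchih.
  - by move=> p q pq; rewrite (pf _ _ pq) (pchih pq).
  - have [N HN] := C0_convergence cf pf fY e0.
    by exists N => n Nn; split=> // p Xp; exact: HN.
have k0 : (0 < k)%N by exact: leq_ltn_trans jk.
have rf1 : Creg 1 f by exact: Creg_le rf.
have rl : Creg j.+1 (fun x => f x / chih x).
  by apply: CregM => //; apply: CregV => //; exact: Creg_le rchih.
have pl : per (fun x => f x / chih x).
  by move=> p q pq; rewrite (pf _ _ pq) (pchih pq).
apply: cv_succ => // [n||i].
- exact: Rn_reg (Creg_cont rf).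
- exact: C0_convergence (Creg_cont rf) pf fY.
have rchi' : Creg j.+1 chi by exact: Creg_le rchi.
have IHD b g : Creg j.+1 g -> per g -> (forall y, ~ Y y -> g y = 0) ->
    cv X j (fun n => Rn n (DD b g)) (fun x => DD b g x / chih x).
  move=> rg pg gY; apply: IH; [exact: ltnW|exact: DD_reg|exact: DD_per|exact: DD_off].
have IHf : cv X j (fun n => Rn n f) (fun x => f x / chih x).
  by apply: IH => //; [exact: ltnW|exact: CregW].
have cJ b : cv X j (fun=> dpar i (H b)) (dpar i (H b)).
  by apply: cv_cst; [exact: Creg_dpar (Qreg j.+1 (QH b))|exact/per_dpar/pH].
rewrite (_ : (fun n => dpar i (Rn n f)) = fun n x => \sum_(b < 3) dpar i (H b) x *
    (Rn n (DD b f) x - Rn n f x * Rn n (DD b chi) x)); last first.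
  by apply/funext => n; rewrite Rn_dpar.
have := cv_sum_on (fun b => cvM_on (cJ b)
  (cvB_on (IHD b f rf pf fY) (cvM_on IHf (IHD b chi rchi' pchi chiY)))).
apply: cv_eq_on => //; [exact: Creg_dpar|exact: per_dpar|].
move=> x Xx; have Yx := XY Xx.
have df p l : derivable f p (axis R l) by exact: Creg_der rf1.
have rchi1 : Creg 1 chi by exact: Creg_le rchi.
have rchih1 : Creg 1 chih by exact: Creg_le rchih.
have rE1 b l : Creg 1 (E b l) by exact: Creg_le (@rE b l).
have dE b l p i' : derivable (E b l) p (axis R i') by exact: Creg_der (rE1 b l).
have dchi p l : derivable chi p (axis R l) by exact: Creg_der rchi1.
have dchih p l : derivable chih p (axis R l) by exact: Creg_der rchih1.
have chiE l : dpar l chi x = dpar l chih x.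
  have o0 : bnd X 1 0 (fun p => chih p - chi p).
    by apply: bnd_open0 => // p Xp; rewrite chihX// subrr.
  have := bnd0 (bnd_dpar l o0) Xx; rewrite dparB// normr_le0 subr_eq0.
  by move=> /eqP.
have DDE g b : (forall p l, derivable g p (axis R l)) ->
    DD b g x = \sum_(l < 3) (g x * dpar l (E b l) x + E b l x * dpar l g x).
  by move=> dg; apply: eq_bigr => l _; rewrite dparM.
rewrite [RHS](_ : _ = f x * (- ((chih x)^-1 * (chih x)^-1) * dpar i chih x) +
    (chih x)^-1 * dpar i f x); last first.
  by rewrite dparM// ?dparV// => p; apply: derivableV.
have kron g : \sum_(b < 3) dpar i (H b) x * (\sum_(l < 3) E b l x * g l) = g i.
  under eq_bigr do rewrite mulr_sumr.
  rewrite exchange_big /= (bigD1 i)//= [X in _ + X]big1 => [|l li].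
    rewrite addr0; under eq_bigr do rewrite mulrA.
    by rewrite -mulr_suml E_right// eqxx mul1r.
  under eq_bigr do rewrite mulrA.
  by rewrite -mulr_suml E_right// eq_sym (negPf li) mul0r.
rewrite -(kron (fun l => f x * (- ((chih x)^-1 * (chih x)^-1) * dpar l chih x) +
    (chih x)^-1 * dpar l f x)).
apply: eq_bigr => b _; congr (_ * _).
rewrite (DDE f b df) (DDE chi b dchi) mulr_suml mulr_suml mulr_sumr -sumrB.
apply: eq_bigr => l _.
rewrite chiE -(chihX Xx).
move: (ch0 x) (dpar l (E b l) x) (E b l x) (dpar l chih x) (dpar l f x) (f x).
move: (chih x) => c c0 e1 e2 e3 e4 e5.
by field.
Qed.

(** The averages of [chi * g] tend to [chi * g / chih], which is [g] on [X]. Off [X] the averages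
    are not controlled, but there [chiV] is flat to order [k], which annihilates any finite
    bound. *)
Lemma local_density : exists chiV : P -> R,
  [/\ clo Q k chiV, forall p, 0 <= chiV p, 0 < chiV x0 &
      forall g, Creg k g -> per g -> clo Q k (fun p => chiV p * g p)].
Proof.
pose chiV p := Num.max 0 (d / 2 - rho p) ^+ k.+1.
have cV : clo Q k chiV by apply: clo_posX => //; exact: clo_sub.
exists chiV; split=> // [p||g rg pg].
- by rewrite exprn_ge0// le_max lexx.
- by rewrite exprn_gt0// lt_max rho_x0 subr0 divr_gt0// orbT.
have [rV pV _] := cV.
have rf : Creg k (fun p => chi p * g p) by exact: CregM.
have pf : per (fun p => chi p * g p) by move=> p q pq; rewrite (pchi pq) (pg _ _ pq).
have fY y : ~ Y y -> chi y * g y = 0 by move=> /chiY ->; rewrite mul0r.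
have ch0 p : chih p != 0 by rewrite gt_eqF.
have [ru _ _ ug] : cv X k (fun n => Rn n (fun p => chi p * g p)) g.
  apply: cv_eq_on (Ck_convergence (leqnn k) rf pf fY) => // p Xp.
  by rewrite -(chihX Xp) mulrAC divff// mul1r.
apply: clo_clo => // [||e e0].
- exact: CregM.
- by move=> p q pq; rewrite (pV _ _ pq) (pg _ _ pq).
have [B B0 bB] := Creg_bnd rV pV.
have D0 : 0 < 2 ^+ k * B by rewrite mulr_gt0// exprn_gt0.
have [N HN] := ug _ (divr_gt0 e0 D0).
pose r := Rn N (fun p => chi p * g p).
have cr : clo Q k r by apply: Rn_clo; exact: Creg_cont rf.
have [rr pr _] := cr.
exists (fun p => chiV p * r p); first exact: cloM.
have rgr : Creg k (fun p => - (r p - g p)) by apply/CregN/CregB.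
rewrite (_ : (fun p => _) = fun p => chiV p * - (r p - g p)); last first.
  by apply/funext => p; ring.
have pgr : per (fun p => - (r p - g p)).
  by move=> p q pq; rewrite (pr _ _ pq) (pg _ _ pq).
have [B' B'0 bB'] := Creg_bnd rgr pgr.
apply: (@bnd_sub _ _ (X `|` ~` X)) => [p _|]; first by rewrite setUv.
apply: bndU.
  apply: (@bnd_le _ _ _ (2 ^+ k * (B * (e / (2 ^+ k * B))))).
    by rewrite mulrA mulrCA divff ?mulr1// gt_eqF.
  apply: bndM => //; first exact: bnd_sub bB.
  by apply: bndN; [exact: CregB|exact: HN].
apply: (@bnd_le _ _ _ (2 ^+ k * (0 * B'))); first by rewrite mul0r mulr0 ltW.
apply: bndM => //; last exact: bnd_sub bB'.
apply: (@bnd_sub _ _ [set p | d / 2 - rho p <= 0]) => [p|].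
  by rewrite /X /= => /negP; rewrite -leNgt subr_le0.
apply: (@bnd_posX_flat _ k (fun p => d / 2 - rho p)); first exact: Qreg.
exact: Qper.
Qed.

End LocalDensity.

(* Compactness by open covers is stated for pointed spaces, which the library
   does not infer on a product. *)
Definition space3 (R : realType) : Type := (R * R * R)%type.
HB.instance Definition _ (R : realType) :=
  Topological.copy (space3 R) (R * R * R)%type.
HB.instance Definition _ (R : realType) :=
  isPointed.Build (space3 R) ((0, 0, 0) : R * R * R).

(** * From local to global density *)

Section Nachbin.
Variable R : realType.
Local Notation P := (R * R * R)%type.
Local Notation tpi := (@torus_pi R).
Variable Q : set (P -> R).
Hypothesis aQ : periodic_algebra Q.
Variables (N : nat) (h : 'I_N -> P -> R).
Hypothesis Qh : forall a, Q (h a).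
Hypothesis imm : forall p (v : 'I_3 -> R),
  (forall a, \sum_(i < 3) v i * dpar i (h a) p = 0) -> forall i, v i = 0.
Hypothesis inj : forall p q, (forall a, h a p = h a q) -> tpi p = tpi q.

Let Qreg j F : Q F -> Creg j F. Proof. by case: aQ => _ _ _ /[apply] -[]. Qed.
Let Qper F : Q F -> per F. Proof. by case: aQ => _ _ _ /[apply] -[]. Qed.

(** The localisation uses the squared distance in all the functions [h], which separate points,
    while the kernel uses only the three chart functions, which are injective near [x0] alone. *)
Lemma local_density_at k (x0 : P) : exists chi : P -> R,
  [/\ clo Q k chi, forall p, 0 <= chi p, 0 < chi x0 &
      forall g, Creg k g -> per g -> clo Q k (fun p => chi p * g p)].
Proof.
have [H [QH HI]] := chart_exists aQ Qh imm x0.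
have [r r0 Hr] := chart_radius aQ QH HI.
have [d d0 Hd] := small_sqdist aQ Qh inj x0 r0.
have pH b : per (H b) by exact: Qper.
have pjac : per (jacobian H).
  by move=> p q pq; apply/matrixP => i b; rewrite !mxE (per_dpar i (pH b) pq).
have r3 p : ball x0 r p -> ball x0 (3 * r) p by apply: le_ball; lra.
have /choice[B HB] : forall b, exists B : R, 0 < B /\ forall p, `|H b p| <= B.
  by move=> b; have [B B0 hB] := per_bounded (Creg_cont (Qreg 0 (QH b))) (pH b); exists B.
pose M := \sum_b (2 * B b) ^+ 2 + 1.
have hM x y : sqdist H x y < M.
  rewrite ltr_pwDr//; apply: ler_sum => b _; have [b0 bB] := HB b.
  rewrite -[leLHS]real_normK ?num_real// lerXn2r ?nnegrE//.
    by rewrite mulr_ge0// ltW.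
  by rewrite (le_trans (ler_normB _ _))// mulr2n mulrDl mul1r lerD.
have M0 : 0 < M by rewrite ltr_wpDl// sumr_ge0// => b _; exact: sqr_ge0.
have Qrho : Q (fun p => sqdist h p x0).
  have [Qc QD QM _] := aQ.
  apply: (algebra_sum aQ) => a.
  rewrite (_ : (fun p => _) = fun p => (h a p + (fun=> - h a x0) p) * (h a p + (fun=> - h a x0) p)).
    by apply: QM; apply: QD.
  by apply/funext => p; rewrite expr2.
apply: (@local_density R Q aQ (fun p => sqdist h p x0) H d M k x0) => //.
- by apply: big1 => a _; rewrite subrr expr0n.
- by move=> y /Hd[y' yy' By]; rewrite -(pjac _ _ yy'); have [] := Hr y' (r3 _ By).
- move=> x y /Hd[x' xx' Bx] /Hd[y' yy' By] xy; rewrite -xx' -yy'; congr torus_pi.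
  apply: (chart_injective aQ QH (r := r) (x0 := x0)) => // [p Bp i b|b].
    by have [+ _] := Hr p Bp; exact.
  by rewrite (pH b _ _ xx') (pH b _ _ yy').
Qed.

Lemma clo_sum_seq k (I : Type) (s : seq I) (F : I -> P -> R) :
  (forall l, clo Q k (F l)) -> clo Q k (fun p => \sum_(l <- s) F l p).
Proof.
move=> cF; elim: s => [|a s IH].
  rewrite (_ : (fun p => _) = fun=> 0); first exact: clo_cst.
  by apply/funext => p; rewrite big_nil.
rewrite (_ : (fun p => _) = fun p => F a p + \sum_(l <- s) F l p); first exact: cloD.
by apply/funext => p; rewrite big_cons.
Qed.

(** Each [chi x] multiplies every regular periodic function into the closure, so the quotient
    [F / sigma] is taken as it is and the inverse of [sigma] needs no approximation. *)
Theorem nachbin k (F : P -> R) : Creg k F -> per F -> clo Q k F.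
Proof.
move=> rF pF.
have /choice[chi Hchi] : forall x0, exists chi : P -> R,
  [/\ clo Q k chi, forall p, 0 <= chi p, 0 < chi x0 &
      forall g, Creg k g -> per g -> clo Q k (fun p => chi p * g p)].
  exact: local_density_at.
have cchi x : clo Q k (chi x) by have [] := Hchi x.
have rchi x : Creg k (chi x) by have [] := cchi x.
have pchi x : per (chi x) by have [] := cchi x.
have chi0 x p : 0 <= chi x p by have [] := Hchi x.
have ochi x : open (chi x @^-1` [set t | 0 < t] : set P).
  by apply: open_comp => [p _|]; [exact: (Creg_cont (rchi x))|exact: open_gt].
have : cover_compact (@cell R : set P).
  by have := @compact_cell R; rewrite -[compact _]/(compact (_ : set (space3 R))) (compact_cover (space3 R)).
move=> /(_ P setT (fun x => chi x @^-1` [set t | 0 < t])).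
case=> [x _|p _|D _ Dcover].
- exact: ochi.
- by exists p => //=; have [] := Hchi p.
pose s : seq P := finmap.enum_fset D.
pose sigma p := \sum_(x <- s) chi x p.
have rsigma : Creg k sigma by exact: Creg_sum.
have psigma : per sigma.
  by move=> p q pq; apply: eq_bigr => x _; rewrite (pchi x _ _ pq).
have sigma0 p : 0 < sigma p.
  have [q cq qp] := cell_rep p; rewrite -(psigma _ _ qp).
  have [x /= xD xq] := Dcover _ cq.
  rewrite /sigma (big_rem x)//=; apply: ltr_pwDl => //; exact: sumr_ge0.
have sn0 p : sigma p != 0 by rewrite gt_eqF.
have rg : Creg k (fun p => F p / sigma p) by apply: CregM => //; exact: CregV.
have pg : per (fun p => F p / sigma p).
  by move=> p q pq; rewrite (pF _ _ pq) (psigma _ _ pq).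
have : clo Q k (fun p => \sum_(x <- s) chi x p * (F p / sigma p)).
  by apply: clo_sum_seq => x; have [_ _ _] := Hchi x; exact.
congr clo; apply/funext => p; rewrite -mulr_suml -/(sigma p).
by rewrite mulrC divfK.
Qed.

End Nachbin.

(** * The saturation space *)

Section RealSpanTheory.
Variables (R : realType) (V : lmodType R).
Implicit Types (S L : set V) (c : R).

Definition real_subspace L : Prop :=
  L 0 /\ forall c u v, L u -> L v -> L (c *: u + v).

Lemma real_subspaceZ L c u : real_subspace L -> L u -> L (c *: u).
Proof. by move=> [L0 H] Lu; rewrite -[c *: u]addr0; exact: H. Qed.

Lemma real_subspaceD L u v : real_subspace L -> L u -> L v -> L (u + v).
Proof. by move=> [L0 H] Lu Lv; rewrite -[u]scale1r; exact: H. Qed.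

Lemma real_subspace_sum L (I : Type) (s : seq I) (F : I -> V) : real_subspace L ->
  (forall i, L (F i)) -> L (\sum_(i <- s) F i).
Proof.
move=> sL LF; elim: s => [|a s IH]; first by rewrite big_nil; case: sL.
by rewrite big_cons; exact: real_subspaceD.
Qed.

Lemma real_span_sub S : S `<=` real_span S.
Proof.
move=> v Sv; exists 1, (fun=> 1), (fun=> v); split=> //.
by rewrite big_ord1 scale1r.
Qed.

Lemma real_span_subspace S : real_subspace (real_span S).
Proof.
split; first by exists 0, (fun=> 0), (fun=> 0); split=> [[]//|]; rewrite big_ord0.
move=> c u v [n [a [x [Sx ->]]]] [k [d [y [Sy ->]]]].
exists (n + k)%N, (fun i => match fintype.split i with inl j => c * a j | inr j => d j end),
  (fun i => match fintype.split i with inl j => x j | inr j => y j end); split.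
  by move=> i; case: (fintype.split i).
rewrite big_split_ord scaler_sumr /=; congr (_ + _); apply: eq_bigr => i _.
  by rewrite (unsplitK (inl i)) scalerA.
by rewrite (unsplitK (inr i)).
Qed.

Lemma real_span_min S L : real_subspace L -> S `<=` L -> real_span S `<=` L.
Proof.
move=> sL SL v [n [a [x [Sx ->]]]]; apply: real_subspace_sum => // i.
by apply: real_subspaceZ => //; exact/SL/Sx.
Qed.

End RealSpanTheory.

(** * The cubic form in real coordinates *)

Section CubicParts.
Variable R : realType.
Local Notation C := (Rcomplex R).
Local Notation re := (@complex.Re R).
Local Notation im := (@complex.Im R).

(** Together with [cross], the real and imaginary parts of [conjc z * w]: the scalar product and the
    determinant of two vectors in the plane. *)
Definition dotre (z w : C) : R := re z * re w + im z * im w.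
Definition cross (z w : C) : R := re z * im w - im z * re w.

Lemma J_D3N_parts (z h k : C) : J (D3N z h k) = Complex
  (- 2 * (2 * dotre h k * im z + (re h * im k + im h * re k) * re z
     - (re h * re k - im h * im k) * im z))
  (2 * (2 * dotre h k * re z + (re h * re k - im h * im k) * re z
     + (re h * im k + im h * re k) * im z)).
Proof.
case: z h k => [z1 z2] [h1 h2] [k1 k2].
rewrite /J /D3N /dotre mulr2n mulrDl !mul1r /=; simpc; congr Complex; ring.
Qed.

Lemma scale_parts (c : R) (z : C) : c *: z = Complex (c * re z) (c * im z).
Proof. by case: z. Qed.

Lemma add_parts (z w : C) : z + w = Complex (re z + re w) (im z + im w).
Proof. by case: z w => [? ?] []. Qed.

Lemma J_parts (z : C) : J z = Complex (- im z) (re z).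
Proof. by case: z => [? ?]; rewrite /J; simpc. Qed.

Definition cubic_parts := (J_D3N_parts, J_parts, scale_parts, add_parts).

End CubicParts.

(** * Algebraic description of the saturation space *)

Section Saturation.
Variable R : realType.
Local Notation C := (Rcomplex R).
Local Notation T3 := (torus3 R).
Variables (m : nat) (b : 'I_m -> T3 -> C).
Local Notation W := (sat_limit b).
Implicit Types (f g phi : T3 -> C) (s : T3 -> R) (j k l n p q : 'I_m).

Lemma D3N_linear1 (h k : C) : linear (fun z : C => J (D3N z h k)).
Proof.
move=> c u v; rewrite !cubic_parts /=; congr Complex; ring.
Qed.

Lemma D3NC (h k l : C) : D3N h k l = D3N k h l.
Proof. by rewrite /D3N; ring. Qed.

Lemma D3NC13 (h k l : C) : D3N h k l = D3N l k h.
Proof. by rewrite /D3N; ring. Qed.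

Lemma D3N0 (h k : C) : J (D3N 0 h k) = 0.
Proof.
by have := D3N_linear1 h k (-1) 0 0; rewrite scaler0 add0r scaleN1r addNr.
Qed.

Lemma sat_space_subspace i : real_subspace (sat_space b i).
Proof. by case: i => [|i]; exact: real_span_subspace. Qed.

Lemma sat_spaceS i : sat_space b i `<=` sat_space b i.+1.
Proof. by move=> f Wf; apply: real_span_sub; left. Qed.

Lemma sat_space_le i i' : (i <= i')%N -> sat_space b i `<=` sat_space b i'.
Proof.
move=> /subnK <-; elim: (i' - i)%N => [//|d IH]; rewrite addSn => f /IH.
exact: sat_spaceS.
Qed.

Lemma sat_limit_subspace : real_subspace W.
Proof.
split; first by exists 0; rewrite //; exact: (sat_space_subspace 0).1.
move=> c u v [i _ ui] [i' _ vi]; exists (maxn i i') => //.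
by apply: (sat_space_subspace _).2; [apply: sat_space_le ui|apply: sat_space_le vi];
  rewrite ?leq_maxl ?leq_maxr.
Qed.

Lemma sat_limit_generator j : W (b j).
Proof. by exists 0 => //; apply: real_span_sub; exists j. Qed.

Lemma sat_limit_Tfield j k phi : W phi -> W (fun x => Tfield b j k x (phi x)).
Proof.
move=> [i _ Wi]; exists i.+1 => //; apply: real_span_sub; right.
by exists phi, (b j), (b k); split=> //; apply: real_span_sub; eexists.
Qed.

(** The saturation steps allow [h] and [k] in the span of the generators; linearity in each slot and
    symmetry of [D3N] reduce them one after the other to generators. Properties of all saturated
    functions are proved below by exhibiting such an [L]. *)
Lemma sat_limit_min (L : set (T3 -> C)) : real_subspace L -> (forall j, L (b j)) ->
  (forall phi j k, L phi -> L (fun x => Tfield b j k x (phi x))) -> W `<=` L.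
Proof.
move=> sL Lb LT.
have span0 : sat_space0 b `<=` L.
  by apply: real_span_min => // _ [j _ <-].
have LD phi h h2 : L phi -> sat_space0 b h -> sat_space0 b h2 ->
    L (fun x => J (D3N (phi x) (h x) (h2 x))).
  move=> Lphi Sh Sk.
  pose L1 (h1 : T3 -> C) := forall h3, sat_space0 b h3 -> L (fun x => J (D3N (phi x) (h1 x) (h3 x))).
  suff /(_ _ Sh)/(_ _ Sk) : sat_space0 b `<=` L1 by [].
  apply: real_span_min.
    split=> [k' _|c u v Lu Lv k' Sk'].
      have [L0 _] := sL; congr L : L0; apply/funext => x.
      by rewrite D3NC D3N0.
    have := sL.2 c _ _ (Lu _ Sk') (Lv _ Sk'); congr L; apply/funext => x.
    have := D3N_linear1 (phi x) (k' x) c (u x) (v x); rewrite /= => E.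
    by rewrite [RHS](congr1 (@J R) (D3NC _ _ _)) E (D3NC (u x)) (D3NC (v x)).
  move=> _ [j _ <-] k'; move: k'; apply: real_span_min.
    split=> [|c u v Lu Lv].
      have [L0 _] := sL; congr L : L0; apply/funext => x.
      by rewrite D3NC13 D3N0.
    have := sL.2 c _ _ Lu Lv; congr L; apply/funext => x.
    have := D3N_linear1 (b j x) (phi x) c (u x) (v x); rewrite /= => E.
    by rewrite [RHS](congr1 (@J R) (D3NC13 _ _ _)) E (D3NC13 (u x)) (D3NC13 (v x)).
  by move=> _ [k' _ <-]; exact: LT.
move=> f [i _]; elim: i f => [|i IH] f; first exact: span0.
apply: real_span_min => // g [/IH//|[phi [h [k [Wphi Sh Sk ->]]]]].
by apply: LD => //; exact: IH.
Qed.

Lemma sat_limit_algebra A phi : Tfield_algebra b A -> W phi ->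
  W (fun x => A x (phi x)).
Proof.
move=> AA; move: phi; apply: (AA [set B | forall phi, W phi -> W (fun x => B x (phi x))]).
split; first split=> //.
- move=> c B D HB HD phi Wphi.
  exact: (sat_limit_subspace.2 c _ _ (HB _ Wphi) (HD _ Wphi)).
- by move=> B D HB HD phi Wphi; apply: HB; exact: HD.
- by move=> _ [j _ [k _ <-]] phi Wphi; exact: sat_limit_Tfield.
Qed.

Lemma Tfield_algebra_unital : unital_subalgebra (Tfield_algebra b).
Proof.
split=> [A [[]//]|c A B AA AB S HS|A B AA AB S HS].
  by have [[_ HZ _] _] := HS; apply: HZ; [exact: AA|exact: AB].
by have [[_ _ HM] _] := HS; apply: HM; [exact: AA|exact: AB].
Qed.

Lemma Tfield_in_algebra j k : Tfield_algebra b (Tfield b j k).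
Proof. by move=> S [_]; apply; exists j => //; exists k. Qed.

Lemma sat_limitE : W = [set f : T3 -> C |
  exists A : 'I_m -> T3 -> C -> C,
    (forall j : 'I_m, Tfield_algebra b (A j)) /\
    f = (fun x => \sum_(j < m) A j x (b j x))].
Proof.
have [A1 AZ AM] := Tfield_algebra_unital.
have A0 : Tfield_algebra b (fun x z => 0).
  have := AZ (-1) _ _ A1 A1; congr (Tfield_algebra b).
  by apply/funext => x; apply/funext => z; rewrite scaleN1r addNr.
apply/seteqP; split=> [|f [A [AA ->]]]; last first.
  have := real_subspace_sum (index_enum 'I_m) sat_limit_subspace
    (fun j => sat_limit_algebra (AA j) (sat_limit_generator j)).
  by congr W; apply/funext => x; rewrite fct_sumE.
apply: sat_limit_min.
- split=> [|c u v [A [AA ->]] [B [BB ->]]].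
    exists (fun=> fun x z => 0); split=> //.
    by apply/funext => x; rewrite big1.
  exists (fun j x z => c *: A j x z + B j x z); split=> [j|]; first exact: AZ.
  apply/funext => x; rewrite big_split /= -scaler_sumr //.
- move=> j; exists (fun l => if l == j then fun=> idfun else fun=> fun=> 0); split.
    by move=> l; case: ifP.
  apply/funext => x; rewrite (bigD1 j)//= eqxx big1 ?addr0// => l /negPf -> //.
- move=> phi j k [A [AA ->]].
  exists (fun l x => Tfield b j k x \o A l x); split=> [l|].
    by apply: AM => //; exact: Tfield_in_algebra.
  apply/funext => x /=.
  have lT := Tfield_algebra_linear x (Tfield_in_algebra j k).
  apply: (big_morph (Tfield b j k x)) => [z w|].
    by have := lT 1 z w; rewrite !scale1r.
  by have := lT (-1) 0 0; rewrite scaler0 add0r scaleN1r addNr.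
Qed.

End Saturation.

(** * Directional derivatives *)

Section Directional.
Variable R : realType.
Local Notation P := (R * R * R)%type.
Implicit Types (F : P -> R) (p v : P).

(** The immersion condition quantifies over all directions, whereas [Creg] records derivatives along
    the axes; continuity of the latter bridges the gap. *)
Lemma directional_derivative F p v : Creg 1 F ->
  is_derive p v F (\sum_(i < 3) coord i v * dpar i F p).
Proof.
move=> rF; set L := \sum_(i < 3) _.
have dF i z : derivable F z (axis R i) by exact: (Creg_der rF).
suff H : h^-1 *: ((F \o shift p) (h *: v) - F p) @[h --> 0^'] --> L.
  by split; [apply/cvg_ex; exists L|apply: cvg_lim].
apply/cvgrPdist_le => e e0.
pose V := 1 + \sum_(i < 3) `|coord i v|.
have V0 : 0 < V by rewrite ltr_pwDl ?sumr_ge0.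
have [r r0 Hr] : exists2 r, 0 < r & forall i z, ball p (3 * r) z ->
    `|dpar i F p - dpar i F z| <= e / V.
  have : \forall z \near p, forall i, `|dpar i F p - dpar i F z| <= e / V.
    apply: (@filter_forall _ _ (fun i z => `|dpar i F p - dpar i F z| <= e / V) (nbhs p) _) => i; have /(_ p)/cvgrPdist_le := Creg_cont (Creg_dpar i rF).
    by apply; exact: divr_gt0.
  move=> /nbhs_ballP[r /= r0 Hr]; exists (r / 3); first exact: divr_gt0.
  by move=> i z; rewrite mulrC divfK ?pnatr_eq0// => /Hr; exact.
have hb : \forall h \near 0^', ball p r (h *: v + p).
  have cl : continuous (fun h : R => h *: v + p).
    by move=> h; apply: cvgD; [apply: cvgZl|]; [exact: cvg_id|exact: cvg_cst].
  have : \forall h \near (0 : R), ball p r (h *: v + p).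
    by have /= := cl 0; rewrite /continuous_at scale0r add0r; apply; exact: nbhsx_ballx.
  exact: cvg_within.
near=> h.
have h0 : h != 0 by near: h; exact: nbhs_dnbhs_neq.
have [|xi [bxi E]] := path_mvt dF (near hb h _) (ballxx p r0); first by [].
rewrite /= E /L scaler_sumr -sumrB (le_trans (ler_norm_sum _ _ _))//.
apply: (@le_trans _ _ (\sum_(i < 3) `|coord i v| * (e / V))).
  apply: ler_sum => i _.
  have -> : coord i (h *: v + p) - coord i p = h * coord i v.
    by rewrite /coord; do 2?case: ifP => _ //=; rewrite addrK.
  rewrite /GRing.scale /= -(mulrA h) mulKf// -mulrBr normrM ler_wpM2l//.
  exact: Hr.
rewrite -mulr_suml mulrA ler_pdivrMr// mulrC ler_pM2l// /V lerDr //.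
Unshelve. all: by end_near.
Qed.

End Directional.

(** * Functions that act on the saturation space *)

Section Multipliers.
Variable R : realType.
Local Notation C := (Rcomplex R).
Local Notation P := (R * R * R)%type.
Local Notation T3 := (torus3 R).
Local Notation tpi := (@torus_pi R).
Local Notation re := (@complex.Re R).
Local Notation im := (@complex.Im R).
Variables (m : nat) (b : 'I_m -> T3 -> C).
Hypothesis b_smooth : forall j, torus_Cinfty (b j).
Local Notation W := (sat_limit b).

Let g j k x := dotre (b j x) (b k x).
Let om j k x := cross (b j x) (b k x).
Let r x := \sum_(l < m) g l l x.

(** The fields are trace-free endomorphisms of a real plane, and by the polarised Cayley-Hamilton
    identity the anticommutator of two such endomorphisms is a scalar. *)
Lemma D3N_anticommute (h k l n z : C) :
  J (D3N (J (D3N z l n)) h k) + J (D3N (J (D3N z h k)) l n) =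
  (- 8 * (5 * (dotre h k * dotre l n) - dotre h l * dotre k n
          - dotre h n * dotre k l)) *: z.
Proof.
rewrite !cubic_parts /dotre /=; case: h k l n z => [h1 h2] [k1 k2] [l1 l2] [n1 n2] [z1 z2].
rewrite /=; congr Complex; ring.
Qed.

(** The planar triple product identity. It trades a determinant for scalar products at the price of
    the rotation [J]. *)
Lemma cross_J (h k n : C) :
  cross h k *: J n = dotre h n *: k - dotre k n *: h.
Proof.
rewrite -scaleNr !cubic_parts /dotre /cross /=; case: h k n => [h1 h2] [k1 k2] [n1 n2].
by rewrite /=; congr Complex; ring.
Qed.

(** Both fields produce a multiple of [p ^+ 2 * conjc n], with opposite signs; after cancellation
    the rotation is undone and a real multiple of [n] remains. *)
Lemma D3N_J (p n : C) (t : R) :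
  J (D3N (t *: J n) p p) + J (D3N (t *: J p) n p) = (- 4 * (t * dotre p p)) *: n.
Proof.
rewrite !cubic_parts /dotre /=; case: p n => [p1 p2] [n1 n2].
by rewrite /=; congr Complex; ring.
Qed.

Lemma D3N_self (n : C) : J (D3N n n n) = 6 *: (dotre n n *: J n).
Proof.
rewrite !cubic_parts /dotre /=; case: n => [n1 n2].
by rewrite /=; congr Complex; ring.
Qed.

Lemma torus_CinftyP (f : T3 -> C) : torus_Cinfty f <->
  forall k, Creg k (fun p => re (f (tpi p))) /\ Creg k (fun p => im (f (tpi p))).
Proof. by split=> H k; apply/(class_CP k (tlift f)); exact: H. Qed.

Let breg j k : Creg k (fun p => re (b j (tpi p))) /\ Creg k (fun p => im (b j (tpi p))).
Proof. by have /torus_CinftyP := b_smooth j; exact. Qed.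

Let greg j l k : Creg k (fun p => g j l (tpi p)).
Proof. by have [? ?] := breg j k; have [? ?] := breg l k; apply: CregD; exact: CregM. Qed.

Let omreg j l k : Creg k (fun p => om j l (tpi p)).
Proof. by have [? ?] := breg j k; have [? ?] := breg l k; apply: CregB; exact: CregM. Qed.

Let rreg k : Creg k (fun p => r (tpi p)).
Proof. by apply: Creg_sum => l _; exact: greg. Qed.

Lemma sat_limit_smooth : W `<=` @torus_Cinfty R.
Proof.
apply: sat_limit_min => //.
  split=> [|c u v /torus_CinftyP Hu /torus_CinftyP Hv]; apply/torus_CinftyP => k.
    by split; exact: Creg_cst.
  have [u1 u2] := Hu k; have [v1 v2] := Hv k; split.
    have := CregD (CregZ c u1) v1; congr Creg; apply/funext => p /=.
    by rewrite -[(c *: u + v) _]/(c *: u _ + v _) scale_parts add_parts.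
  have := CregD (CregZ c u2) v2; congr Creg; apply/funext => p /=.
  by rewrite -[(c *: u + v) _]/(c *: u _ + v _) scale_parts add_parts.
move=> phi j l /torus_CinftyP H; apply/torus_CinftyP => k.
have [u1 u2] := H k; have [b1 b2] := breg j k; have [c1 c2] := breg l k.
pose B : P -> R := fun p => re (b j (tpi p)) * re (b l (tpi p)) - im (b j (tpi p)) * im (b l (tpi p)).
pose D : P -> R := fun p => re (b j (tpi p)) * im (b l (tpi p)) + im (b j (tpi p)) * re (b l (tpi p)).
have rB : Creg k B by apply: CregB; exact: CregM.
have rD : Creg k D by apply: CregD; exact: CregM.
split.
  have := CregZ (- 2) (CregD (CregM (CregZ 2 (greg j l k)) u2) (CregB (CregM rD u1) (CregM rB u2))).
  congr Creg; apply/funext => p; rewrite /Tfield J_D3N_parts /g /B /D /=; ring.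
have := CregZ 2 (CregD (CregM (CregZ 2 (greg j l k)) u1) (CregD (CregM rB u1) (CregM rD u2))).
congr Creg; apply/funext => p; rewrite /Tfield J_D3N_parts /g /B /D /=; ring.
Qed.

Definition multiplier (s : T3 -> R) : Prop :=
  (forall k, Creg k (s \o tpi)) /\ forall w, W w -> W (fun x => s x *: w x).

Lemma multiplier_cst (c : R) : multiplier (fun=> c).
Proof.
split=> [k|w Ww]; first exact: Creg_cst.
exact: (real_subspaceZ c (sat_limit_subspace b) Ww).
Qed.

Lemma multiplierD s t : multiplier s -> multiplier t -> multiplier (fun x => s x + t x).
Proof.
move=> [rs Ws] [rt Wt]; split=> [k|w Ww]; first exact: (CregD (rs k) (rt k)).
have := real_subspaceD (sat_limit_subspace b) (Ws _ Ww) (Wt _ Ww).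
by congr W; apply/funext => x /=; rewrite scalerDl.
Qed.

Lemma multiplierM s t : multiplier s -> multiplier t -> multiplier (fun x => s x * t x).
Proof.
move=> [rs Ws] [rt Wt]; split=> [k|w Ww]; first exact: (CregM (rs k) (rt k)).
by have := Ws _ (Wt _ Ww); congr W; apply/funext => x /=; rewrite scalerA.
Qed.

Lemma multiplierZ (c : R) s : multiplier s -> multiplier (fun x => c * s x).
Proof. by move=> ms; apply: multiplierM => //; exact: multiplier_cst. Qed.

Lemma multiplier_sum n (s : 'I_n -> T3 -> R) : (forall l, multiplier (s l)) ->
  multiplier (fun x => \sum_(l < n) s l x).
Proof.
elim: n s => [|n IH] s ms.
  by have := multiplier_cst 0; congr multiplier; apply/funext => x; rewrite big_ord0.
have := multiplierD (ms ord0) (IH (fun l => s (lift ord0 l)) (fun l => ms _)).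
by congr multiplier; apply/funext => x; rewrite big_ord_recl.
Qed.

Let multiplier_anticommute j k l n : multiplier (fun x =>
  5 * (g j k x * g l n x) - g j l x * g k n x - g j n x * g k l x).
Proof.
split=> [i|w Ww].
  have M a a' c c' : Creg i (fun p => g a a' (tpi p) * g c c' (tpi p)) by exact: CregM.
  exact: (CregB (CregB (CregZ 5 (M _ _ _ _)) (M _ _ _ _)) (M _ _ _ _)).
have sW := sat_limit_subspace b.
have := real_subspaceZ (- 8^-1) sW (real_subspaceD sW
  (sat_limit_Tfield j k (sat_limit_Tfield l n Ww))
  (sat_limit_Tfield l n (sat_limit_Tfield j k Ww))).
congr W; apply/funext => x /=; rewrite [in RHS]/g.
rewrite -[LHS]/(_ *: (J (D3N (J (D3N (w x) _ _)) _ _) + J (D3N (J (D3N (w x) _ _)) _ _))).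
rewrite D3N_anticommute scalerA; congr (_ *: _).
by field.
Qed.

(* The anticommutator identities for the three pairings of [j k l n] form an
   invertible linear system in the three products. *)
Lemma multiplier_dot2 j k l n :
  multiplier (fun x => dotre (b j x) (b k x) * dotre (b l x) (b n x)).
Proof.
have gC a c x : g a c x = g c a x by rewrite /g /dotre; ring.
have u1 := multiplier_anticommute j k l n.
have u2 := multiplier_anticommute j l k n.
have u3 := multiplier_anticommute j n k l.
have := multiplierZ 6^-1 (multiplierD u1
  (multiplierZ 3^-1 (multiplierD u1 (multiplierD u2 u3)))).
congr multiplier; apply/funext => x; rewrite -/(g _ _ _) -/(g l n x).
by rewrite (gC l k) (gC n k) (gC n l); field.
Qed.

(** Binet-Cauchy: a product of two determinants is a difference of products of scalar products. *)
Lemma multiplier_cross2 j k l n :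
  multiplier (fun x => cross (b j x) (b k x) * cross (b l x) (b n x)).
Proof.
have := multiplierD (multiplier_dot2 j l k n) (multiplierZ (-1) (multiplier_dot2 j n k l)).
by congr multiplier; apply/funext => x; rewrite /dotre /cross; ring.
Qed.

Let multiplier_rdot l n : multiplier (fun x => r x * g l n x).
Proof.
have := multiplier_sum (fun p => multiplier_dot2 p p l n).
by congr multiplier; apply/funext => x; rewrite mulr_suml.
Qed.

Let theta j k l n x := g l n x * om j k x.

(** The factor [g l n] completes the two scalar products given by [cross_J] to products of two,
    which are multipliers. *)
Let sat_limit_thetaJ j k l n p : W (fun x => theta j k l n x *: J (b p x)).
Proof.
have sW := sat_limit_subspace b.
have := sW.2 (-1) _ _ ((multiplier_dot2 l n k p).2 _ (sat_limit_generator b j))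
  ((multiplier_dot2 l n j p).2 _ (sat_limit_generator b k)).
congr W; apply/funext => x.
rewrite /theta -scalerA cross_J scalerBr !scalerA addrC scaleN1r //.
Qed.

(** [D3N_J] removes the rotation left by the previous step, at the price of the factor [g p p]. *)
Let sat_limit_thetag j k l n p q : W (fun x => (theta j k l n x * g p p x) *: b q x).
Proof.
have sW := sat_limit_subspace b.
have := real_subspaceZ (- 4^-1) sW (real_subspaceD sW
  (sat_limit_Tfield p p (sat_limit_thetaJ j k l n q))
  (sat_limit_Tfield q p (sat_limit_thetaJ j k l n p))).
congr W; apply/funext => x.
rewrite -[LHS]/(_ *: (J (D3N _ _ _) + J (D3N _ _ _))) D3N_J scalerA.
by congr (_ *: _); rewrite /g; field.
Qed.

Let rtheta j k l n x := r x * theta j k l n x.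

(** Summation over [p] turns [g p p] into [r], which is positive wherever the generators have no
    common zero. *)
Let sat_limit_rtheta j k l n q : W (fun x => rtheta j k l n x *: b q x).
Proof.
have := real_subspace_sum (index_enum 'I_m) (sat_limit_subspace b)
  (fun p => sat_limit_thetag j k l n p q).
congr W; apply/funext => x; rewrite fct_sumE /rtheta mulrC mulr_sumr scaler_suml //.
Qed.

Let sat_limit_dotJ n : W (fun x => g n n x *: J (b n x)).
Proof.
have := real_subspaceZ 6^-1 (sat_limit_subspace b)
  (sat_limit_Tfield n n (sat_limit_generator b n)).
congr W; apply/funext => x; rewrite -[LHS]/(_ *: J (D3N _ _ _)) D3N_self !scalerA.
by congr (_ *: _); rewrite /g; field.
Qed.

Let sat_limit_rthetaJ j k l n q :
  W (fun x => (rtheta j k l n x * g q q x) *: J (b q x)).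
Proof.
have := (multiplier_rdot q q).2 _ (sat_limit_thetaJ j k l n q).
by congr W; apply/funext => x; rewrite scalerA /rtheta mulrAC.
Qed.

Let multiplier_rtheta2 j k l n j' k' l' n' :
  multiplier (fun x => rtheta j k l n x * rtheta j' k' l' n' x).
Proof.
have := multiplierM (multiplierM (multiplier_rdot l n) (multiplier_rdot l' n'))
  (multiplier_cross2 j k j' k').
by congr multiplier; apply/funext => x; rewrite /rtheta /theta /om; ring.
Qed.

(* [rtheta] need not preserve the saturation space, but it maps the generators
   into it, and the product of two such functions is a multiplier. *)
Inductive coefficient : (T3 -> R) -> Prop :=
| coefficient_multiplier s : multiplier s -> coefficient s
| coefficient_odd s j k l n : multiplier s ->
    coefficient (fun x => s x * rtheta j k l n x)
| coefficientD q q' : coefficient q -> coefficient q' ->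
    coefficient (fun x => q x + q' x).

Lemma coefficientM q q' : coefficient q -> coefficient q' ->
  coefficient (fun x => q x * q' x).
Proof.
have E (u v : T3 -> R) : u =1 v -> coefficient u -> coefficient v by move=> /funext ->.
move=> cq; elim: cq q' => {q} [s ms|s j k l n ms|q1 q2 _ IH1 _ IH2] q' cq'.
- elim: cq' => {q'} [t mt|t j k l n mt|q1 q2 _ IH1 _ IH2].
  + by apply: coefficient_multiplier; exact: multiplierM.
  + by apply: E (coefficient_odd j k l n (multiplierM ms mt)) => x; rewrite mulrA.
  + by apply: E (coefficientD IH1 IH2) => x; rewrite mulrDr.
- elim: cq' => {q'} [t mt|t j' k' l' n' mt|q1 q2 _ IH1 _ IH2].
  + by apply: E (coefficient_odd j k l n (multiplierM ms mt)) => x; rewrite mulrAC.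
  + have := multiplierM (multiplierM ms mt) (multiplier_rtheta2 j k l n j' k' l' n').
    move/coefficient_multiplier; apply: E => x; exact: mulrACA.
  + by apply: E (coefficientD IH1 IH2) => x; rewrite mulrDr.
- by apply: E (coefficientD (IH1 _ cq') (IH2 _ cq')) => x; rewrite mulrDl.
Qed.

Lemma coefficient_reg q k : coefficient q -> Creg k (q \o tpi).
Proof.
elim=> [s [rs _]|s j l n p [rs _]|q1 q2 _ IH1 _ IH2]; first exact: rs.
  exact: (CregM (rs k) (CregM (rreg k) (CregM (greg n p k) (omreg j l k)))).
exact: (CregD IH1 IH2).
Qed.

(** The rotated generator carries the factor [g n n] because this is the form in which
    [Tfield b n n] produces it from [b n]. *)
Lemma coefficient_act q n : coefficient q -> W (fun x => q x *: b n x) /\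
  W (fun x => (q x * g n n x) *: J (b n x)).
Proof.
elim=> [s [_ Ws]|s j k l p [_ Ws]|q1 q2 _ [IH1 IH1'] _ [IH2 IH2']].
- split; first by apply: Ws; exact: sat_limit_generator.
  by have := Ws _ (sat_limit_dotJ n); congr W; apply/funext => x; rewrite scalerA.
- split.
    by have := Ws _ (sat_limit_rtheta j k l p n); congr W; apply/funext => x; rewrite scalerA.
  have := Ws _ (sat_limit_rthetaJ j k l p n); congr W; apply/funext => x.
  by rewrite scalerA mulrA.
- have sW := sat_limit_subspace b.
  split; [have := real_subspaceD sW IH1 IH2|have := real_subspaceD sW IH1' IH2'];
    by congr W; apply/funext => x; rewrite ?mulrDl scalerDl.
Qed.

Definition coefficient_lifts : set (P -> R) :=
  [set F | exists2 q, coefficient q & F = q \o tpi].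

Lemma coefficient_algebra : periodic_algebra coefficient_lifts.
Proof.
split=> [c|_ _ [q cq ->] [q' cq' ->]|_ _ [q cq ->] [q' cq' ->]|_ [q cq ->]].
- by exists (fun=> c) => //; apply/coefficient_multiplier/multiplier_cst.
- by exists (fun x => q x + q' x) => //; exact: coefficientD.
- by exists (fun x => q x * q' x) => //; exact: coefficientM.
- by split=> [|k]; [exact: per_tpi|exact: coefficient_reg].
Qed.

End Multipliers.

(** * Density in C^k from the embedding *)

Section EmbeddingDensity.
Variable R : realType.
Local Notation C := (Rcomplex R).
Local Notation P := (R * R * R)%type.
Local Notation T3 := (torus3 R).
Local Notation tpi := (@torus_pi R).
Local Notation re := (@complex.Re R).
Local Notation im := (@complex.Im R).
Variables (m : nat) (b : 'I_m -> T3 -> C).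
Hypothesis b_smooth : forall j, torus_Cinfty (b j).
Local Notation W := (sat_limit b).

Lemma GammaE x i j : Gamma b x i j =
  Complex (dotre (b i x) (b j x)) (cross (b j x) (b i x)).
Proof.
rewrite /Gamma mxE big_ord1 !mxE /dotre /cross.
by case: (b i x) (b j x) => [? ?] [? ?]; simpc; congr Complex => /=; ring.
Qed.

Let breg j k : Creg k (fun p => re (b j (tpi p))) /\ Creg k (fun p => im (b j (tpi p))).
Proof. by have /torus_CinftyP := b_smooth j; exact. Qed.

Definition gram_re i j (p : P) := dotre (b i (tpi p)) (b j (tpi p)).
Definition gram_im i j (p : P) := cross (b i (tpi p)) (b j (tpi p)).

Lemma gram_re_reg j l k : Creg k (gram_re j l).
Proof. by have [? ?] := breg j k; have [? ?] := breg l k; apply: CregD; exact: CregM. Qed.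

Lemma gram_im_reg j l k : Creg k (gram_im j l).
Proof. by have [? ?] := breg j k; have [? ?] := breg l k; apply: CregB; exact: CregM. Qed.

Definition ddir (v : 'I_3 -> R) (F : P -> R) (p : P) := \sum_(i < 3) v i * dpar i F p.

Lemma ddirM v F G p : Creg 1 F -> Creg 1 G ->
  ddir v (fun q => F q * G q) p = F p * ddir v G p + G p * ddir v F p.
Proof.
move=> rF rG; rewrite /ddir !mulr_sumr -big_split /=; apply: eq_bigr => i _.
by rewrite dparM; [ring|move=> z; exact: (Creg_der rF)|move=> z; exact: (Creg_der rG)].
Qed.

Lemma ddir_sum v n (F : 'I_n -> P -> R) p : (forall l, Creg 1 (F l)) ->
  ddir v (fun q => \sum_(l < n) F l q) p = \sum_(l < n) ddir v (F l) p.
Proof.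
move=> rF; rewrite /ddir exchange_big /=; apply: eq_bigr => i _.
by rewrite dpar_sum ?mulr_sumr// => l z; exact: (Creg_der (rF l)).
Qed.

Lemma Gamma_derive p v :
  (forall i j, ddir (fun l => coord l v) (gram_re i j) p = 0) ->
  (forall i j, ddir (fun l => coord l v) (gram_im i j) p = 0) ->
  forall i j, 'D_v (tlift (fun x => Gamma b x i j)) p = 0.
Proof.
move=> Dg Do i j; apply: (@derive_val _ _ _ _ _ _ 0); apply: is_derive_complex.
  rewrite -[re 0]/(0 : R) -(Dg i j).
  rewrite (_ : (fun q => _) = gram_re i j); first exact/directional_derivative/gram_re_reg.
  by apply/funext => q; rewrite /tlift /= GammaE.
rewrite -[im 0]/(0 : R) -(Do j i).
rewrite (_ : (fun q => _) = gram_im j i); first exact/directional_derivative/gram_im_reg.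
by apply/funext => q; rewrite /tlift /= GammaE.
Qed.

Hypothesis emb : smooth_embedding (Gamma b).

Let Gimm p v : (forall i j, 'D_v (tlift (fun x => Gamma b x i j)) p = 0) -> v = 0.
Proof. by case: emb => _ + _ _ _; apply. Qed.

Let Ginj : injective (Gamma b).
Proof. by case: emb. Qed.

Let r p := \sum_(l < m) gram_re l l p.

Let gll0 l p : 0 <= gram_re l l p.
Proof. by rewrite addr_ge0// -expr2 sqr_ge0. Qed.

Let rreg k : Creg k r.
Proof. by apply: Creg_sum => l _; exact: gram_re_reg. Qed.

(** [Gamma] is quadratic in the generators, so at a common zero its differential would vanish,
    against the immersion property. *)
Lemma embedding_pos p : 0 < r p.
Proof.
rewrite lt_neqAle sumr_ge0 ?andbT//; apply/negP => /eqP r0.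
have b0 j : re (b j (tpi p)) = 0 /\ im (b j (tpi p)) = 0.
  have : gram_re j j p = 0.
    by apply: (psumr_eq0P (P := predT) (fun l _ => gll0 l p)) => //; exact/esym.
  move/eqP; rewrite /gram_re /dotre paddr_eq0 -?expr2 ?sqr_ge0// !sqrf_eq0.
  by move=> /andP[/eqP ? /eqP ?].
suff /eqP : axis R 0 = 0.
  by case/eqP => /eqP; rewrite oner_eq0.
have e F G : Creg 1 F -> Creg 1 G -> F p = 0 -> G p = 0 -> forall i,
    dpar i (fun q => F q * G q) p = 0.
  move=> rF rG F0 G0 i; rewrite dparM; [|by move=> z; exact: (Creg_der rF)|by move=> z; exact: (Creg_der rG)].
  by rewrite F0 G0 !mul0r addr0.
have eD F G F' G' : Creg 1 F -> Creg 1 G -> Creg 1 F' -> Creg 1 G' ->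
    F p = 0 -> G p = 0 -> F' p = 0 -> G' p = 0 -> forall i,
    dpar i (fun q => F q * G q + F' q * G' q) p = 0 /\
    dpar i (fun q => F q * G q - F' q * G' q) p = 0.
  move=> rF rG rF' rG' F0 G0 F'0 G'0 i.
  have r1 z : derivable (fun q => F q * G q) z (axis R i) := Creg_der (CregM rF rG).
  have r2 z : derivable (fun q => F' q * G' q) z (axis R i) := Creg_der (CregM rF' rG').
  by rewrite (dparD r1 r2) (dparB r1 r2) (e _ _ rF rG F0 G0) (e _ _ rF' rG' F'0 G'0) addr0 subr0.
apply: (@Gimm p); apply: Gamma_derive => i j; apply: big1 => l _.
  have [u1 u2] := breg i 1; have [v1 v2] := breg j 1.
  have [/= a1 a2] := b0 i; have [/= c1 c2] := b0 j.
  by rewrite (eD _ _ _ _ u1 v1 u2 v2 a1 c1 a2 c2 l).1 mulr0.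
have [u1 u2] := breg i 1; have [v1 v2] := breg j 1.
have [/= a1 a2] := b0 i; have [/= c1 c2] := b0 j.
by rewrite (eD _ _ _ _ u1 v2 u2 v1 a1 c2 a2 c1 l).2 mulr0.
Qed.

Let I := ('I_m * 'I_m * ('I_m * 'I_m) * bool)%type.

(** A finite family of coefficients, as Nachbin's theorem requires; the boolean selects products of
    two real parts or the odd functions that see the imaginary parts. *)
Let gen (a : I) : P -> R := fun p =>
  if a.2 then gram_re a.1.1.1 a.1.1.2 p * gram_re a.1.2.1 a.1.2.2 p
  else r p * (gram_re a.1.2.1 a.1.2.2 p * gram_im a.1.1.1 a.1.1.2 p).

Let gen_lift a : coefficient_lifts b (gen a).
Proof.
case: a => [[[j k] [l n]] []]; rewrite /gen /=.
  exists (fun x => dotre (b j x) (b k x) * dotre (b l x) (b n x)) => //.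
  by apply/coefficient_multiplier/multiplier_dot2.
have := coefficient_odd j k l n (multiplier_cst b 1).
by move=> H; eexists; first exact: H; apply/funext => p /=; rewrite mul1r.
Qed.

(** Summing over a repeated index gives vanishing derivatives for [r * g] and [r * r]. As [r] is
    positive, the derivatives of [r], then of the real parts, and through [r * r * gram_im] of the
    imaginary parts vanish in turn. *)
Let gen_imm p (v : 'I_3 -> R) :
  (forall a, ddir v (gen a) p = 0) -> forall i, v i = 0.
Proof.
move=> H.
have Hg j k l n : ddir v (fun q => gram_re j k q * gram_re l n q) p = 0.
  exact: (H ((j, k), (l, n), true)).
have Ho j k l n : ddir v (fun q => r q * (gram_re l n q * gram_im j k q)) p = 0.
  exact: (H ((j, k), (l, n), false)).
have g1 j k := gram_re_reg j k 1; have o1 j k := gram_im_reg j k 1.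
have r1 := rreg 1; have rp := embedding_pos p.
have Drg j k : ddir v (fun q => r q * gram_re j k q) p = 0.
  rewrite (_ : (fun q => _) = fun q => \sum_(l < m) (gram_re l l q * gram_re j k q)); last first.
    by apply/funext => q; rewrite mulr_suml.
  by rewrite (ddir_sum v p (fun l => CregM (g1 l l) (g1 j k))) big1.
have Drr : ddir v (fun q => r q * r q) p = 0.
  rewrite (_ : (fun q => _) = fun q => \sum_(l < m) (r q * gram_re l l q)); last first.
    by apply/funext => q; rewrite mulr_sumr.
  by rewrite (ddir_sum v p (fun l => CregM r1 (g1 l l))) big1.
have Dr : ddir v r p = 0.
  move: Drr; rewrite (ddirM v p r1 r1) -mulrDr => /eqP; rewrite mulf_eq0 gt_eqF//=.
  by rewrite -mulr2n mulrn_eq0 /= => /eqP.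
have Dg j k : ddir v (gram_re j k) p = 0.
  move: (Drg j k); rewrite (ddirM v p r1 (g1 j k)) Dr mulr0 addr0 => /eqP.
  by rewrite mulf_eq0 gt_eqF//= => /eqP.
have Do j k : ddir v (gram_im j k) p = 0.
  have : ddir v (fun q => r q * (r q * gram_im j k q)) p = 0.
    rewrite (_ : (fun q => _) = fun q => \sum_(l < m) (r q * (gram_re l l q * gram_im j k q))); last first.
      by apply/funext => q; rewrite -mulr_sumr -mulr_suml.
    by rewrite (ddir_sum v p (fun l => CregM r1 (CregM (g1 l l) (o1 j k)))) big1.
  rewrite (ddirM v p r1 (CregM r1 (o1 j k))) (ddirM v p r1 (o1 j k)).
  rewrite Dr !mulr0 !addr0 => /eqP.
  by rewrite !mulf_eq0 gt_eqF//= => /eqP.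
pose u : P := (v 0, v 1, v 2).
have uE l : coord l u = v l.
  by case: l => [[|[|[|//]]] ?]; rewrite /coord /u /=; congr v; exact: val_inj.
have u0 : u = 0.
  by apply: (@Gimm p); apply: Gamma_derive => i j; rewrite /ddir;
    under eq_bigr do rewrite uE; [exact: Dg|exact: Do].
by move=> i; rewrite -uE u0 /coord; do 2?case: ifP.
Qed.

(** The same elimination on values, [r] being recovered from its square by positivity. *)
Let gen_inj p q : (forall a, gen a p = gen a q) -> tpi p = tpi q.
Proof.
move=> H.
have Hg j k l n : gram_re j k p * gram_re l n p = gram_re j k q * gram_re l n q.
  exact: (H ((j, k), (l, n), true)).
have Ho j k l n : r p * (gram_re l n p * gram_im j k p) = r q * (gram_re l n q * gram_im j k q).
  exact: (H ((j, k), (l, n), false)).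
have p0 := embedding_pos p; have q0 := embedding_pos q.
have rg j k : r p * gram_re j k p = r q * gram_re j k q.
  by rewrite !mulr_suml; apply: eq_bigr => l _.
have rr : r p = r q.
  apply/eqP; rewrite -(eqrXn2 (ltn0Sn 1) (ltW p0) (ltW q0)) !expr2 !{2}/r !mulr_sumr.
  by apply/eqP/eq_bigr => l _.
have gE j k : gram_re j k p = gram_re j k q.
  by have := rg j k; rewrite rr => /(mulfI _); apply; rewrite gt_eqF.
have oE j k : gram_im j k p = gram_im j k q.
  have : r p * (r p * gram_im j k p) = r q * (r q * gram_im j k q).
    have E z : r z * (r z * gram_im j k z) =
        \sum_(l < m) r z * (gram_re l l z * gram_im j k z).
      by rewrite -mulr_sumr -mulr_suml.
    by rewrite !E; apply: eq_bigr => l _.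
  by rewrite rr => /(mulfI _)/(mulfI _); apply; rewrite gt_eqF.
apply: Ginj; apply/matrixP => i j; rewrite !GammaE.
by congr Complex; [exact: gE|exact: oE].
Qed.

Lemma embedding_coefficient_dense k (F : P -> R) : Creg k F -> per F ->
  clo (coefficient_lifts b) k F.
Proof.
apply: (@nachbin _ _ (coefficient_algebra b_smooth) #|{: I}| (fun a => gen (enum_val a))).
- by move=> a; exact: gen_lift.
- move=> p v H; apply: gen_imm => a.
  by rewrite -[a]enum_rankK; exact: (H (enum_rank a)).
- move=> p q H; apply: gen_inj => a.
  by rewrite -[a]enum_rankK; exact: (H (enum_rank a)).
Qed.



Let D p := \sum_(l < m) gram_re l l p ^+ 2.

Let Dpos p : 0 < D p.
Proof.
rewrite lt_neqAle sumr_ge0 ?andbT => [|l _]; last exact: sqr_ge0.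
apply/negP => /eqP D0; have := embedding_pos p; rewrite /r big1 ?ltxx// => l _.
have : gram_re l l p ^+ 2 = 0.
  by apply: (psumr_eq0P (P := predT) (fun l _ => sqr_ge0 (gram_re l l p))) => //; exact/esym.
by move/eqP; rewrite sqrf_eq0 => /eqP.
Qed.

(** [A] and [B] come from the real and imaginary parts of [f * conjc (b n)]. The weight
    [gram_re n n] is absorbed in [A] but left visible beside [J (b n)], where [coefficient_act] asks
    for it; it is also why [D] sums squares. *)
Lemma embedding_decomposition k (f : T3 -> C) : torus_C k f ->
  exists A B : 'I_m -> P -> R,
  [/\ forall n, Creg k (A n) /\ per (A n), forall n, Creg k (B n) /\ per (B n) &
    forall p, f (tpi p) = \sum_(n < m)
      (A n p *: b n (tpi p) + (B n p * gram_re n n p) *: J (b n (tpi p)))].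
Proof.
move=> /class_CP[rf1 rf2].
exists (fun n p => dotre (f (tpi p)) (b n (tpi p)) * gram_re n n p / D p),
  (fun n p => cross (b n (tpi p)) (f (tpi p)) / D p).
have rD : Creg k D by apply: Creg_sum => l _; apply: CregX; exact: gram_re_reg.
have rDV : Creg k (fun p => (D p)^-1).
  by apply: CregV => // p; rewrite gt_eqF ?Dpos.
split=> [n|n|p].
- have [u v] := breg n k; split.
    apply: CregM => //; apply: CregM; last exact: gram_re_reg.
    by apply: CregD; exact: CregM.
  by move=> p q; rewrite /D /gram_re => ->.
- have [u v] := breg n k; split.
    apply: CregM => //; by apply: CregB; exact: CregM.
  by move=> p q; rewrite /D /gram_re => ->.
- transitivity (\sum_(n < m) (gram_re n n p ^+ 2 / D p) *: f (tpi p)).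
    rewrite -scaler_suml -mulr_suml -/(D p) divff ?scale1r//.
    by rewrite gt_eqF ?Dpos.
  apply: eq_bigr => n _; have := Dpos p; rewrite /gram_re; move: (D p) => d d0.
  rewrite J_parts !scale_parts add_parts /dotre /cross.
  case: (f _) (b n _) => [f1 f2] [b1 b2] /=.
  by congr Complex; field; rewrite gt_eqF.
Qed.

Lemma embedding_approx k (f : T3 -> C) (e : R) : torus_C k f -> 0 < e ->
  exists2 w, W w & bnd setT k e (fun p => re (f (tpi p)) - re (w (tpi p))) /\
    bnd setT k e (fun p => im (f (tpi p)) - im (w (tpi p))).
Proof.
move=> rf e0; have [A [B [rA rB fE]]] := embedding_decomposition rf.
have pb n : per (fun p => re (b n (tpi p))) /\ per (fun p => im (b n (tpi p))).
  by split=> p q ->.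
have pg n : per (gram_re n n) by move=> p q; rewrite /gram_re => ->.
have [M M0 HM] : exists2 M, 0 < M & forall n,
  [/\ bnd setT k M (fun p => re (b n (tpi p))), bnd setT k M (fun p => im (b n (tpi p))),
    bnd setT k M (fun p => gram_re n n p * re (b n (tpi p))) &
    bnd setT k M (fun p => gram_re n n p * im (b n (tpi p)))].
  have /choice[M HM] : forall n, exists M, 0 < M /\
    [/\ bnd setT k M (fun p => re (b n (tpi p))), bnd setT k M (fun p => im (b n (tpi p))),
    bnd setT k M (fun p => gram_re n n p * re (b n (tpi p))) &
    bnd setT k M (fun p => gram_re n n p * im (b n (tpi p)))].
    move=> n; have [u v] := breg n k; have [pu pv] := pb n.
    have g1 := gram_re_reg n n k.
    have pgu : per (fun p => gram_re n n p * re (b n (tpi p))).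
      by move=> p q pq; rewrite (pg n _ _ pq) (pu _ _ pq).
    have pgv : per (fun p => gram_re n n p * im (b n (tpi p))).
      by move=> p q pq; rewrite (pg n _ _ pq) (pv _ _ pq).
    have [M1 M10 H1] := Creg_bnd u pu; have [M2 M20 H2] := Creg_bnd v pv.
    have [M3 M30 H3] := Creg_bnd (CregM g1 u) pgu.
    have [M4 M40 H4] := Creg_bnd (CregM g1 v) pgv.
    exists (M1 + M2 + M3 + M4); split; first by rewrite !addr_gt0.
    split; [apply: bnd_le H1|apply: bnd_le H2|apply: bnd_le H3|apply: bnd_le H4]; lra.
  have le1 n : M n <= 1 + \sum_(l < m) M l.
    rewrite (bigD1 n)//= addrCA lerDl addr_ge0// sumr_ge0// => l _.
    by apply: ltW; case: (HM l).
  exists (1 + \sum_(l < m) M l).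
    by rewrite ltr_pwDl// sumr_ge0// => l _; apply: ltW; case: (HM l).
  by move=> n; have [_ [h1 h2 h3 h4]] := HM n;
    split; apply: (bnd_le (le1 n)).
(* The successor of [m] keeps the denominator positive for an empty family; each of the [m] terms
   then contributes at most [e / m.+1]. *)
pose d := e / (m.+1%:R * (2 ^+ k * (2 * M))).
have K0 : 0 < 2 ^+ k :> R by rewrite exprn_gt0.
have d0 : 0 < d by rewrite divr_gt0// !mulr_gt0.
have app (F : 'I_m -> P -> R) : (forall n, Creg k (F n) /\ per (F n)) ->
    exists q : 'I_m -> T3 -> R, forall n, coefficient b (q n) /\
      bnd setT k d (fun p => F n p - q n (tpi p)).
  move=> HF; suff /choice[q Hq] : forall n, exists q, coefficient b q /\
      bnd setT k d (fun p => F n p - q (tpi p)) by exists q.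
  move=> n.
  have [rF pF] := HF n; have [_ _ /(_ _ d0)[_ [q cq ->] Hq]] := embedding_coefficient_dense rF pF.
  by exists q.
have [q Hq] := app _ rA; have [q' Hq'] := app _ rB.
have sW := sat_limit_subspace b.
pose w (x : T3) : C := \sum_(n < m)
  (q n x *: b n x + (q' n x * dotre (b n x) (b n x)) *: J (b n x)).
have reS (u : 'I_m -> C) : re (\sum_(n < m) u n) = \sum_(n < m) re (u n).
  by apply: (big_morph re) => // x y; rewrite add_parts.
have imS (u : 'I_m -> C) : im (\sum_(n < m) u n) = \sum_(n < m) im (u n).
  by apply: (big_morph im) => // x y; rewrite add_parts.
have rq n : Creg k (fun p => A n p - q n (tpi p)).
  by apply: CregB; [case: (rA n)|apply: (coefficient_reg b_smooth k); case: (Hq n)].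
have rq' n : Creg k (fun p => B n p - q' n (tpi p)).
  by apply: CregB; [case: (rB n)|apply: (coefficient_reg b_smooth k); case: (Hq' n)].
have small : \sum_(n < m) (2 ^+ k * (d * M) + 2 ^+ k * (d * M)) <= e.
  rewrite sumr_const card_ord -[_ *+ m]mulr_natl.
  rewrite (_ : 2 ^+ k * (d * M) + 2 ^+ k * (d * M) = e / m.+1%:R).
    by rewrite mulrA ler_pdivrMr// mulrC ler_pM2l// ler_nat.
  by rewrite /d; field; rewrite ?gt_eqF.
exists w; last split.
- have := real_subspace_sum (index_enum 'I_m) sW (fun n => real_subspaceD sW
    (coefficient_act b_smooth n (Hq n).1).1 (coefficient_act b_smooth n (Hq' n).1).2).
  by congr W; apply/funext => x; rewrite fct_sumE.
- apply: (bnd_le small).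
  rewrite (_ : (fun p => _) = fun p => \sum_(n < m)
    ((A n p - q n (tpi p)) * re (b n (tpi p)) -
     (B n p - q' n (tpi p)) * (gram_re n n p * im (b n (tpi p))))); last first.
    apply/funext => p; rewrite fE !reS -sumrB; apply: eq_bigr => n _.
    by rewrite J_parts !scale_parts !add_parts /= -/(gram_re n n p); ring.
  apply: bnd_sum => n; have [u v] := breg n k; have [M1 M2 M3 M4] := HM n;
    have rM : Creg k (fun p => gram_re n n p * im (b n (tpi p)))
      by apply: CregM => //; exact: gram_re_reg.
    by apply: CregB; exact: CregM.
  by apply: bndB; [exact: CregM|exact: CregM|apply: bndM => //; case: (Hq n)|
    apply: bndM => //; case: (Hq' n)].
- apply: (bnd_le small).
  rewrite (_ : (fun p => _) = fun p => \sum_(n < m)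
    ((A n p - q n (tpi p)) * im (b n (tpi p)) +
     (B n p - q' n (tpi p)) * (gram_re n n p * re (b n (tpi p))))); last first.
    apply/funext => p; rewrite fE !imS -sumrB; apply: eq_bigr => n _.
    by rewrite J_parts !scale_parts !add_parts /= -/(gram_re n n p); ring.
  apply: bnd_sum => n; have [u v] := breg n k; have [M1 M2 M3 M4] := HM n;
    have rM : Creg k (fun p => gram_re n n p * re (b n (tpi p)))
      by apply: CregM => //; exact: gram_re_reg.
    by apply: CregD; exact: CregM.
  by apply: bndD; [exact: CregM|exact: CregM|apply: bndM => //; case: (Hq n)|
    apply: bndM => //; case: (Hq' n)].
Qed.

Theorem embedding_dense k : closure_C k W = @torus_C R k.
Proof.
apply/seteqP; split=> [f []//|f rf]; split=> // e e0.
(* The modulus costs a factor 2, and the inequality to reach is strict. *)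
have e4 : 0 < e / 4 by rewrite divr_gt0.
have [w Ww [H1 H2]] := embedding_approx rf e4.
have rw : torus_C k w by exact: (sat_limit_smooth b_smooth Ww).
exists w; split=> // s sk p.
have /class_CP[f1 f2] := rf; have /class_CP[w1 w2] := rw.
have E1 : (fun p => re (tlift (f - w) p)) = fun p => re (f (tpi p)) - re (w (tpi p)).
  by apply/funext => z; rewrite /tlift /= -[(f - w) _]/(f _ - w _) reB.
have E2 : (fun p => im (tlift (f - w) p)) = fun p => im (f (tpi p)) - im (w (tpi p)).
  by apply/funext => z; rewrite /tlift /= -[(f - w) _]/(f _ - w _) imB.
apply: (@le_lt_trans _ _ (e / 4 + e / 4)); last by lra.
apply: (@iter_partial_bnd _ setT k) => //.
- by apply/class_CP; rewrite E1 E2; split; exact: CregB.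
- by rewrite E1.
- by rewrite E2.
Qed.

End EmbeddingDensity.

(** * Necessity of the embedding *)

Section Trigonometric.
Variable R : realType.
Local Notation P := (R * R * R)%type.
Local Notation T3 := (torus3 R).
Local Notation tpi := (@torus_pi R).
Implicit Types (p q v : P) (i j : 'I_3) (k : nat).

Lemma is_derive_coord i p v : is_derive p v (coord i) (coord i v).
Proof.
have H : h^-1 *: ((coord i \o shift p) (h *: v) - coord i p) @[h --> 0^'] --> coord i v.
  apply: (@cvg_trans _ (cst (coord i v) h @[h --> (0 : R)^'])); last exact: cvg_cst.
  apply: near_eq_cvg; near=> h; rewrite /=.
  have -> : coord i (h *: v + p) - coord i p = h * coord i v.
    by rewrite /coord; do 2?case: ifP => _ //=; rewrite addrK.
  by rewrite /GRing.scale /= mulKf//; near: h; exact: nbhs_dnbhs_neq.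
by split; [apply/cvg_ex; exists (coord i v)|apply: cvg_lim].
Unshelve. all: by end_near.
Qed.

Lemma coord_axis i j : coord i (axis R j) = (i == j)%:R.
Proof.
by rewrite /coord /axis; case: i j => [[|[|[|//]]] ?] [[|[|[|//]]] ?].
Qed.

Lemma dpar_coord j i : dpar j (@coord R i) = fun=> (i == j)%:R.
Proof.
apply/funext => p; rewrite /dpar -coord_axis.
exact: (@derive_val _ _ _ _ _ _ _ (is_derive_coord i p _)).
Qed.

Lemma continuous_coord i : continuous (@coord R i : P -> R).
Proof.
rewrite /coord; case: eqP => _; [|case: eqP => _] => p.
- by apply: (@continuous_comp _ _ _ (fun z : P => z.1) (fun z : R * R => z.1));
    exact: cvg_fst.
- apply: (@continuous_comp _ _ _ (fun z : P => z.1) (fun z : R * R => z.2));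
    [exact: cvg_fst|exact: cvg_snd].
- exact: cvg_snd.
Qed.

Lemma Creg_trig k i : Creg k (fun p => cos (coord i p)) /\ Creg k (fun p => sin (coord i p)).
Proof.
have dC p j : derivable (@coord R i) p (axis R j).
  exact: (@ex_derive _ _ _ _ _ _ _ (is_derive_coord i p _)).
have cC := @continuous_coord i.
have c1 : continuous (fun p => cos (coord i p)).
  by apply: (@continuous_comp_derive _ (@cos R) (fun s => - sin s)) => // s.
have c2 : continuous (fun p => sin (coord i p)).
  by apply: (@continuous_comp_derive _ (@sin R) (@cos R)) => // s.
elim: k => [//|k [IH1 IH2]]; split; split=> // j; split.
- by move=> p; apply: (@derivable_comp _ (@cos R) (fun s => - sin s)) => // s.
- rewrite (@dpar_comp _ (@cos R) (fun s => - sin s)) // dpar_coord.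
  by apply: CregM; [exact: CregN|exact: Creg_cst].
- by move=> p; apply: (@derivable_comp _ (@sin R) (@cos R)) => // s.
- rewrite (@dpar_comp _ (@sin R) (@cos R)) // dpar_coord.
  by apply: CregM => //; exact: Creg_cst.
Qed.

Lemma trig_int (n : int) (t : R) : cos (n%:~R * (2 * pi) + t) = cos t /\
  sin (n%:~R * (2 * pi) + t) = sin t.
Proof.
have H (l : nat) (s : R) : cos (l%:R * (2 * pi) + s) = cos s /\ sin (l%:R * (2 * pi) + s) = sin s.
  rewrite addrC mulr_natl mulr_natl.
  by rewrite (periodicn (@cosD2pi R)) (periodicn (@sinD2pi R)).
case: n => l; first exact: H.
have [<- <-] := H l.+1 ((Negz l)%:~R * (2 * pi) + t).
rewrite addrA (_ : l.+1%:R * (2 * pi) + (Negz l)%:~R * (2 * pi) = 0) ?add0r//.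
by rewrite NegzE mulrNz mulNr subrr.
Qed.

Lemma per_trig i : per (fun p => cos (coord i p)) /\ per (fun p => sin (coord i p)).
Proof.
by split; apply: perP => n p; rewrite /coord; do 2?case: ifP => _ /=;
  rewrite ?(trig_int _ _).1 ?(trig_int _ _).2.
Qed.

(** The difference, reduced to one period, has cosine 1. By the half-angle formula the sine of its
    half vanishes, which leaves only the two ends of the period. *)
Lemma trig_circle (s t : R) : cos s = cos t -> sin s = sin t ->
  exists n : int, s - t = n%:~R * (2 * pi).
Proof.
move=> cst' snt; have [n /andP[u0 u2]] := circle_cell (s - t).
have cu : cos (n%:~R * (2 * pi) + (s - t)) = 1.
  by rewrite (trig_int _ _).1 cosB cst' snt -!expr2 cos2Dsin2.
have [u uE] : exists u, u = n%:~R * (2 * pi) + (s - t) by eexists.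
rewrite -uE in u0 u2 cu.
have : cos ((u / 2) *+ 2) = 1 by rewrite -[_ *+ 2]mulr_natr divfK.
rewrite cos_mulr2n cos2sin2 -[_ *+ 2]mulr_natr => {}cu.
have s0 : sin (u / 2) = 0.
  apply/eqP; rewrite -sqrf_eq0; apply/eqP; lra.
have [u00|u0'] := eqVneq u 0.
  by exists (- n); rewrite mulrNz mulNr; move: uE; rewrite u00; lra.
have [u22|u2'] := eqVneq u (2 * pi).
  by exists (1 - n); rewrite intrB mulrBl mul1r; move: uE; rewrite u22; lra.
suff : 0 < sin (u / 2) by rewrite s0 ltxx.
apply: sin_gt0_pi; have : 0 < u by rewrite lt_neqAle eq_sym u0'.
have : u < 2 * pi by rewrite lt_neqAle u2'.
by move=> *; apply/andP; split; lra.
Qed.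

Lemma trig_separates p q : (forall i, cos (coord i p) = cos (coord i q)) ->
  (forall i, sin (coord i p) = sin (coord i q)) -> tpi p = tpi q.
Proof.
move=> Hc Hs; apply/torus_piP.
have [n0 E0] := trig_circle (Hc 0) (Hs 0).
have [n1 E1] := trig_circle (Hc 1) (Hs 1).
have [n2 E2] := trig_circle (Hc 2) (Hs 2).
exists (n0, n1, n2); move: p q {Hc Hs} E0 E1 E2 => [[p0 p1] p2] [[q0 q1] q2].
by rewrite /coord /lattice /= => <- <- <-; congr (_, _, _) => /=; rewrite subrK.
Qed.

End Trigonometric.

(** * Derivations that vanish on the Gram entries *)

Section Equivariance.
Variable R : realType.
Local Notation C := (Rcomplex R).
Local Notation P := (R * R * R)%type.
Local Notation T3 := (torus3 R).
Local Notation tpi := (@torus_pi R).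
Local Notation re := (@complex.Re R).
Local Notation im := (@complex.Im R).
Variables (m : nat) (b : 'I_m -> T3 -> C).
Hypothesis b_smooth : forall j, torus_Cinfty (b j).
Local Notation W := (sat_limit b).
Variable k : nat.
Hypotheses (k1 : (1 <= k)%N) (dense : closure_C k W = @torus_C R k).

Definition dotf (f g : T3 -> C) (p : P) := dotre (f (tpi p)) (g (tpi p)).
Definition crossf (f g : T3 -> C) (p : P) := cross (f (tpi p)) (g (tpi p)).

Let reg1 (f : T3 -> C) := Creg 1 (fun p => re (f (tpi p))) /\ Creg 1 (fun p => im (f (tpi p))).

Let breg j : reg1 (b j).
Proof. by have /torus_CinftyP := b_smooth j; exact. Qed.

Let dotf_reg f g : reg1 f -> reg1 g -> Creg 1 (dotf f g).
Proof. by move=> [? ?] [? ?]; apply: CregD; exact: CregM. Qed.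

Let crossf_reg f g : reg1 f -> reg1 g -> Creg 1 (crossf f g).
Proof. by move=> [? ?] [? ?]; apply: CregB; exact: CregM. Qed.

(** First-order closeness is all that the necessity argument uses; this is where [1 <= k] enters. *)
Lemma dense_approx f e : torus_C k f -> 0 < e -> exists2 w, W w &
  bnd setT 1 e (fun p => re (f (tpi p)) - re (w (tpi p))) /\
  bnd setT 1 e (fun p => im (f (tpi p)) - im (w (tpi p))).
Proof.
move=> rf e0; have := rf; rewrite -dense => -[_ /(_ _ e0)[w [Ww rw Hw]]].
exists w => //.
have rfw : class_C 1 (tlift (f - w)).
  have /class_CP[f1 f2] := rf; have /class_CP[w1 w2] := rw; apply/class_CP.
  have E1 : (fun p => re (tlift (f - w) p)) = fun p => re (f (tpi p)) - re (w (tpi p)).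
    by apply/funext => z; rewrite /tlift /= -[(f - w) _]/(f _ - w _) reB.
  have E2 : (fun p => im (tlift (f - w) p)) = fun p => im (f (tpi p)) - im (w (tpi p)).
    by apply/funext => z; rewrite /tlift /= -[(f - w) _]/(f _ - w _) imB.
  by rewrite E1 E2; split; apply: (Creg_le k1); exact: CregB.
have d1 i p : derivable (tlift (f - w)) p (axis R i) by have [_ /(_ i)[+ _]] := rfw.
have H0 p : `|tlift (f - w) p| <= e by apply: ltW; exact: (Hw [::]).
have H1 i p : `|partial i (tlift (f - w)) p| <= e by apply: ltW; exact: (Hw [:: i]).
have E1 : (fun p => re (f (tpi p)) - re (w (tpi p))) = fun p => re (tlift (f - w) p).
  by apply/funext => z; rewrite /tlift /= -[(f - w) _]/(f _ - w _) reB.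
have E2 : (fun p => im (f (tpi p)) - im (w (tpi p))) = fun p => im (tlift (f - w) p).
  by apply/funext => z; rewrite /tlift /= -[(f - w) _]/(f _ - w _) imB.
rewrite E1 E2; split; split.
- by move=> p _; exact: le_trans (re_norm_le _) (H0 p).
- move=> i; split=> // p _; rewrite -(re_partial (d1 i)).
  exact: le_trans (re_norm_le _) (H1 i p).
- by move=> p _; exact: le_trans (im_norm_le _) (H0 p).
- move=> i; split=> // p _; rewrite -(im_partial (d1 i)).
  exact: le_trans (im_norm_le _) (H1 i p).
Qed.

(** The fields act linearly at each point, so a common zero of the generators is a zero of every
    saturated function, and the constant 1 could not be approximated. *)
Lemma dense_nonvanishing p : exists j, b j (tpi p) != 0.
Proof.
apply/not_existsP => H.
have b0 j : b j (tpi p) = 0 by apply/eqP/negPn/negP; exact: H.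
have W0 w : W w -> w (tpi p) = 0.
  apply: (sat_limit_min (L := [set w : T3 -> C | w (tpi p) = 0])) => //.
    by split=> [//|c u v /= u0 v0]; rewrite -[LHS]/(c *: u _ + v _) u0 v0 scaler0 addr0.
  by move=> phi j l /= E; rewrite /Tfield E D3N0.
have r1 : torus_C k (fun=> 1 : C) by apply/class_CP; split; exact: Creg_cst.
have e0 : 0 < 2^-1 :> R by rewrite invr_gt0.
have [w /W0 w0 [H1 _]] := dense_approx r1 e0.
have := bnd0 H1 (I : setT p); rewrite w0 /= subr0 normr1; lra.
Qed.

(* The increment [F q - F p] and the directional derivative at [p = q] are both
   twisted derivations; vanishing on the Gram entries propagates from the
   generators to the whole saturation space and then, by density, everywhere. *)
Lemma twisted_derivation_eq0 (delta : (P -> R) -> R) (p q : P) (K : R) :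
  (forall F G, Creg 1 F -> Creg 1 G ->
     delta (fun x => F x * G x) = F q * delta G + G p * delta F) ->
  (forall c F G, Creg 1 F -> Creg 1 G ->
     delta (fun x => c * F x + G x) = c * delta F + delta G) ->
  (forall M F, Creg 1 F -> bnd setT 1 M F -> `|delta F| <= K * M) ->
  (forall i j, delta (dotf (b i) (b j)) = 0 /\ delta (crossf (b i) (b j)) = 0) ->
  forall F, Creg k F -> per F -> delta F = 0.
Proof.
move=> dM dZ dB dG.
have dM0 F G : Creg 1 F -> Creg 1 G -> delta F = 0 -> delta G = 0 ->
    delta (fun x => F x * G x) = 0.
  by move=> rF rG F0 G0; rewrite dM// F0 G0 !mulr0 addr0.
have dZ0 c F G : Creg 1 F -> Creg 1 G -> delta F = 0 -> delta G = 0 ->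
    delta (fun x => c * F x + G x) = 0.
  by move=> rF rG F0 G0; rewrite dZ// F0 G0 mulr0 addr0.
have d0 : delta (fun=> 0) = 0.
  have := dZ (-1) _ _ (Creg_cst 1 0) (Creg_cst 1 0).
  rewrite (_ : (fun x : P => _) = fun=> 0); first by lra.
  by apply/funext => x; rewrite mulr0 addr0.
have comb (c c' c'' : R) F G F' G' F'' G'' :
    [/\ Creg 1 F, Creg 1 G, Creg 1 F' & Creg 1 G'] -> Creg 1 F'' -> Creg 1 G'' ->
    [/\ delta F = 0, delta G = 0, delta F' = 0 & delta G' = 0] -> delta F'' = 0 -> delta G'' = 0 ->
    delta (fun x => c * (F x * G x) + (c' * (F' x * G' x) + (c'' * (F'' x * G'' x) + 0))) = 0.
  move=> [r1 r2 r3 r4] r5 r6 [d1 d2 d3 d4] d5 d6.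
  have q1 := CregM r1 r2; have q2 := CregM r3 r4; have q3 := CregM r5 r6.
  have s3 := CregD (CregZ c'' q3) (Creg_cst 1 0).
  apply: (dZ0 c _ _ q1 (CregD (CregZ c' q2) s3)); first exact: dM0.
  apply: (dZ0 c' _ _ q2 s3); first exact: dM0.
  by apply: (dZ0 c'' _ _ q3 (Creg_cst 1 0)); first exact: dM0.
(* The pairings with the generators, rather than [w] itself, are what [Gamma] controls. *)
pose L (w : T3 -> C) := reg1 w /\
  forall n, delta (dotf w (b n)) = 0 /\ delta (crossf w (b n)) = 0.
have WL w : W w -> L w.
  apply: sat_limit_min.
  - split=> [|c u v [[u1 u2] Hu] [[v1 v2] Hv]].
      split; first by split; exact: Creg_cst.
      move=> n; have E1 : dotf 0 (b n) = fun=> 0.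
        by apply/funext => x; rewrite /dotf /dotre /= !mul0r addr0.
      have E2 : crossf 0 (b n) = fun=> 0.
        by apply/funext => x; rewrite /crossf /cross /= !mul0r subr0.
      by rewrite E1 E2.
    have E x : (c *: u + v) (tpi x) = Complex (c * re (u (tpi x)) + re (v (tpi x)))
        (c * im (u (tpi x)) + im (v (tpi x))).
      by rewrite -[LHS]/(c *: u _ + v _) scale_parts add_parts.
    split.
      by split; under eq_fun do rewrite E /=; apply: CregD => //; exact: CregZ.
    move=> n; have [Hu1 Hu2] := Hu n; have [Hv1 Hv2] := Hv n; have rb := breg n.
    rewrite (_ : dotf _ _ = fun x => c * dotf u (b n) x + dotf v (b n) x); last first.
      by apply/funext => x; rewrite /dotf /dotre E /=; ring.
    rewrite (_ : crossf _ _ = fun x => c * crossf u (b n) x + crossf v (b n) x); last first.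
      by apply/funext => x; rewrite /crossf /cross E /=; ring.
    have ru : reg1 u by []. have rv : reg1 v by [].
    by split; apply: dZ0 => //; [exact: dotf_reg|exact: dotf_reg|exact: crossf_reg|exact: crossf_reg].
  - by move=> j; split.
  - move=> phi j l [rphi Hphi].
    have rT : reg1 (fun x => Tfield b j l x (phi x)).
      have [u1 u2] := rphi; have [b1 b2] := breg j; have [c1 c2] := breg l.
      have rg := dotf_reg (breg j) (breg l).
      have rB := CregB (CregM b1 c1) (CregM b2 c2).
      have rD := CregD (CregM b1 c2) (CregM b2 c1).
      split.
        have := CregZ (- 2) (CregB (CregD (CregM (CregZ 2 rg) u2) (CregM rD u1)) (CregM rB u2)).
        by congr Creg; apply/funext => x; rewrite /Tfield J_D3N_parts.
      have := CregZ 2 (CregD (CregD (CregM (CregZ 2 rg) u1) (CregM rB u1)) (CregM rD u2)).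
      by congr Creg; apply/funext => x; rewrite /Tfield J_D3N_parts.
    split=> // n.
    have [X1 X2] := Hphi n; have [Y1 Y2] := Hphi l.
    have [g1 g2] := dG j l; have [h1 h2] := dG j n; have [e1 e2] := dG n j.
    have rX1 := dotf_reg rphi (breg n); have rX2 := crossf_reg rphi (breg n).
    have rY1 := dotf_reg rphi (breg l); have rY2 := crossf_reg rphi (breg l).
    have rg1 := dotf_reg (breg j) (breg l); have rh1 := dotf_reg (breg j) (breg n).
    have ro2 := crossf_reg (breg n) (breg j).
    (* Pairing a field applied to [phi] with a generator gives products of a Gram entry and a
       pairing of [phi]; [delta] vanishes on both factors. *)
    rewrite (_ : dotf _ (b n) = fun x => 4 * (dotf (b j) (b l) x * crossf phi (b n) x)
      + (- 2 * (dotf (b j) (b n) x * crossf phi (b l) x)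
      + (- 2 * (crossf (b n) (b j) x * dotf phi (b l) x) + 0))); last first.
      apply/funext => x; rewrite /dotf /crossf /Tfield J_D3N_parts /dotre /cross /=; ring.
    rewrite (_ : crossf (fun y => Tfield b j l y (phi y)) (b n) = fun x => - 4 * (dotf (b j) (b l) x * dotf phi (b n) x)
      + (- 2 * (dotf (b j) (b n) x * dotf phi (b l) x)
      + (2 * (crossf (b n) (b j) x * crossf phi (b l) x) + 0))); last first.
      apply/funext => x; rewrite /dotf /crossf /Tfield J_D3N_parts /dotre /cross /=; ring.
    by split; apply: comb.
have dB0 F G : Creg 1 F -> Creg 1 G -> delta G = 0 -> delta F = delta (fun x => F x - G x).
  move=> rF rG G0; have := dZ (-1) _ _ rG rF; rewrite G0 mulr0 add0r => <-.
  by congr delta; apply/funext => x; ring.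
have all0 f n : torus_C k f -> delta (dotf f (b n)) = 0 /\ delta (crossf f (b n)) = 0.
  move=> rf.
  have rf1 : reg1 f by have /class_CP[? ?] := rf; split; apply: (Creg_le k1).
  have [u1 u2] := breg n.
  have [M1 M10 H1] := Creg_bnd u1 (fun x y xy => congr1 re (congr1 (b n) xy)).
  have [M2 M20 H2] := Creg_bnd u2 (fun x y xy => congr1 im (congr1 (b n) xy)).
  pose N := 2 * (M1 + M2).
  have small e : 0 < e -> `|delta (dotf f (b n))| <= `|K| * N * e /\
      `|delta (crossf f (b n))| <= `|K| * N * e.
    move=> e0; have [w Ww [B1 B2]] := dense_approx rf e0.
    have [rw Hw] := WL _ Ww; have [w1 w2] := Hw n.
    have [f1 f2] := rf1; have [v1 v2] := rw.
    have KN F : Creg 1 F -> bnd setT 1 (N * e) F -> `|delta F| <= `|K| * N * e.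
      move=> rF /(dB _ _ rF) /le_trans; apply.
      rewrite -mulrA ler_wpM2r ?ler_norm// !mulr_ge0 ?addr_ge0 ?ltW//.
    rewrite (dB0 _ _ (dotf_reg rf1 (breg n)) (dotf_reg rw (breg n)) w1).
    rewrite (dB0 _ _ (crossf_reg rf1 (breg n)) (crossf_reg rw (breg n)) w2).
    split; apply: KN.
    - by apply: CregB; exact: dotf_reg.
    - have := bndD (CregM (CregB f1 v1) u1) (CregM (CregB f2 v2) u2)
        (bndM (CregB f1 v1) u1 B1 H1) (bndM (CregB f2 v2) u2 B2 H2).
      rewrite (_ : 2 ^+ 1 * (e * M1) + 2 ^+ 1 * (e * M2) = N * e); last by rewrite /N; ring.
      by congr bnd; apply/funext => x; rewrite /dotf /dotre; ring.
    - by apply: CregB; exact: crossf_reg.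
    - have := bndB (CregM (CregB f1 v1) u2) (CregM (CregB f2 v2) u1)
        (bndM (CregB f1 v1) u2 B1 H2) (bndM (CregB f2 v2) u1 B2 H1).
      rewrite (_ : 2 ^+ 1 * (e * M2) + 2 ^+ 1 * (e * M1) = N * e); last by rewrite /N; ring.
      by congr bnd; apply/funext => x; rewrite /crossf /cross; ring.
  have lim (a : R) : (forall e, 0 < e -> `|a| <= `|K| * N * e) -> a = 0.
    move=> Ha; apply/eqP; rewrite -normr_le0; apply/ler_addgt0Pl => e e0; rewrite addr0.
    have D0 : 0 < `|K| * N + 1 by rewrite ltr_wpDl// mulr_ge0// mulr_ge0// addr_ge0 ?ltW.
    apply: (le_trans (Ha _ (divr_gt0 e0 D0))).
    by rewrite mulrA ler_pdivrMr// mulrC ler_pM2l// lerDl.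
  by split; apply: lim => e /small[].
move=> F rF pF; have r1F : Creg 1 F by exact: Creg_le rF.
(* Pairing the constant 1 with the generators shows that [delta] vanishes on their real and
   imaginary parts. *)
have db n : delta (fun p => re (b n (tpi p))) = 0 /\ delta (fun p => im (b n (tpi p))) = 0.
  have r1 : torus_C k (fun=> 1 : C) by apply/class_CP; split; exact: Creg_cst.
  have [e1 e2] := all0 _ n r1.
  rewrite -{1}e1 -e2; split; congr delta; apply/funext => x;
    by rewrite /dotf /crossf /dotre /cross /= mul1r mul0r ?addr0 ?subr0.
have rF' : torus_C k (fun x => Complex (descend F x) 0 : C).
  apply/class_CP; split=> /=; last exact: Creg_cst.
  by have := rF; rewrite -{1}(descend_tpi pF).
(* By the twisted Leibniz rule, [delta] of [F] times a component of [b j] is [delta F] times the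
   value of that component at [p], and some component is nonzero there. *)
have [j] := dense_nonvanishing p; have [u1 u2] := breg j; have [d1 d2] := db j.
apply: contraNeq => dF; have [e1 e2] := all0 _ j rF'.
have E1 : delta (fun x => F x * re (b j (tpi x))) = 0.
  rewrite -e1; congr delta; apply/funext => x; rewrite /dotf /dotre /= mul0r addr0.
  by rewrite -[descend F (tpi x)]/((descend F \o tpi) x) descend_tpi.
have E2 : delta (fun x => F x * im (b j (tpi x))) = 0.
  rewrite -e2; congr delta; apply/funext => x; rewrite /crossf /cross /= mul0r subr0.
  by rewrite -[descend F (tpi x)]/((descend F \o tpi) x) descend_tpi.
move: E1 E2; rewrite !dM// d1 d2 !mulr0 !add0r => /eqP + /eqP.
rewrite !mulf_eq0 (negPf dF) !orbF.
by case: (b j _) => x y /= /eqP -> /eqP ->.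
Qed.

End Equivariance.

(** * Topology of the torus *)

Section TorusTopology.
Variable R : realType.
Local Notation P := (R * R * R)%type.
Local Notation T3 := (torus3 R).
Local Notation tpi := (@torus_pi R).

Lemma continuous_torus_pi : continuous (tpi : P -> T3).
Proof.
have cpi := @pi_continuous R (circle R).
have c1 : continuous (fun p : P => (\pi_(circle R) p.1.1)%qT).
  move=> p; apply: (@continuous_comp _ _ _ (fun z : P => z.1.1)); last exact: cpi.
  by apply: (@continuous_comp _ _ _ (fun z : P => z.1) (fun z : R * R => z.1));
    exact: cvg_fst.
have c2 : continuous (fun p : P => (\pi_(circle R) p.1.2)%qT).
  move=> p; apply: (@continuous_comp _ _ _ (fun z : P => z.1.2)); last exact: cpi.
  by apply: (@continuous_comp _ _ _ (fun z : P => z.1) (fun z : R * R => z.2));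
    [exact: cvg_fst|exact: cvg_snd].
have c3 : continuous (fun p : P => (\pi_(circle R) p.2)%qT).
  by move=> p; apply: (@continuous_comp _ _ _ snd); [exact: cvg_snd|exact: cpi].
by move=> p; exact: (cvg_pair (cvg_pair (c1 p) (c2 p)) (c3 p)).
Qed.

(** The preimage of the image of an open set is the union of its translates by multiples of the
    period. *)
Lemma circle_pi_open (A : set R) (x : R) : nbhs x A ->
  nbhs (\pi_(circle R) x)%qT ((fun y => \pi_(circle R) y)%qT @` A).
Proof.
rewrite nbhsE => -[B [oB Bx] BA]; apply: (@filterS _ _ _ ((fun y => \pi_(circle R) y)%qT @` B)).
  exact: image_subset.
apply: open_nbhs_nbhs; split; last by exists x.
rewrite /open /= /quotient_open.
have -> : (\pi_(circle R) @^-1` ((fun y => \pi_(circle R) y) @` B))%qT =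
    \bigcup_(n : int) [set y | B (n%:~R * (2 * pi) + y)].
  apply/seteqP; split=> y /=.
    move=> [z Bz /circleP[n E]]; exists n => //=; by rewrite -E subrK.
  move=> [n _ /= Bn]; exists (n%:~R * (2 * pi) + y) => //.
  by apply/circleP; exists n; rewrite addrK.
apply: bigcup_open => n _; apply: (@open_comp _ _ (fun y => n%:~R * (2 * pi) + y)) => // y _.
by apply: cvgD; [exact: cvg_cst|exact: cvg_id].
Qed.

Lemma torus_pi_open (A : set P) (p : P) : nbhs p A -> nbhs (tpi p) (tpi @` A).
Proof.
case: p => [[p1 p2] p3] [[A12 A3] /= [[[A1 A2] /= [nA1 nA2] sub12] nA3] sub].
exists (((fun y => \pi_(circle R) y)%qT @` A1 `*` (fun y => \pi_(circle R) y)%qT @` A2),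
  (fun y => \pi_(circle R) y)%qT @` A3); last first.
  move=> [[_ _] _] [/= [[/= x1 ? <-] [x2 ? <-]] [x3 ? <-]].
  by exists (x1, x2, x3) => //; apply: sub; split=> //; apply: sub12.
split; last exact: circle_pi_open.
by eexists (_, _); [split; apply: circle_pi_open; eassumption|].
Qed.

(** The torus carries a product of quotient topologies rather than the quotient topology of the
    space; openness of [torus_pi] still allows continuity to be tested on lifts. *)
Lemma continuous_descend (Z : topologicalType) (f : T3 -> Z) :
  continuous (f \o tpi : P -> Z) -> continuous f.
Proof.
move=> cf x; have [p <-] : exists p, tpi p = x by eexists; exact: torus_pi_repr.
move=> A nA; have := torus_pi_open (cf p A nA).
apply: filterS => _ [y /= Ay <-].
exact: Ay.
Qed.

Lemma compact_torus : compact [set: T3].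
Proof.
rewrite (_ : setT = tpi @` (@cell R : set P)).
  apply: continuous_compact; last exact: compact_cell.
  exact/continuous_subspaceT/continuous_torus_pi.
apply/seteqP; split=> // x _; rewrite -(torus_pi_repr x).
by have [q cq qp] := cell_rep (repr x.1.1, repr x.1.2, repr x.2); exists q.
Qed.

End TorusTopology.

(** * Topology of matrices *)

Section MatrixTopology.
Variable R : realType.
Local Notation C := (Rcomplex R).

Lemma continuous_matrix (T : topologicalType) (n : nat) (G : T -> 'M[C]_n) :
  (forall i j, continuous (fun x => G x i j)) -> continuous G.
Proof.
move=> cG x; apply/cvg_ballP => e e0.
have : \forall y \near x, forall i j, ball (G x i j) e (G y i j).
  apply: (@filter_forall _ _ (fun i y => forall j, ball (G x i j) e (G y i j)) (nbhs x) _) => i.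
  apply: (@filter_forall _ _ (fun j y => ball (G x i j) e (G y i j)) (nbhs x) _) => j.
  by have /cvg_ballP := cG i j x; exact.
by apply: filterS => y H; split.
Qed.

Lemma hausdorff_matrix (n : nat) : hausdorff_space 'M[C]_n.
Proof.
rewrite ball_hausdorff => A B /eqP AB.
have [i [j Aij]] : exists i j, A i j != B i j.
  apply: contrapT => H; apply: AB; apply/matrixP => i j; apply/eqP/negPn/negP => Hij.
  by apply: H; exists i, j.
have := @norm_hausdorff R C; rewrite ball_hausdorff => /(_ _ _ Aij)[r H].
exists r; apply/eqP/seteqP; split=> // M [[_ /(_ i j) HA] [_ /(_ i j) HB]].
by move/eqP/seteqP: H => [H _]; exact: (H (M i j)).
Qed.

End MatrixTopology.

(** * The embedding from density *)

Section EmbeddingOfDense.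
Variable R : realType.
Local Notation C := (Rcomplex R).
Local Notation P := (R * R * R)%type.
Local Notation T3 := (torus3 R).
Local Notation tpi := (@torus_pi R).
Local Notation re := (@complex.Re R).
Local Notation im := (@complex.Im R).
Variables (m : nat) (b : 'I_m -> T3 -> C).
Hypothesis b_smooth : forall j, torus_Cinfty (b j).
Local Notation W := (sat_limit b).
Variable k : nat.
Hypotheses (k1 : (1 <= k)%N) (dense : closure_C k W = @torus_C R k).

Lemma Gamma_smooth i j : torus_Cinfty (fun x => Gamma b x i j).
Proof.
apply/torus_CinftyP => l; split.
  have := gram_re_reg b_smooth i j l; congr Creg; apply/funext => p.
  by rewrite GammaE.
have := gram_im_reg b_smooth j i l; congr Creg; apply/funext => p.
by rewrite GammaE.
Qed.

(** If [Gamma] agrees at two points, the increment between them annihilates every regular periodic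
    function, in particular the cosines and sines of the coordinates, which separate points. *)
Lemma dense_injective : injective (Gamma b).
Proof.
move=> x y Gxy; rewrite -(torus_pi_repr x) -(torus_pi_repr y).
set p := (repr x.1.1, _, _); set q := (repr y.1.1, _, _).
have xp : tpi p = x := torus_pi_repr x. have yq : tpi q = y := torus_pi_repr y.
suff eqF (F : P -> R) : Creg k F -> per F -> F q - F p = 0.
  by apply: trig_separates => i; apply/eqP; rewrite eq_sym -subr_eq0; apply/eqP;
    apply: (eqF (fun z => _ (coord i z))); have [? ?] := Creg_trig R k i;
    have [? ?] := per_trig R i.
move: F; apply: (@twisted_derivation_eq0 _ _ _ b_smooth _ k1 dense
    (fun F => F q - F p) p q 2).
- by move=> F G _ _; ring.
- by move=> c F G _ _; ring.
- move=> M F _ HF; have := bnd0 HF (I : setT p); have := bnd0 HF (I : setT q).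
  rewrite !ler_norml => /andP[a1 a2] /andP[c1 c2]; apply/andP; split; lra.
- move=> i j; have := congr1 (fun A : 'M[C]_m => A i j) Gxy.
  have := congr1 (fun A : 'M[C]_m => A j i) Gxy.
  rewrite !GammaE => -[_ E2] [E1 _].
  by rewrite /dotf /crossf xp yq E1 E2 !subrr.
Qed.

(** The twisted derivation is now the derivative at [p] in the direction [v]. Its vanishing on the
    cosine and sine of a coordinate forces that component of [v] to be 0, their squares adding up to
    1. *)
Lemma dense_immersive p v :
  (forall i j, 'D_v (tlift (fun x => Gamma b x i j)) p = 0) -> v = 0.
Proof.
move=> H; pose vc l := coord l v.
have HD F : Creg 1 F -> is_derive p v F (ddir vc F p) := @directional_derivative _ F p v.
have D0 (F : P -> R) : Creg k F -> per F -> ddir vc F p = 0.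
  move: F; apply: (@twisted_derivation_eq0 _ _ _ b_smooth _ k1 dense
    (fun F => ddir vc F p) p p (\sum_(l < 3) `|vc l|)).
  - by move=> F G rF rG; rewrite ddirM.
  - move=> c F G rF rG; rewrite /ddir mulr_sumr -big_split; apply: eq_bigr => l _ /=.
    have dF z : derivable F z (axis R l) by exact: (Creg_der rF).
    have dG z : derivable G z (axis R l) by exact: (Creg_der rG).
    rewrite dparD//; last by move=> z; exact: (Creg_der (CregZ c rF)).
    by rewrite dparZ//; ring.
  - move=> M F rF HF; rewrite mulr_suml (le_trans (ler_norm_sum _ _ _))//.
    apply: ler_sum => l _; rewrite normrM ler_wpM2l//.
    exact: (bnd0 (bnd_dpar l HF)).
  - move=> i j.
    have E i' j' : ddir vc (gram_re b i' j') p = 0 /\ ddir vc (gram_im b j' i') p = 0.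
      have D : is_derive p v (tlift (fun x => Gamma b x i' j') : P -> C)
          (Complex (ddir vc (gram_re b i' j') p) (ddir vc (gram_im b j' i') p) : C).
        apply: is_derive_complex.
          have := HD _ (gram_re_reg b_smooth i' j' 1).
          by congr is_derive; apply/funext => z; rewrite /tlift /= GammaE.
        have := HD _ (gram_im_reg b_smooth j' i' 1).
        by congr is_derive; apply/funext => z; rewrite /tlift /= GammaE.
      by have := H i' j'; rewrite (@derive_val _ _ _ _ _ _ _ D) => -[].
    by split; [exact: (E i j).1|exact: (E j i).2].
have v0 i : coord i v = 0.
  have [r1 r2] := Creg_trig R k i; have [p1 p2] := per_trig R i.
  have := D0 _ r1 p1; have := D0 _ r2 p2.
  rewrite -(@derive_val _ _ _ _ _ _ _ (HD _ (Creg_le k1 r1))).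
  rewrite -(@derive_val _ _ _ _ _ _ _ (HD _ (Creg_le k1 r2))).
  have dv := is_derive_coord i p v.
  have dc : derivable (@coord R i) p v by exact: (@ex_derive _ _ _ _ _ _ _ dv).
  rewrite (@derive_val _ _ _ _ _ _ _ (is_derive_chain (is_derive_sin _) dc)).
  rewrite (@derive_val _ _ _ _ _ _ _ (is_derive_chain (is_derive_cos _) dc)).
  rewrite (@derive_val _ _ _ _ _ _ _ dv) => E1 E2.
  have : (cos (coord i p) ^+ 2 + sin (coord i p) ^+ 2) * coord i v = 0.
    rewrite mulrDl !expr2 -!mulrA E1 -[sin _ * coord i v]opprK -mulNr E2.
    by rewrite oppr0 !mulr0 addr0.
  by rewrite cos2Dsin2 mul1r.
by have := v0 0; have := v0 1; have := v0 2; case: v {H vc HD D0 v0} => [[? ?] ?];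
  rewrite /coord /= => -> -> ->.
Qed.

Lemma embedding_of_dense : smooth_embedding (Gamma b).
Proof.
have cG : continuous (Gamma b).
  apply: continuous_matrix => i j; apply: continuous_descend.
  by have := Gamma_smooth i j 0; case.
split.
- exact: Gamma_smooth.
- exact: dense_immersive.
- exact: dense_injective.
- exact: cG.
(* A compact source and a Hausdorff target: the image of the closed complement of [U] is closed, and
   by injectivity its complement cuts out the image of [U]. *)
- move=> U oU; exists (~` (Gamma b @` (~` U))).
    apply: closed_openC; apply: compact_closed; first exact: hausdorff_matrix.
    apply: continuous_compact; first exact: continuous_subspaceT.
    apply: (subclosed_compact _ (@compact_torus R)) => //; exact: open_closedC.
  apply/seteqP; split=> [_ [x Ux <-]|_ [/[swap] [[x _ <-]] H]].
    split; last by exists x.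
    by move=> [y Uy /dense_injective yx]; apply: Uy; rewrite yx.
  by exists x => //; apply: contrapT => Ux; apply: H; exists x.
Qed.

End EmbeddingOfDense.

(** * Density in the Sobolev space *)

Section SquareIntegrable.
Variable R : realType.
Local Notation P := (R * R * R)%type.
Local Notation mR := (measurableTypeR R).
Local Notation mP := (mR * mR * mR)%type.
Local Notation mu3 := (lebesgue3 R).
Local Notation cellR := (@cell R).
Implicit Types (F G H : P -> R).

Lemma cintegrable_dom F G : measurable_fun cellR F -> cintegrable G ->
  (forall p, (cellR : set P) p -> `|F p| <= G p) -> cintegrable F.
Proof.
move=> mF iG FG; apply: le_integrable iG; first exact: measurable_cell.
  exact/measurable_EFinP.
move=> p cp /=; rewrite lee_fin (le_trans (FG _ cp))//; exact: ler_norm.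
Qed.

Definition sqint F := measurable_fun cellR F /\ cintegrable (fun p => F p ^+ 2).

Definition nsq F := cellint (fun p => F p ^+ 2).

Lemma nsq_ge0 F : 0 <= nsq F.
Proof. by apply: cellint_ge0 => p _; exact: sqr_ge0. Qed.

Lemma sqint_dom F G : measurable_fun cellR F -> sqint G ->
  (forall p, (cellR : set P) p -> `|F p| <= `|G p|) -> sqint F.
Proof.
move=> mF [mG iG] FG; split=> //; apply: (cintegrable_dom _ iG).
  by apply: measurable_funX.
by move=> p /FG FGp; rewrite normrX -[G p ^+ 2]real_normK ?num_real// lerXn2r// nnegrE.
Qed.

Lemma sqint_cont F : continuous F -> sqint F.
Proof.
move=> cF; split; first by apply: measurable_funTS; exact: continuous3_measurable.
by apply: cintegrable_cont; exact: contX.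
Qed.

Lemma sqintM F G : sqint F -> sqint G -> cintegrable (fun p => F p * G p).
Proof.
move=> [mF iF] [mG iG]; apply: (cintegrable_dom _ (cintegrableD iF iG)).
  exact: measurable_funM.
move=> p _; rewrite normrM -[F p ^+ 2]real_normK ?num_real// -[G p ^+ 2]real_normK ?num_real//.
have := sqr_ge0 (`|F p| - `|G p|); have := mulr_ge0 (normr_ge0 (F p)) (normr_ge0 (G p)).
by nra.
Qed.

Lemma sqintD F G : sqint F -> sqint G -> sqint (fun p => F p + G p).
Proof.
move=> sF sG; split; first exact: (measurable_funD sF.1 sG.1).
have := cintegrableD (cintegrableD sF.2 sG.2) (cintegrableZ 2 (sqintM sF sG)).
by congr cintegrable; apply/funext => p; ring.
Qed.

Lemma sqintZ c F : sqint F -> sqint (fun p => c * F p).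
Proof.
move=> sF; split; first by apply: measurable_funM => //; exact: sF.1.
have := cintegrableZ (c ^+ 2) sF.2.
by congr cintegrable; apply/funext => p; ring.
Qed.

Lemma sqintB F G : sqint F -> sqint G -> sqint (fun p => F p - G p).
Proof.
move=> sF sG; have := sqintD sF (sqintZ (-1) sG).
by congr sqint; apply/funext => p; rewrite mulN1r.
Qed.

Lemma nsqD2 F G H : sqint F -> sqint G -> sqint H ->
  (forall p, (cellR : set P) p -> `|H p| <= `|F p| + `|G p|) ->
  nsq H <= 2 * nsq F + 2 * nsq G.
Proof.
move=> sF sG sH HFG; rewrite /nsq -(cellintZ 2 sF.2) -(cellintZ 2 sG.2).
rewrite -cellintD; [|exact: (cintegrableZ 2 sF.2)|exact: (cintegrableZ 2 sG.2)].
apply: cellint_le; [exact: sH.2| |].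
  exact: (cintegrableD (cintegrableZ 2 sF.2) (cintegrableZ 2 sG.2)).
move=> p /HFG {}HFG; rewrite -[F p ^+ 2]real_normK ?num_real//.
rewrite -[G p ^+ 2]real_normK ?num_real// -[H p ^+ 2]real_normK ?num_real//.
have := normr_ge0 (H p); have := normr_ge0 (F p); have := normr_ge0 (G p).
have := sqr_ge0 (`|F p| - `|G p|).
by move: `|F p| `|G p| `|H p| HFG => x y z *; nra.
Qed.

Lemma nsqD F G : sqint F -> sqint G ->
  nsq (fun p => F p + G p) <= 2 * nsq F + 2 * nsq G.
Proof.
move=> sF sG; apply: nsqD2 => //; first exact: sqintD.
by move=> p _; exact: ler_normD.
Qed.

Lemma nsqZ c F : sqint F -> nsq (fun p => c * F p) = c ^+ 2 * nsq F.
Proof.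
move=> sF; rewrite /nsq -cellintZ; last exact: sF.2.
by congr cellint; apply/funext => p; rewrite exprMn.
Qed.

(** Dominated convergence for the squared difference, whose majorant is [4 * H ^+ 2]. *)
Lemma nsq_dominated (F_ : nat -> P -> R) F H :
  (forall n, measurable_fun cellR (F_ n)) -> measurable_fun cellR F -> sqint H ->
  (forall n p, (cellR : set P) p -> `|F_ n p| <= H p) ->
  (forall p, (cellR : set P) p -> `|F p| <= H p) ->
  {ae mu3, forall p, (cellR : set P) p -> F_ ^~ p @ \oo --> F p} ->
  forall e, 0 < e -> exists n, nsq (fun p => F p - F_ n p) <= e.
Proof.
move=> mF_ mF sH HF_ HF cvF e e0.
have mD n : measurable_fun cellR (fun p => F p - F_ n p) by exact: measurable_funB.
have [] := @dominated_convergence _ mP R mu3 cellR (@measurable_cell R)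
  (fun n p => ((F p - F_ n p) ^+ 2)%:E) (fun=> 0%E) (fun p => (4 * H p ^+ 2)%:E).
- by move=> n; apply/measurable_EFinP; exact: measurable_funX.
- exact: measurable_cst.
- case: cvF => N [mN N0 sub]; exists N; split=> //; apply: subset_trans sub.
  apply: subsetC => p Hp cp.
  apply: cvg_EFin; first exact: nearW.
  have c0 : (fun n => F p - F_ n p) @ \oo --> (0 : R).
    by rewrite -(subrr (F p)); apply: cvgB; [exact: cvg_cst|exact: Hp].
  have := cvgM c0 c0; rewrite mulr0; exact.
- exact: (cintegrableZ 4 sH.2).
- apply: aeW => p n cp; rewrite lee_fin ger0_norm ?sqr_ge0//.
  have := HF_ n _ cp; have := HF _ cp; rewrite !ler_norml.
  by move=> /andP[? ?] /andP[? ?]; nra.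
move=> _ _; rewrite integral0 => cv.
have sD n : sqint (fun p => F p - F_ n p).
  have mm : measurable_fun cellR H := sH.1.
  apply: sqintB; apply: (sqint_dom _ sH) => // p cp;
    by rewrite (le_trans _ (ler_norm _))// ?HF// ?HF_.
have cv' : (fun n => nsq (fun p => F p - F_ n p)) @ \oo --> (0 : R).
  by move/fine_cvgP : cv => [_].
have /cvgrPdist_le/(_ _ e0)[n _ Hn] := cv'.
exists n; have := Hn n (leqnn n); rewrite sub0r normrN ger0_norm//; exact: nsq_ge0.
Qed.

End SquareIntegrable.

(** * Density of continuous periodic functions in L^2 *)

Section SquareDensity.
Variable R : realType.
Local Notation P := (R * R * R)%type.
Local Notation mR := (measurableTypeR R).
Local Notation mP := (mR * mR * mR)%type.
Local Notation mu3 := (lebesgue3 R).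
Local Notation cellR := (@cell R).
Implicit Types (F G H : P -> R) (i : 'I_3).

Definition continuously_approximable F := sqint F /\ forall e : R, 0 < e ->
  exists f, [/\ continuous f, per f & nsq (fun p => F p - f p) <= e].
Local Notation dens := continuously_approximable.

Lemma dens_cont F : continuous F -> per F -> dens F.
Proof.
move=> cF pF; split=> [|e e0]; first exact: sqint_cont.
exists F; split=> //; rewrite /nsq (_ : (fun p => _) = fun=> 0); last first.
  by apply/funext => p; rewrite subrr expr0n.
by rewrite cellint_cst mul0r ltW.
Qed.

(** Treats sums and maxima at once: a Lipschitz operation carries approximants to approximants. *)
Lemma dens_lipschitz2 (op : R -> R -> R) F G :
  (forall f g : P -> R, continuous f -> continuous g -> continuous (fun p => op (f p) (g p))) ->
  (forall x y z t, `|op x y - op z t| <= `|x - z| + `|y - t|) ->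
  sqint (fun p => op (F p) (G p)) -> dens F -> dens G -> dens (fun p => op (F p) (G p)).
Proof.
move=> cop lop sop [sF dF] [sG dG]; split=> // e e0.
have e4 : 0 < e / 4 by rewrite divr_gt0.
have [f [cf pf Hf]] := dF _ e4; have [g [cg pg Hg]] := dG _ e4.
exists (fun p => op (f p) (g p)); split; first exact: cop.
  by move=> p q pq; rewrite (pf _ _ pq) (pg _ _ pq).
have s1 := sqintB sF (sqint_cont cf); have s2 := sqintB sG (sqint_cont cg).
apply: (le_trans (nsqD2 s1 s2 (sqintB sop (sqint_cont (cop _ _ cf cg))) _)); last by lra.
by move=> p _.
Qed.

Lemma densD F G : dens F -> dens G -> dens (fun p => F p + G p).
Proof.
move=> dF dG; apply: (dens_lipschitz2 (op := +%R)) => //.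
- by move=> f g cf cg; exact: contD.
- by move=> x y z t; rewrite opprD addrACA; exact: ler_normD.
- by apply: sqintD; [case: dF|case: dG].
Qed.

Lemma densZ (c : R) F : dens F -> dens (fun p => c * F p).
Proof.
move=> [sF dF]; split=> [|e e0]; first exact: sqintZ.
have c0 : 0 < c ^+ 2 + 1 by rewrite ltr_wpDl ?sqr_ge0.
have [f [cf pf Hf]] := dF _ (divr_gt0 e0 c0).
exists (fun p => c * f p); split; first by apply: contM => //; exact: cst_continuous.
  by move=> p q pq; rewrite (pf _ _ pq).
rewrite (_ : (fun p => _) = fun p => c * (F p - f p)); last first.
  by apply/funext => p; rewrite mulrBr.
rewrite nsqZ; last by apply: sqintB => //; exact: sqint_cont.
move: Hf; rewrite ler_pdivlMr// mulrC mulrDl mul1r; apply: le_trans.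
by rewrite -[leLHS]addr0 lerD2l nsq_ge0.
Qed.

Lemma dens_sum n (F : 'I_n -> P -> R) : (forall l, dens (F l)) ->
  dens (fun p => \sum_(l < n) F l p).
Proof.
elim: n F => [|n IH] F dF.
  rewrite (_ : (fun p => _) = fun=> 0); last by apply/funext => p; rewrite big_ord0.
  by apply: dens_cont => //; exact: cst_continuous.
rewrite (_ : (fun p => _) = fun p => F ord0 p + \sum_(l < n) F (lift ord0 l) p); last first.
  by apply/funext => p; rewrite big_ord_recl.
by apply: densD => //; exact: IH.
Qed.

Lemma dens_limit (F_ : nat -> P -> R) F H : (forall n, dens (F_ n)) ->
  measurable_fun cellR F -> sqint H ->
  (forall n p, (cellR : set P) p -> `|F_ n p| <= H p) ->
  (forall p, (cellR : set P) p -> `|F p| <= H p) ->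
  {ae mu3, forall p, (cellR : set P) p -> F_ ^~ p @ \oo --> F p} -> dens F.
Proof.
move=> dF_ mF sH HF_ HF cvF.
have sF : sqint F by apply: (sqint_dom mF sH) => p cp; rewrite (le_trans (HF _ cp))// ler_norm.
split=> // e e0; have e4 : 0 < e / 4 by rewrite divr_gt0.
have [n Hn] := nsq_dominated (fun n => (dF_ n).1.1) mF sH HF_ HF cvF e4.
have [sFn /(_ _ e4)[f [cf pf Hf]]] := dF_ n.
exists f; split=> //.
have := nsqD (sqintB sF sFn) (sqintB sFn (sqint_cont cf)).
rewrite (_ : (fun p => F p - F_ n p + _) = fun p => F p - f p); last first.
  by apply/funext => p; rewrite addrA subrK.
by move=> /le_trans; apply; lra.
Qed.

Let dset (A : set mP) := measurable A /\ dens \1_A.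

Let sq1 : sqint (fun=> 1 : R). Proof. by apply: sqint_cont; exact: cst_continuous. Qed.

Let indic_le1 (A : set mP) p : `|\1_A p : R| <= 1.
Proof. by rewrite indicE; case: (_ \in _); rewrite ?normr1 ?normr0. Qed.

Let msq (A : set mP) : measurable A -> sqint \1_A.
Proof.
move=> mA; apply: (sqint_dom _ sq1); first exact: measurable_indic.
by move=> p _; rewrite normr1; exact: indic_le1.
Qed.

Lemma indicU (A B : set mP) :
  \1_(A `|` B) = (fun p => Num.max (\1_A p) (\1_B p)) :> (P -> R).
Proof.
apply/funext => p; rewrite !indicE in_setU.
by case: (p \in A); case: (p \in B); rewrite ?maxxx ?(max_l ler01) ?(max_r ler01).
Qed.

Lemma maxr_lipschitz (x y z t : R) :
  `|Num.max x y - Num.max z t| <= `|x - z| + `|y - t|.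
Proof.
have := ler_norm (x - z); have := ler_norm (y - t).
have := ler_norm (- (x - z)); have := ler_norm (- (y - t)); rewrite !normrN.
move: `|x - z| `|y - t| => a c *; rewrite ler_norml.
by case: (leP x y) => ?; case: (leP z t) => ?; apply/andP; split; lra.
Qed.

Lemma cont_max F G : continuous F -> continuous G ->
  continuous (fun p => Num.max (F p) (G p)).
Proof.
move=> cF cG; rewrite (_ : (fun p => _) = fun p => F p + Num.max 0 (G p - F p)).
  by apply: contD => //; apply: cont_max0; exact: contB.
by apply/funext => p; case: (leP (F p) (G p)) => h; case: leP => h'; lra.
Qed.

(** Complements correspond to one minus the indicator, finite unions to maxima, and countable unions
    to bounded pointwise limits. *)
Lemma dset_sigma_algebra : sigma_algebra setT dset.
Proof.
have d0 : dset set0.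
  by split=> //; rewrite indic0; apply: dens_cont => //; exact: cst_continuous.
split=> //.
- move=> A [mA dA]; split; first by rewrite setTD; exact: measurableC.
  have := densD (dens_cont (@cst_continuous P R 1) (fun _ _ _ => erefl)) (densZ (-1) dA).
  congr dens; apply/funext => p; rewrite setTD !indicE in_setC.
  by case: (_ \in _); rewrite ?mulr1 ?subrr// mulr0 addr0.
- move=> A dA; have mA n : measurable (A n) by case: (dA n).
  have mU : measurable (\bigcup_n A n) by exact: bigcup_measurable.
  split=> //.
  have dU n : dset (\big[setU/set0]_(l < n) A l).
    elim: n => [|n [mUn dUn]]; first by rewrite big_ord0.
    rewrite big_ord_recr /=; split; first exact: measurableU.
    have mUA := msq (measurableU _ _ mUn (mA n)); rewrite indicU in mUA *.
    apply: (dens_lipschitz2 (op := Num.max)) => //; last by case: (dA n).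
      exact: cont_max.
    exact: maxr_lipschitz.
  apply: (dens_limit (fun n => (dU n).2) _ sq1); first exact: measurable_indic.
  - by move=> n p _; exact: indic_le1.
  - by move=> p _; exact: indic_le1.
  apply: aeW => p _; apply: cvg_near_cst.
  have [[n _ An]|nU] := pselect ((\bigcup_n A n) p).
    exists n.+1 => // l /= nl; rewrite !indicE !mem_set//; first by exists n.
    by rewrite -bigcup_mkord; exists n.
  apply: nearW => n; rewrite !indicE !memNset// => H; apply: nU.
  by move: H; rewrite -bigcup_mkord => -[l _ Al]; exists l.
Qed.

(** Periodicity identifies opposite faces of the cell, so pointwise convergence to an indicator can
    fail there. *)
Lemma face_null i (c : R) : exists N : set mP, [/\ measurable N, mu3 N = 0%E &
  forall p : P, (cellR : set P) p -> coord i p = c -> N p].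
Proof.
pose D j : set mR := if j == i then [set c] else `[0, 2 * pi]%classic.
have mD j : measurable (D j).
  by rewrite /D; case: ifP => _; [exact: measurable_set1|exact: measurable_itv].
exists ((D 0 `*` D 1) `*` D 2); split.
- by apply: measurableX => //; exact: measurableX.
- rewrite lebesgue3X//.
  have Di : lebesgue_measure (D i) = 0%E by rewrite /D eqxx lebesgue_measure_set1.
  have : i = 0 \/ i = 1 \/ i = 2.
    by case: i {D mD Di} => [[|[|[|//]]] ?]; [left|right; left|right; right]; exact: val_inj.
  by case=> [|[]] E; rewrite -E in Di *; rewrite Di ?mul0e ?mule0 ?mul0e.
- move=> [[p0 p1] p2] [[/= c0 c1] c2] pc; rewrite /D.
  split; [split|]; case: ifP => //= /eqP ji; move: pc; rewrite -ji /coord /= //.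
Qed.

(** These half-spaces generate the Borel sets. Their indicators are not periodic; the approximants
    are truncated multiples of a periodic function whose sign is right off the faces of the cell. *)
Lemma dens_ray i (a : R) : dens \1_([set p | coord i p < a] : set mP).
Proof.
(* [a] is clamped to the period, so that half-spaces that miss or contain the cell need no separate
   case, and then halved for the product formula of sines. *)
pose s : R := Num.max 0 (Num.min a (2 * pi)) / 2.
have pi0 := pi_gt0 R.
have s0 : 0 <= s by rewrite divr_ge0// le_max lexx.
have s1 : s <= pi.
  by rewrite /s ler_pdivrMr// mulrC ge_max mulr_ge0 ?pi_ge0//= ge_min lexx orbT.
have st (t : R) : 0 < t -> t < 2 * pi -> (t / 2 < s) = (t < a).
  move=> t0 t2; rewrite /s ltr_pM2r ?invr_gt0// lt_max lt_min t2 andbT.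
  by rewrite ltNge (ltW t0).
(* [w = 2 sin (t / 2) sin (s - t / 2)] is positive on the period exactly for
   [t < a]. *)
pose w (p : P) := cos (coord i p - s) - cos s.
have cC := Creg_cont (Creg_trig R 0 i).1; have cS := Creg_cont (Creg_trig R 0 i).2.
have [pC pS] := per_trig R i.
have wE : w = fun p => cos (coord i p) * cos s + sin (coord i p) * sin s - cos s.
  by apply/funext => p; rewrite /w cosB.
have cw : continuous w.
  rewrite wE; apply: contB; last exact: cst_continuous.
  by apply: contD; apply: contM => //; exact: cst_continuous.
have pw : per w by rewrite wE => p q pq; rewrite (pC _ _ pq) (pS _ _ pq).
have w2 p : w p = 2 * (sin (coord i p / 2) * sin (s - coord i p / 2)).
  have -> : w p = cos (coord i p / 2 - (s - coord i p / 2)) -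
      cos (coord i p / 2 + (s - coord i p / 2)).
    by congr (cos _ - cos _); field.
  by move: (coord i p / 2) (s - _) => x y; rewrite cosB cosD; ring.
pose f n (p : P) := 1 - Num.max 0 (1 - n%:R * Num.max 0 (w p)).
have mA : measurable ([set p | coord i p < a] : set mP).
  apply: open3_measurable; apply: (@open_comp _ R (@coord R i) [set t | t < a]) => //.
  by move=> p _; exact: continuous_coord.
apply: (@dens_limit f _ (fun=> 1)).
- move=> n; apply: dens_cont; last by move=> p q pq; rewrite /f (pw _ _ pq).
  rewrite /f; apply: contB; first exact: cst_continuous.
  apply: cont_max0; apply: contB; first exact: cst_continuous.
  by apply: contM; [exact: cst_continuous|exact: cont_max0].
- exact: measurable_indic.
- exact: sq1.
- move=> n p _; rewrite /f; have : 0 <= n%:R * Num.max 0 (w p).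
    by rewrite mulr_ge0// le_max lexx.
  move: (n%:R * _) => x x0; rewrite ler_norml.
  by case: (leP 0 (1 - x)) => ?; apply/andP; split; lra.
- by move=> p _; exact: indic_le1.
have [N0 [mN0 N00 H0]] := face_null i 0; have [N2 [mN2 N20 H2]] := face_null i (2 * pi).
exists (N0 `|` N2); split; first exact: measurableU.
  by rewrite null_set_setU.
move=> p /= nH; apply: contrapT => nN; apply: nH => cp.
have p0 : coord i p != 0 by apply/eqP => E; apply: nN; left; exact: H0.
have p2 : coord i p != 2 * pi by apply/eqP => E; apply: nN; right; exact: H2.
have /andP[q0 q2] : 0 < coord i p < 2 * pi.
  have : 0 <= coord i p <= 2 * pi.
    move: cp; case: p {nN p0 p2} => [[? ?] ?]; rewrite /cell /coord /= !in_itv /=.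
    by move=> [[? ?] ?]; do 2?case: ifP.
  by rewrite !le_eqVlt eq_sym (negPf p0) (negPf p2).
have sp : 0 < sin (coord i p / 2) by apply: sin_gt0_pi; apply/andP; split; lra.
have [pa|pa] := ltP (coord i p) a; rewrite indicE.
  rewrite mem_set//=.
  have w0 : 0 < w p.
    have := st _ q0 q2; rewrite pa => ts.
    by rewrite w2 !mulr_gt0//; apply: sin_gt0_pi; apply/andP; split; lra.
  apply: cvg_near_cst; near=> n.
  have nw : 1 <= n%:R * w p.
    rewrite -ler_pdivrMr// div1r ltW//; near: n; exact: nbhs_infty_gtr.
  rewrite /f (max_r (ltW w0)) max_l ?subr0//; lra.
rewrite memNset//=; last by apply/negP; rewrite -leNgt.
apply: cvg_near_cst; apply: nearW => n.
have w0 : w p <= 0.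
  have := st _ q0 q2; rewrite [in RHS]ltNge pa => /negbT; rewrite -leNgt => ts.
  rewrite w2 pmulr_rle0// pmulr_rle0// -[_ - _]opprB sinN oppr_le0; apply: sin_ge0_pi.
  by apply/andP; split; lra.
by rewrite /f (max_l w0) mulr0 subr0 (max_r ler01) subrr.
Unshelve. all: by end_near.
Qed.

(** The coordinates are measurable for the sigma-algebra of approximable sets, since it contains the
    half-spaces. Hence the identity into the product is measurable, which says that every measurable
    set is approximable. *)
Lemma dens_indic (A : set mP) : measurable A -> dens \1_A.
Proof.
move=> mA; suff [] : dset A by [].
pose S := g_sigma_algebraType dset.
have mS (B : set S) : measurable B -> dset B.
  by rewrite /measurable /= sigma_algebra_id//; exact: dset_sigma_algebra.
have mc i : measurable_fun setT (@coord R i : S -> mR).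
  apply: (measurability _ (RGenInftyO.measurableE R)) => _ [_ [a ->] <-].
  apply: sub_sigma_algebra; rewrite setTI.
  split; last first.
    exact: (dens_ray i a).
  apply: open3_measurable; apply: (@open_comp _ _ (@coord R i) `]-oo, a[%classic) => //.
  by move=> p _; exact: continuous_coord.
have mid : measurable_fun setT ((fun p => (coord 0 p, coord 1 p, coord 2 p)) : S -> mP).
  by apply: measurable_fun_pair => //; apply: measurable_fun_pair.
apply: mS; have := mid measurableT A mA; rewrite setTI; congr measurable.
by apply/seteqP; split=> -[[]].
Qed.

(** [S] is the integer part of [t], capped at [M]. *)
Lemma level_count (t : R) M : 0 <= t ->
  let S : R := \sum_(j < M) (j.+1%:R <= t)%R%:R in
  (t < M%:R -> t - 1 < S <= t) /\ (M%:R <= t -> S = M%:R).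
Proof.
move=> t0; elim: M => [|M [IH1 IH2]] /=; first by rewrite big_ord0; split=> [|//]; lra.
rewrite big_ord_recr /=; have [tM|tM] := leP M.+1%:R t; split=> // _.
- by rewrite IH2; [rewrite -natr1|apply: le_trans tM; rewrite ler_nat].
- rewrite addr0; have [Mt|tM'] := leP M%:R t; last exact: IH1.
  rewrite IH2//; move: tM Mt; rewrite -natr1; move: (M%:R : R) => x ? ?.
  by apply/andP; split; lra.
Qed.

(** Layer cake: on the cell [F_ n] is [n * F] rounded down, capped at [n ^ 2] and divided by [n]. It
    stays below [F], and within [1 / n] of it once [n] exceeds the value of [F]. *)
Lemma dens_ge0 F : sqint F -> (forall p, (cellR : set P) p -> 0 <= F p) -> dens F.
Proof.
move=> sF F0.
pose A n j : set mP := cellR `&` F @^-1` [set` `[j.+1%:R / n%:R, +oo[].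
have mA n j : measurable (A n j) by apply: sF.1; [exact: measurable_cell|exact: measurable_itv].
pose F_ n p := \sum_(j < n ^ 2) n%:R^-1 * \1_(A n j) p : R.
have FE n p : (cellR : set P) p -> (0 < n)%N ->
    F_ n p = n%:R^-1 * \sum_(j < n ^ 2) (j.+1%:R <= n%:R * F p)%R%:R.
  move=> cp n0; rewrite mulr_sumr; apply: eq_bigr => j _; congr (_ * _).
  have n0' : 0 < n%:R :> R by rewrite ltr0n.
  rewrite indicE -(ler_pdivrMl _ _ n0') mulrC; congr (nat_of_bool _)%:R.
  apply/idP/idP => [|h]; first by rewrite inE => -[_]; rewrite /= in_itv /= andbT.
  by rewrite inE; split=> //; rewrite /= in_itv /= andbT.
have n1 n : (0 < n)%N -> (n%:R : R) != 0 by move=> ?; rewrite pnatr_eq0 -lt0n.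
have Fb n p : (cellR : set P) p -> 0 <= F_ n p <= F p.
  move=> cp; case: (posnP n) => [->|n0]; first by rewrite /F_ big_ord0 lexx F0.
  rewrite FE// mulr_ge0 ?invr_ge0//=; last by apply: sumr_ge0.
  have n0' : 0 < n%:R :> R by rewrite ltr0n.
  rewrite ler_pdivrMl//.
  have [H1 H2] := level_count (n ^ 2) (mulr_ge0 (ler0n R n) (F0 _ cp)).
  by have [/[dup]/H2 -> //|/H1/andP[]//] := leP (n ^ 2)%:R (n%:R * F p).
apply: (@dens_limit F_ _ F) => //.
- move=> n; apply: dens_sum => j; apply: densZ; exact: dens_indic.
- exact: sF.1.
- by move=> n p cp; have /andP[h0 h1] := Fb n p cp; rewrite ger0_norm.
- by move=> p cp; rewrite ger0_norm// F0.
apply: aeW => p cp; apply/cvgrPdist_le => e e0; near=> n.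
have nF : F p < n%:R by near: n; exact: nbhs_infty_gtr.
have ne : e^-1 < n%:R by near: n; exact: nbhs_infty_gtr.
have n0' : 0 < n%:R :> R by apply: lt_trans ne; rewrite invr_gt0.
have n0 : (0 < n)%N by rewrite -(ltr0n R).
have /andP[_ h1] := Fb n p cp; rewrite ger0_norm ?subr_ge0//.
have [H1 _] := level_count (n ^ 2) (mulr_ge0 (ler0n R n) (F0 _ cp)).
have /H1/andP[H _] : n%:R * F p < (n ^ 2)%:R :> R by rewrite natrX expr2 ltr_pM2l.
have ne' : n%:R^-1 <= e by rewrite -[e]invrK lef_pV2 ?posrE ?invr_gt0// ltW.
apply: le_trans ne'; rewrite FE// lerBlDr -(ler_pM2l n0') mulrDr !mulVKf ?n1// mulfV ?n1//.
by lra.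
Unshelve. all: by end_near.
Qed.

Theorem square_integrable_dens F : sqint F -> dens F.
Proof.
move=> sF; have mN : measurable_fun cellR (fun p => - F p).
  have := measurable_funB (measurable_cst (0 : R)) sF.1.
  by congr measurable_fun; apply/funext => p; rewrite /= sub0r.
have m1 : measurable_fun cellR (fun p => Num.max 0 (F p)).
  by apply: measurable_maxr; [exact: measurable_cst|exact: sF.1].
have m2 : measurable_fun cellR (fun p => Num.max 0 (- F p)).
  by apply: measurable_maxr => //; exact: measurable_cst.
have d1 : dens (fun p => Num.max 0 (F p)).
  apply: dens_ge0 => [|p _]; last by rewrite le_max lexx.
  by apply: (sqint_dom m1 sF) => p _; case: (leP 0 (F p)) => ?; rewrite ?normr0.
have d2 : dens (fun p => Num.max 0 (- F p)).
  apply: dens_ge0 => [|p _]; last by rewrite le_max lexx.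
  by apply: (sqint_dom m2 sF) => p _; case: (leP 0 (- F p)) => ?; rewrite ?normr0 ?normrN.
have := densD d1 (densZ (-1) d2); congr dens; apply/funext => p.
by case: (leP 0 (F p)) => ?; case: (leP 0 (- F p)) => ?; lra.
Qed.

End SquareDensity.

(** * Exchange of integrals for tensor kernels *)

Section TensorExchange.
Variable R : realType.
Local Notation P := (R * R * R)%type.
Variable Q : set (P -> R).
Hypothesis aQ : periodic_algebra Q.

Lemma tensor_exchange (g : P -> R) (K : P -> P -> R) : pairs_with_continuous g -> tensor Q K ->
  cintegrable (fun y => g y * cellint (fun x => K x y)) /\
  cellint (fun x => cellint (fun y => g y * K x y)) =
  cellint (fun y => g y * cellint (fun x => K x y)).
Proof.
have [_ _ _ Qr] := aQ; move=> pg.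
have cQ q : Q q -> continuous q by move=> /Qr[_ r]; exact: (Creg_cont (r 0)).
elim=> [|q r {}K Qq cr pr tK [IH1 IH2]].
  have E : (fun y => g y * cellint (fun x : P => 0)) = fun=> 0.
    by apply/funext => y; rewrite cellint_cst mul0r mulr0.
  rewrite E; split; first by apply: cintegrable_cont; exact: cst_continuous.
  congr cellint; apply/funext => x; rewrite (_ : (fun y => _) = fun=> 0) ?cellint_cst ?mul0r//.
  by apply/funext => y; rewrite mulr0.
have iq : cintegrable q by apply: cintegrable_cont; exact: cQ.
have iK y : cintegrable (K^~ y) by apply: cintegrable_cont; apply: cQ; exact: tensor_regl tK.
have E : (fun y => g y * cellint (fun x => q x * r y + K x y)) =
    fun y => cellint q * (g y * r y) + g y * cellint (fun x => K x y).
  apply/funext => y; rewrite cellintD//; last first.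
    by rewrite (_ : (fun x => _) = fun x => r y * q x); [exact: cintegrableZ|
      apply/funext => x; rewrite mulrC].
  rewrite (_ : (fun x => q x * r y) = fun x => r y * q x); last first.
    by apply/funext => x; rewrite mulrC.
  by rewrite cellintZ//; ring.
have igr : cintegrable (fun y => g y * r y) by exact: pg.
rewrite E; split; first by apply: cintegrableD => //; exact: cintegrableZ.
rewrite cellintD//; last exact: cintegrableZ.
rewrite cellintZ// -IH2.
have E2 x : cellint (fun y => g y * (q x * r y + K x y)) =
    cellint (fun y => g y * r y) * q x + cellint (fun y => g y * K x y).
  rewrite (_ : (fun y => _) = fun y => q x * (g y * r y) + g y * K x y); last first.
    by apply/funext => y; ring.
  rewrite cellintD; [|exact: cintegrableZ|exact: (tensor_integrable pg _ tK)].
  by rewrite cellintZ// mulrC.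
rewrite (_ : (fun x => _) = fun x => cellint (fun y => g y * r y) * q x +
    cellint (fun y => g y * K x y)); last by apply/funext.
rewrite cellintD; [|exact: cintegrableZ|].
  by rewrite cellintZ// mulrC.
by apply: cintegrable_cont; apply: cQ; exact: tensor_int.
Qed.

End TensorExchange.

(** * Trigonometric convolution kernels and weak derivatives *)

Section TrigonometricKernel.
Variable R : realType.
Local Notation P := (R * R * R)%type.
Local Notation tpi := (@torus_pi R).
Implicit Types (f g F G : P -> R) (x y p q : P) (i j : 'I_3) (n : nat).

Definition smooth_periodic : set (P -> R) := [set F | per F /\ forall k, Creg k F].
Local Notation Q := smooth_periodic.

Lemma smooth_periodic_algebra : periodic_algebra Q.
Proof.
split=> [c|F G [pF rF] [pG rG]|F G [pF rF] [pG rG]|//].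
- by split=> // k; exact: Creg_cst.
- split=> [p q pq|k]; first by rewrite (pF _ _ pq) (pG _ _ pq).
  exact: CregD.
- split=> [p q pq|k]; first by rewrite (pF _ _ pq) (pG _ _ pq).
  exact: CregM.
Qed.

Definition trig (a : 'I_(3 + 3)) : P -> R :=
  match fintype.split a with
  | inl i => fun p => cos (coord i p)
  | inr i => fun p => sin (coord i p)
  end.

Lemma trig_smooth a : Q (trig a).
Proof.
rewrite /trig; case: (fintype.split a) => i.
  by split=> [|k]; [exact: (per_trig R i).1|exact: (Creg_trig R k i).1].
by split=> [|k]; [exact: (per_trig R i).2|exact: (Creg_trig R k i).2].
Qed.

(** Each summand is [2 - 2 * cos (x_i - y_i)], expanded for differentiation in one variable. *)
Lemma sqdist_trigE x y : sqdist trig x y = \sum_(i < 3)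
  (2 + ((- 2 * cos (coord i y)) * cos (coord i x) + (- 2 * sin (coord i y)) * sin (coord i x))).
Proof.
rewrite /sqdist big_split_ord /= -big_split /=; apply: eq_bigr => i _.
rewrite /trig (unsplitK (inl i)) (unsplitK (inr i)).
have := cos2Dsin2 (coord i x); have := cos2Dsin2 (coord i y).
move: (cos _) (sin _) (cos _) (sin _) => a b c d e1 e2.
lra.
Qed.

Let M0 : (0 : R) < 25 := ltr0n _ 25.

Lemma sqdist_trig_lt x y : sqdist trig x y < 25.
Proof.
rewrite sqdist_trigE; apply: (@le_lt_trans _ _ (\sum_(i < 3) (6 : R))).
  apply: ler_sum => i _.
  have := cos2Dsin2 (coord i x); have := cos2Dsin2 (coord i y).
  move: (cos _) (sin _) (cos _) (sin _) => a b c d e1 e2.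
  by have := sqr_ge0 (a + c); have := sqr_ge0 (b + d); nra.
by rewrite sumr_const card_ord -[_ *+ 3]mulr_natr; lra.
Qed.

Lemma sqdist_trig_sep x y : sqdist trig x y = 0 -> tpi x = tpi y.
Proof.
move=> s0.
have E a : trig a x = trig a y.
  apply/eqP; rewrite -subr_eq0 -sqrf_eq0; apply/eqP.
  exact: (psumr_eq0P (P := predT) (fun a _ => sqr_ge0 (trig a x - trig a y)) s0).
apply: trig_separates => i.
  by have := E (lshift 3 i); rewrite /trig (unsplitK (inl i)).
by have := E (rshift 3 i); rewrite /trig (unsplitK (inr i)).
Qed.

(** Any constant above 12, the largest squared distance, would do in place of 25. *)
Definition tkern n x y := kern trig 25 n x y.

Lemma tkern_tensor n : tensor Q (tkern n).
Proof. by apply: kern_tensor; [exact: smooth_periodic_algebra|exact: trig_smooth]. Qed.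

Lemma tkernC n x y : tkern n x y = tkern n y x.
Proof.
rewrite /tkern /kern /sqdist; congr ((1 - _ / _) ^+ _); apply: eq_bigr => a _.
by rewrite -sqrrN opprB.
Qed.

Lemma tkern_gt0 n x y : 0 < tkern n x y.
Proof. exact: (kern_gt0 M0 sqdist_trig_lt). Qed.

Lemma tkern_smooth n x : Q (tkern n x).
Proof.
have := tensor_regl smooth_periodic_algebra x (tkern_tensor n); congr Q.
by apply/funext => y; exact: tkernC.
Qed.

Lemma dpar_trig i j : dpar i (fun p => cos (coord j p)) = (fun p => - sin (coord j p) * (j == i)%:R) /\
  dpar i (fun p => sin (coord j p)) = (fun p => cos (coord j p) * (j == i)%:R).
Proof.
have dC p : derivable (@coord R j) p (axis R i).
  exact: (@ex_derive _ _ _ _ _ _ _ (is_derive_coord j p _)).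
split.
  by rewrite (@dpar_comp _ (@cos R) (fun s => - sin s)) // dpar_coord.
by rewrite (@dpar_comp _ (@sin R) (@cos R)) // dpar_coord.
Qed.

Lemma dpar_sqdist_trig i x y : dpar i (fun z => sqdist trig z y) x =
  \sum_(j < 3) 2 * (cos (coord j y) * sin (coord j x) - sin (coord j y) * cos (coord j x))
    * (j == i)%:R.
Proof.
rewrite (_ : (fun z => _) = fun z => \sum_(j < 3) (2 + ((- 2 * cos (coord j y)) * cos (coord j z)
    + (- 2 * sin (coord j y)) * sin (coord j z)))); last by apply/funext => z; exact: sqdist_trigE.
have rC j : Creg 1 (fun z : P => cos (coord j z)) by have [] := Creg_trig R 1 j.
have rS j : Creg 1 (fun z : P => sin (coord j z)) by have [] := Creg_trig R 1 j.
rewrite dpar_sum => [|j p]; last first.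
  by apply: (@Creg_der _ 0); apply: CregD; [exact: Creg_cst|apply: CregD; exact: CregZ].
apply: eq_bigr => j _; have [dc ds] := dpar_trig i j.
have dC p : derivable (fun z : P => cos (coord j z)) p (axis R i) := Creg_der (rC j).
have dS p : derivable (fun z : P => sin (coord j z)) p (axis R i) := Creg_der (rS j).
have dCZ c p : derivable (fun z : P => c * cos (coord j z)) p (axis R i).
  exact: Creg_der (CregZ c (rC j)).
have dSZ c p : derivable (fun z : P => c * sin (coord j z)) p (axis R i).
  exact: Creg_der (CregZ c (rS j)).
have dCS c c' p : derivable (fun z : P => c * cos (coord j z) + c' * sin (coord j z)) p (axis R i).
  exact: Creg_der (CregD (CregZ c (rC j)) (CregZ c' (rS j))).
have d2 p : derivable (fun=> 2 : R) p (axis R i) := Creg_der (Creg_cst 1 2).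
rewrite (dparD d2 (dCS _ _)) (dparD (dCZ _) (dSZ _)) dpar_cst.
rewrite (dparZ dC) (dparZ dS).
by rewrite dc ds; ring.
Qed.

(* The kernel depends on [x - y] only. *)
Lemma dpar_tkern n i x y : dpar i ((tkern n)^~ y) x = - dpar i (tkern n x) y.
Proof.
pose u : {poly R} := (1 - 25^-1 *: 'X) ^+ n.
have uE z w : tkern n z w = u.[sqdist trig z w].
  by rewrite /tkern /kern /u !hornerE mulrC.
have sC z w : sqdist trig z w = sqdist trig w z.
  by apply: eq_bigr => a _; rewrite -sqrrN opprB.
have ds w p : derivable (fun z => sqdist trig z w) p (axis R i).
  apply: (@Creg_der _ 0); apply: Creg_sum => a _; apply: CregX; apply: CregB; last exact: Creg_cst.
  by have [_] := trig_smooth a; exact.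
have D w z : dpar i (fun z => tkern n z w) z =
    u^`().[sqdist trig z w] * dpar i (fun z => sqdist trig z w) z.
  rewrite (_ : (fun z => tkern n z w) = fun z => u.[sqdist trig z w]); last first.
    by apply/funext => t; exact: uE.
  by rewrite (@dpar_comp _ (horner u) (horner u^`()))//; exact: is_derive_horner.
rewrite (_ : tkern n x = fun z => tkern n z x); last by apply/funext => z; exact: tkernC.
rewrite !D [sqdist trig y x]sC -mulrN; congr (_ * _).
rewrite !dpar_sqdist_trig -sumrN; apply: eq_bigr => j _; ring.
Qed.

Lemma dpar0_cst F : Creg 1 F -> (forall i p, dpar i F p = 0) -> forall p q, F p = F q.
Proof.
move=> rF F0 p q; pose r := 1 + (\sum_(i < 3) `|coord i p| + \sum_(i < 3) `|coord i q|).
have co0 i : coord i 0 = 0 :> R by rewrite /coord; do 2?case: ifP.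
have le1 z i : `|@coord R i z| <= \sum_(l < 3) `|coord l z|.
  by rewrite (bigD1 i)//= lerDl sumr_ge0.
have S0 z : 0 <= \sum_(l < 3) `|@coord R l z| by apply: sumr_ge0.
have bp : ball 0 r p.
  apply/ball_coord => i; rewrite co0 sub0r normrN /r.
  by have := le1 p i; have := S0 q; lra.
have bq : ball 0 r q.
  apply/ball_coord => i; rewrite co0 sub0r normrN /r.
  by have := le1 q i; have := S0 p; lra.
have dF i z : derivable F z (axis R i) by exact: (Creg_der rF).
have [xi [_ E]] := path_mvt dF bp bq; apply/eqP; rewrite -subr_eq0 E big1// => i _.
by rewrite F0 mulr0.
Qed.

Let pairs1 : pairs_with_continuous (fun=> 1 : R).
Proof. by apply: continuous_pairs; exact: cst_continuous. Qed.

Definition kern_mass n := cellint (tkern n 0).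

(** The derivative of the mass in [x] is minus the integral over a period of a derivative in [y]. *)
Lemma kern_massE n x : cellint (tkern n x) = kern_mass n.
Proof.
have E : (fun z => cellint (fun y => 1 * tkern n z y)) = fun z => cellint (tkern n z).
  by apply/funext => z; congr cellint; apply/funext => y; rewrite mul1r.
apply: (dpar0_cst (F := fun z => cellint (tkern n z))).
  rewrite -E; have [_] := tensor_int smooth_periodic_algebra pairs1 (tkern_tensor n); exact.
move=> i p; rewrite -E.
have [_ ->] := tensor_int_dpar smooth_periodic_algebra pairs1 i p (tkern_tensor n).
have [pK rK] := tkern_smooth n p.
rewrite (_ : (fun y => _) = fun y => (-1) * dpar i (tkern n p) y); last first.
  by apply/funext => y; rewrite dpar_tkern mul1r mulN1r.
rewrite cellintZ ?cellint_dpar ?mulr0//.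
by apply: cintegrable_cont; exact: (Creg_cont (Creg_dpar i (rK 1))).
Qed.

Lemma kern_mass_gt0 n : 0 < kern_mass n.
Proof.
have [pK rK] := tkern_smooth n 0.
apply: (@cellint_gt0 _ _ 0) => //; [exact: (Creg_cont (rK 0))| |exact: tkern_gt0].
by move=> p; exact: (ltW (tkern_gt0 _ _ _)).
Qed.

Definition smoothing n f x := (kern_mass n)^-1 * cellint (fun y => f y * tkern n x y).

Lemma sqint_pairs f : sqint f -> pairs_with_continuous f.
Proof. by move=> sf r cr pr; apply: sqintM => //; exact: sqint_cont. Qed.

Lemma sqint_sqr_pairs f : sqint f -> pairs_with_continuous (fun y => f y ^+ 2).
Proof.
move=> sf r cr pr; have [M _ HM] := per_bounded cr pr.
apply: (@cintegrable_dom _ _ (fun y => M * f y ^+ 2)).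
- apply: measurable_funM; first by apply: measurable_funX; exact: sf.1.
  by apply: measurable_funTS; exact: continuous3_measurable.
- exact: cintegrableZ sf.2.
- by move=> p _; rewrite normrM (ger0_norm (sqr_ge0 (f p))) mulrC ler_wpM2r ?sqr_ge0.
Qed.

Lemma smoothing_smooth n f : sqint f -> Q (smoothing n f).
Proof.
move=> /sqint_pairs pf; have aQ := smooth_periodic_algebra.
have := tensor_int aQ pf (tkern_tensor n) => -[p r].
split=> [x y xy|k]; first by rewrite /smoothing (p _ _ xy).
by apply: CregZ; exact: r.
Qed.

Let integ n f x : sqint f -> cintegrable (fun y => f y * tkern n x y).
Proof. by move=> /sqint_pairs pf; exact: (tensor_integrable pf x (tkern_tensor n)). Qed.

Lemma smoothingB n f g x : sqint f -> sqint g ->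
  smoothing n (fun y => f y - g y) x = smoothing n f x - smoothing n g x.
Proof.
move=> sf sg; rewrite /smoothing -mulrBr -cellintB; [|exact: integ|exact: integ].
by congr (_ * cellint _); apply/funext => y; rewrite mulrBl.
Qed.

(* Jensen: [0 <= int (f - a)^2 K] for the mean [a] of [f] against [K / mass]. *)
Lemma smoothing_contraction n f : sqint f -> nsq (smoothing n f) <= nsq f.
Proof.
move=> sf; have c0 := kern_mass_gt0 n; set c := kern_mass n in c0.
have aQ := smooth_periodic_algebra; have tK := tkern_tensor n.
have pf2 := sqint_sqr_pairs sf.
have i2 x : cintegrable (fun y => f y ^+ 2 * tkern n x y) := tensor_integrable pf2 x tK.
have iK x : cintegrable (tkern n x).
  by apply: cintegrable_cont; have [_ r] := tkern_smooth n x; exact: (Creg_cont (r 0)).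
have jensen x : smoothing n f x ^+ 2 <= c^-1 * cellint (fun y => f y ^+ 2 * tkern n x y).
  pose a := smoothing n f x.
  have : 0 <= cellint (fun y => (f y - a) ^+ 2 * tkern n x y).
    by apply: cellint_ge0 => y _; rewrite mulr_ge0 ?sqr_ge0// ltW ?tkern_gt0.
  rewrite (_ : (fun y => _) = fun y => f y ^+ 2 * tkern n x y +
      ((- 2 * a) * (f y * tkern n x y) + a ^+ 2 * tkern n x y)); last first.
    by apply/funext => y; ring.
  have j1 := cintegrableZ (- 2 * a) (@integ n f x sf); have j2 := cintegrableZ (a ^+ 2) (iK x).
  rewrite cellintD//; last exact: cintegrableD.
  rewrite cellintD// cellintZ; last exact: integ.
  rewrite cellintZ// kern_massE -/c.
  have -> : cellint (fun y => f y * tkern n x y) = c * a.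
    by rewrite /a /smoothing mulVKf// gt_eqF.
  rewrite -/a ler_pdivlMl//; move: (cellint _) => t; nra.
have [j3 E] := tensor_exchange aQ pf2 tK.
have sS := smoothing_smooth n sf.
apply: (@le_trans _ _ (cellint (fun x => c^-1 * cellint (fun y => f y ^+ 2 * tkern n x y)))).
  have [_ r2] := tensor_int aQ pf2 tK.
  apply: cellint_le => //; last by apply: cintegrableZ; apply: cintegrable_cont; exact: (Creg_cont (r2 0)).
  by apply: cintegrable_cont; apply: contX; exact: (Creg_cont (sS.2 0)).
rewrite cellintZ; last first.
  have [_ r2] := tensor_int aQ pf2 tK.
  by apply: cintegrable_cont; exact: (Creg_cont (r2 0)).
rewrite E (_ : (fun y => _) = fun y => c * f y ^+ 2); last first.
  apply/funext => y; rewrite mulrC; congr (_ * _).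
  by rewrite /c -(kern_massE n y); congr cellint; apply/funext => x; exact: tkernC.
by rewrite cellintZ ?mulKf ?gt_eqF//; exact: sf.2.
Qed.

(** Concentration without localisation: both sets are the whole space and the weight is 1, so the
    normalisation is the constant mass. *)
Lemma smoothing_uniform f e : continuous f -> per f -> 0 < e ->
  exists N, forall n, (N <= n)%N -> forall x, `|smoothing n f x - f x| <= e.
Proof.
move=> cf pf e0.
have ctrig a : continuous (trig a) by have [_ r] := trig_smooth a; exact: (Creg_cont (r 0)).
have ptrig a : per (trig a) by have [] := trig_smooth a.
have [N HN] := @concentration R (3 + 3) trig ctrig ptrig setT setT (fun=> 1) 25
  closedT closedT (fun _ _ _ => erefl) (fun _ _ _ => erefl) (@cst_continuous P R 1)
  (fun _ _ _ => erefl) (fun _ => ler01) (fun y H => False_ind _ (H I)) (fun _ _ => ltr01)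
  M0 sqdist_trig_lt (fun x y _ _ => @sqdist_trig_sep x y) f e cf pf
  (fun y H => False_ind _ (H I)) e0.
exists N => n Nn x; have := HN n Nn x I; rewrite !mul1r.
have -> : cellint (fun y => 1 * kern trig 25 n x y) = kern_mass n.
  by rewrite -(kern_massE n x); congr cellint; apply/funext => y; rewrite mul1r.
have c0 := kern_mass_gt0 n.
have -> : cellint (fun y => f y * kern trig 25 n x y) = kern_mass n * smoothing n f x.
  by rewrite /smoothing mulVKf// gt_eqF.
rewrite [f x * _]mulrC -mulrBr normrM (gtr0_norm c0) [e * _]mulrC ler_pM2l//.
Qed.

(** For a continuous approximant [g], [f - S f = (f - g) + (g - S g) - S (f - g)], and contraction
    bounds the last term. The three errors [e / 16] enter with factors 2, 4 and 4. *)
Theorem smoothing_cvg f e : sqint f -> 0 < e ->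
  exists N, forall n, (N <= n)%N -> nsq (fun p => f p - smoothing n f p) <= e.
Proof.
move=> sf e0; have e1 : 0 < e / 16 by rewrite divr_gt0.
have [_ /(_ _ e1)[g [cg pg Hg]]] := square_integrable_dens sf.
have V0 : 0 < (2 * pi) ^+ 3 :> R by rewrite exprn_gt0// mulr_gt0// pi_gt0.
pose d := Num.sqrt (e / 16 / (2 * pi) ^+ 3).
have d0 : 0 < d by rewrite sqrtr_gt0 divr_gt0.
have [N HN] := smoothing_uniform cg pg d0; exists N => n /HN {}HN.
have sg := sqint_cont cg; have sfg := sqintB sf sg.
have cS h : sqint h -> sqint (smoothing n h).
  by move=> sh; apply: sqint_cont; exact: (Creg_cont ((smoothing_smooth n sh).2 0)).
have H1 := smoothing_contraction n sfg.
have H2 : nsq (fun p => g p - smoothing n g p) <= e / 16.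
  have : nsq (fun p => g p - smoothing n g p) <= cellint (fun=> d ^+ 2).
    apply: cellint_le; [exact: (sqintB sg (cS _ sg)).2|by apply: cintegrable_cont; exact: cst_continuous|].
    move=> p _; rewrite -[_ ^+ 2]real_normK ?num_real// lerXn2r// ?nnegrE ?(ltW d0)//.
    by rewrite distrC.
  rewrite cellint_cst sqr_sqrtr ?divfK ?gt_eqF// ltW// divr_gt0//.
have E : (fun p => f p - smoothing n f p) = fun p => (f p - g p) +
    ((g p - smoothing n g p) - smoothing n (fun y => f y - g y) p).
  by apply/funext => p; rewrite smoothingB//; ring.
have s2 := sqintB sg (cS _ sg); have s3 := cS _ sfg.
rewrite E; apply: (le_trans (nsqD sfg (sqintB s2 s3))).
have := nsqD s2 (sqintZ (-1) s3); rewrite nsqZ// sqrrN expr1n mul1r.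
rewrite (_ : (fun p => _ + -1 * _) = fun p => g p - smoothing n g p -
   smoothing n (fun y => f y - g y) p); last by apply/funext => p; rewrite mulN1r.
lra.
Qed.

Definition real_weak_partial i f g := forall F, Q F ->
  cellint (fun p => f p * dpar i F p) = - cellint (fun p => g p * F p).

(** Translation invariance moves the derivative to the variable [y], in which the kernel is an
    admissible test function. *)
Lemma dpar_smoothing n i f g : sqint f -> sqint g -> real_weak_partial i f g ->
  dpar i (smoothing n f) = smoothing n g.
Proof.
move=> sf sg fg; apply/funext => x; rewrite /smoothing.
have aQ := smooth_periodic_algebra; have tK := tkern_tensor n.
have pf := sqint_pairs sf; have [_ r] := tensor_int aQ pf tK.
rewrite dparZ; last by move=> p; exact: (Creg_der (r 1)).
congr (_ * _); have [_ ->] := tensor_int_dpar aQ pf i x tK.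
have E : (fun y => f y * dpar i (fun z => tkern n z y) x) =
    fun y => (-1) * (f y * dpar i (tkern n x) y).
  by apply/funext => y; rewrite dpar_tkern mulN1r mulrN.
have [pK rK] := tkern_smooth n x.
rewrite E cellintZ; last first.
  by apply: pf; [exact: (Creg_cont (Creg_dpar i (rK 1)))|exact: per_dpar].
by rewrite fg// mulN1r opprK.
Qed.

(** The smoothings of two weak derivatives coincide, both being the classical derivative of the
    smoothing of [f], and smoothings converge in L^2. *)
Lemma weak_partial_unique i f g g' : sqint f -> sqint g -> sqint g' ->
  real_weak_partial i f g -> real_weak_partial i f g' -> nsq (fun p => g p - g' p) = 0.
Proof.
move=> sf sg sg' fg fg'; have sd := sqintB sg sg'.
have S0 n p : smoothing n (fun p => g p - g' p) p = 0.
  by rewrite smoothingB// -(dpar_smoothing n sf sg fg) -(dpar_smoothing n sf sg' fg') subrr.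
apply/eqP; rewrite eq_le nsq_ge0 andbT; apply/ler_addgt0Pl => e e0; rewrite addr0.
have [N /(_ N (leqnn N))] := smoothing_cvg sd e0.
rewrite (_ : (fun p => _ - smoothing _ _ _) = fun p => g p - g' p)//.
by apply/funext => p; rewrite S0 subr0.
Qed.

End TrigonometricKernel.

(** * From C^1 approximation to the Sobolev norm *)

Section SobolevDensity.
Variable R : realType.
Local Notation C := (Rcomplex R).
Local Notation P := (R * R * R)%type.
Local Notation T3 := (torus3 R).
Local Notation tpi := (@torus_pi R).
Local Notation re := (@complex.Re R).
Local Notation im := (@complex.Im R).
Local Notation Q := (@smooth_periodic R).
Implicit Types (u g w : T3 -> C) (F G : P -> R) (i : 'I_3).

Definition relift u : P -> R := fun p => re (u (tpi p)).
Definition imlift u : P -> R := fun p => im (u (tpi p)).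

Let normsq (z : C) : `|z| ^+ 2 = re z ^+ 2 + im z ^+ 2.
Proof. by case: z => x y; rewrite /Num.norm /= sqr_sqrtr ?addr_ge0 ?sqr_ge0. Qed.

Let L2E u : L2_sqnorm u = (\int[lebesgue3 R]_(p in @cell R)
  (relift u p ^+ 2 + imlift u p ^+ 2)%:E)%E.
Proof. by apply: eq_integral => p _; rewrite normsq. Qed.

Lemma torus_L2P u : torus_L2 u <-> sqint (relift u) /\ sqint (imlift u).
Proof.
split=> [[m1 m2]|[[m1 i1] [m2 i2]]].
  rewrite L2E => fin.
  have m12 : measurable_fun (@cell R) (fun p => relift u p ^+ 2 + imlift u p ^+ 2).
    by apply: measurable_funD; apply: measurable_funX.
  have i12 : cintegrable (fun p => relift u p ^+ 2 + imlift u p ^+ 2).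
    apply/integrableP; split; first exact/measurable_EFinP.
    apply: le_lt_trans fin; rewrite le_eqVlt; apply/orP; left; apply/eqP.
    by apply: eq_integral => p _; rewrite /= ger0_norm ?addr_ge0 ?sqr_ge0.
  split; split=> //; apply: (cintegrable_dom _ i12); try exact: measurable_funX.
    by move=> p _; rewrite ger0_norm ?sqr_ge0// lerDl sqr_ge0.
  by move=> p _; rewrite ger0_norm ?sqr_ge0// lerDr sqr_ge0.
split=> //; rewrite L2E.
have /integrableP[_] := cintegrableD i1 i2; apply: le_lt_trans.
rewrite le_eqVlt; apply/orP; left; apply/eqP.
by apply: eq_integral => p _; rewrite /= ger0_norm ?addr_ge0 ?sqr_ge0.
Qed.

Lemma L2_sqnormE u : torus_L2 u -> L2_sqnorm u = (nsq (relift u) + nsq (imlift u))%:E.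
Proof.
move=> /torus_L2P[[_ i1] [_ i2]]; rewrite L2E -cellintD// /cellint /Rintegral fineK //; last first.
exact: (integrable_fin_num (@measurable_cell R) (cintegrableD i1 i2)).
Qed.

Let smooth_parts w : torus_Cinfty w <-> Q (relift w) /\ Q (imlift w).
Proof.
split=> [/torus_CinftyP H|[[_ H1] [_ H2]]]; last by apply/torus_CinftyP => k; split; [exact: H1|exact: H2].
split; split=> [p q pq|k]; try by have [? ?] := H k.
  by rewrite /relift pq.
by rewrite /imlift pq.
Qed.

Let partial_parts i w p : torus_C 1 w ->
  partial i (tlift w) p = Complex (dpar i (relift w) p) (dpar i (imlift w) p).
Proof.
move=> [_ /(_ i)[d _]]; have := congr1 (@^~ p) (re_partial d); have := congr1 (@^~ p) (im_partial d).
rewrite -[dpar i (relift w) p]/(dpar i (fun q => re (tlift w q)) p).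
rewrite -[dpar i (imlift w) p]/(dpar i (fun q => im (tlift w q)) p) => <- <-.
by case: (partial _ _ _).
Qed.

(** Real test functions extract the two real identities; conversely a complex test function combines
    them linearly through its own real and imaginary parts. *)
Lemma weak_partialP i u g : torus_L2 u -> torus_L2 g -> weak_partial i u g <->
  real_weak_partial i (relift u) (relift g) /\ real_weak_partial i (imlift u) (imlift g).
Proof.
move=> /torus_L2P[su1 su2] /torus_L2P[sg1 sg2]; split=> [H|[H1 H2] phi sphi].
  have key F : Q F -> Complex (cellint (fun p => relift u p * dpar i F p))
      (cellint (fun p => imlift u p * dpar i F p)) =
      - Complex (cellint (fun p => relift g p * F p)) (cellint (fun p => imlift g p * F p)) :> C.
    move=> QF; pose phi (x : T3) : C := Complex (descend F x) 0.
    have rphi : relift phi = F by rewrite -[RHS](descend_tpi QF.1).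
    have iphi : imlift phi = fun=> 0 by [].
    have sphi : torus_Cinfty phi.
      apply/smooth_parts; rewrite rphi iphi; split=> //.
      by split=> // k; exact: Creg_cst.
    have := H _ sphi; rewrite /cintegral.
    rewrite (_ : (fun p => re (tlift u p * _)) = fun p => relift u p * dpar i F p); last first.
      apply/funext => p; rewrite partial_parts// rphi iphi dpar_cst /relift /tlift /=.
      by case: (u _) => a c /=; rewrite mulr0 subr0.
    rewrite (_ : (fun p => im (tlift u p * _)) = fun p => imlift u p * dpar i F p); last first.
      apply/funext => p; rewrite partial_parts// rphi iphi dpar_cst /imlift /tlift /=.
      by case: (u _) => a c /=; rewrite mulr0 add0r.
    rewrite (_ : (fun p => re (tlift g p * _)) = fun p => relift g p * F p); last first.
      apply/funext => p; rewrite -[in RHS]rphi /relift /tlift /=.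
      by case: (g _) => a c /=; rewrite mulr0 subr0.
    rewrite (_ : (fun p => im (tlift g p * _)) = fun p => imlift g p * F p) //.
    apply/funext => p; rewrite -[in RHS]rphi /relift /imlift /tlift /=.
    by case: (g _) => a c /=; rewrite mulr0 add0r.
  by split=> F /key[E1 E2].
have /smooth_parts[Q1 Q2] := sphi.
have s1 : sqint (relift phi) by apply: sqint_cont; exact: (Creg_cont (Q1.2 0)).
have s2 : sqint (imlift phi) by apply: sqint_cont; exact: (Creg_cont (Q2.2 0)).
have sd1 : sqint (dpar i (relift phi)).
  by apply: sqint_cont; exact: (Creg_cont (Creg_dpar i (Q1.2 1))).
have sd2 : sqint (dpar i (imlift phi)).
  by apply: sqint_cont; exact: (Creg_cont (Creg_dpar i (Q2.2 1))).
rewrite /cintegral.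
rewrite (_ : (fun p => re (tlift u p * _)) = fun p => relift u p * dpar i (relift phi) p
    - imlift u p * dpar i (imlift phi) p); last first.
  by apply/funext => p; rewrite partial_parts// /relift /imlift /tlift /=; case: (u _).
rewrite (_ : (fun p => im (tlift u p * _)) = fun p => relift u p * dpar i (imlift phi) p
    + imlift u p * dpar i (relift phi) p); last first.
  by apply/funext => p; rewrite partial_parts// /relift /imlift /tlift /=; case: (u _).
rewrite (_ : (fun p => re (tlift g p * _)) = fun p => relift g p * relift phi p
    - imlift g p * imlift phi p); last first.
  by apply/funext => p; rewrite /relift /imlift /tlift /=; case: (g _) (phi _) => ? ? [].
rewrite (_ : (fun p => im (tlift g p * _)) = fun p => relift g p * imlift phi p
    + imlift g p * relift phi p); last first.
  by apply/funext => p; rewrite /relift /imlift /tlift /=; case: (g _) (phi _) => ? ? [].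
have := (H1 _ Q1, H1 _ Q2, H2 _ Q1, H2 _ Q2) => -[[[a1 a2] a3] a4].
rewrite -!/(cellint _) !cellintB ?cellintD ?a1 ?a2 ?a3 ?a4; try exact: sqintM.
by congr Complex; ring.
Qed.

Lemma real_weak_partial_smooth i F : Q F -> real_weak_partial i F (dpar i F).
Proof. by move=> [pF rF] G [pG rG]; apply: cellint_by_parts => //. Qed.

Lemma real_weak_partialB i F G F' G' : sqint F -> sqint G -> sqint F' -> sqint G' ->
  real_weak_partial i F G -> real_weak_partial i F' G' ->
  real_weak_partial i (fun p => F p - F' p) (fun p => G p - G' p).
Proof.
move=> sF sG sF' sG' H H' phi Qp; have [pp rp] := Qp.
have s1 : sqint phi by apply: sqint_cont; exact: (Creg_cont (rp 0)).
have s2 : sqint (dpar i phi) by apply: sqint_cont; exact: (Creg_cont (Creg_dpar i (rp 1))).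
rewrite (_ : (fun p => (F p - _) * _) = fun p => F p * dpar i phi p - F' p * dpar i phi p); last first.
  by apply/funext => p; rewrite mulrBl.
rewrite (_ : (fun p => (G p - _) * _) = fun p => G p * phi p - G' p * phi p); last first.
  by apply/funext => p; rewrite mulrBl.
rewrite !cellintB; try exact: sqintM.
by rewrite H// H'// opprB opprK addrC.
Qed.

Section SaturationDense.
Variables (m : nat) (b : 'I_m -> T3 -> C).
Hypothesis b_smooth : forall j, torus_Cinfty (b j).
Hypothesis emb : smooth_embedding (Gamma b).
Local Notation W := (sat_limit b).

Let smooth_sqint F : Q F -> sqint F.
Proof. by move=> [_ r]; apply: sqint_cont; exact: (Creg_cont (r 0)). Qed.

Let smooth_dpar_sqint i F : Q F -> sqint (dpar i F).
Proof. by move=> [_ r]; apply: sqint_cont; exact: (Creg_cont (Creg_dpar i (r 1))). Qed.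

Let pderiv i (w : T3 -> C) (x : T3) : C :=
  Complex (descend (dpar i (relift w)) x) (descend (dpar i (imlift w)) x).

Let pderiv_lift i w : torus_Cinfty w ->
  relift (pderiv i w) = dpar i (relift w) /\ imlift (pderiv i w) = dpar i (imlift w).
Proof.
by move=> /smooth_parts[[p1 _] [p2 _]]; split;
  [rewrite -[RHS](descend_tpi (per_dpar i p1))|rewrite -[RHS](descend_tpi (per_dpar i p2))].
Qed.

Let pderivP i w : torus_Cinfty w ->
  [/\ torus_L2 w, torus_L2 (pderiv i w) & weak_partial i w (pderiv i w)].
Proof.
move=> sw; have [E1 E2] := pderiv_lift i sw; have /smooth_parts[Q1 Q2] := sw.
have L1 : torus_L2 w by apply/torus_L2P; split; exact: smooth_sqint.
have L2 : torus_L2 (pderiv i w).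
  by apply/torus_L2P; rewrite E1 E2; split; exact: smooth_dpar_sqint.
split=> //; apply/weak_partialP => //; rewrite E1 E2.
by split; exact: real_weak_partial_smooth.
Qed.

Lemma smooth_torus_H1 w : torus_Cinfty w -> torus_H1 w.
Proof.
move=> sw; split; first by have [] := pderivP 0 sw.
by move=> i; exists (pderiv i w); have [] := pderivP i sw.
Qed.

Let reliftB u w : relift (u - w) = (fun p => relift u p - relift w p) /\
  imlift (u - w) = (fun p => imlift u p - imlift w p).
Proof.
by split; apply/funext => p; rewrite /relift /imlift -[(u - w) _]/(u _ - w _) ?reB ?imB.
Qed.

Let torus_L2B u w : torus_L2 u -> torus_L2 w -> torus_L2 (u - w).
Proof.
move=> /torus_L2P[u1 u2] /torus_L2P[w1 w2]; apply/torus_L2P.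
by have [-> ->] := reliftB u w; split; exact: sqintB.
Qed.

Let near_sum F G H (t eta : R) : sqint F -> sqint G -> sqint H ->
  nsq (fun p => F p - G p) <= t -> 0 <= eta -> (forall p, `|G p - H p| <= eta) ->
  nsq (fun p => F p - H p) <= 2 * t + 2 * (eta ^+ 2 * (2 * pi) ^+ 3).
Proof.
move=> sF sG sH Ht eta0 Heta.
have := nsqD (sqintB sF sG) (sqintB sG sH).
rewrite (_ : (fun p => _ + _) = fun p => F p - H p); last first.
  by apply/funext => p; rewrite addrA subrK.
move=> /le_trans; apply; apply: lerD; first by rewrite ler_pM2l.
rewrite ler_pM2l// -cellint_cst; apply: cellint_le; first exact: (sqintB sG sH).2.
  by apply: cintegrable_cont; exact: cst_continuous.
by move=> p _; rewrite -[_ ^+ 2]real_normK ?num_real// lerXn2r// nnegrE.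
Qed.

(** [u] is smoothed and the result approximated in C^1 by a saturated function [w]. The weak
    derivative that enters the norm is an arbitrary choice, so uniqueness is used to compare it with
    [g i - pderiv i w], at the cost of a factor 2. *)
Lemma sat_limit_H1_approx u (e : R) : torus_H1 u -> 0 < e ->
  exists2 w, W w & (H1_sqnorm (u - w)%R < (e ^+ 2)%:E)%E.
Proof.
move=> [Lu Hg] e0; have /torus_L2P[su1 su2] := Lu.
have /choice[g Hgi] : forall i, exists g, torus_L2 g /\ weak_partial i u g.
  by move=> i; have [g ? ?] := Hg i; exists g.
have sg i : sqint (relift (g i)) /\ sqint (imlift (g i)) by apply/torus_L2P; case: (Hgi i).
have rg i : real_weak_partial i (relift u) (relift (g i)) /\
    real_weak_partial i (imlift u) (imlift (g i)).
  by apply/weak_partialP => //; case: (Hgi i).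
(* The function contributes at most [2 * t] and each of the three derivatives at most [4 * t], in
   total [14 * t < e ^+ 2]. *)
pose t := e ^+ 2 / 32; have t0 : 0 < t by rewrite divr_gt0 ?exprn_gt0.
have t4 : 0 < t / 4 by rewrite divr_gt0.
have V0 : 0 < (2 * pi) ^+ 3 :> R by rewrite exprn_gt0// mulr_gt0// pi_gt0.
(* A uniform error [eta] has squared norm at most [t / 4] over the cell. *)
pose eta := Num.sqrt (t / 4 / (2 * pi) ^+ 3).
have eta0 : 0 < eta by rewrite sqrtr_gt0 divr_gt0.
have etaE : 2 * (t / 4) + 2 * (eta ^+ 2 * (2 * pi) ^+ 3) = t.
  rewrite sqr_sqrtr; last by rewrite ltW// divr_gt0.
  by rewrite divfK ?gt_eqF//; lra.
have [N1 HN1] := smoothing_cvg su1 t4; have [N2 HN2] := smoothing_cvg su2 t4.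
have /choice[N HN] : forall i, exists N, forall n, (N <= n)%N ->
    nsq (fun p => relift (g i) p - smoothing n (relift (g i)) p) <= t / 4 /\
    nsq (fun p => imlift (g i) p - smoothing n (imlift (g i)) p) <= t / 4.
  move=> i; have [s1 s2] := sg i; have [M1 H1] := smoothing_cvg s1 t4.
  have [M2 H2] := smoothing_cvg s2 t4; exists (maxn M1 M2) => n.
  by rewrite geq_max => /andP[/H1 ? /H2 ?].
pose n := maxn (maxn N1 N2) (\max_i N i).
have Q1 : Q (smoothing n (relift u)) by exact: smoothing_smooth.
have Q2 : Q (smoothing n (imlift u)) by exact: smoothing_smooth.
pose f (x : T3) : C := Complex (descend (smoothing n (relift u)) x)
  (descend (smoothing n (imlift u)) x).
have f1 : relift f = smoothing n (relift u) by rewrite -[RHS](descend_tpi Q1.1).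
have f2 : imlift f = smoothing n (imlift u) by rewrite -[RHS](descend_tpi Q2.1).
have rf : torus_C 1 f by have /smooth_parts : Q (relift f) /\ Q (imlift f) by rewrite f1 f2.
have [w Ww [B1 B2]] := embedding_approx b_smooth emb rf eta0.
rewrite -/(relift f) -/(imlift f) in B1 B2.
exists w => //; have sw := sat_limit_smooth b_smooth Ww.
have /smooth_parts[Qw1 Qw2] := sw.
have Lw : torus_L2 w by have [] := pderivP 0 sw.
have [E1 E2] := reliftB u w.
have bnd1 : (L2_sqnorm (u - w)%R <= (2 * t)%:E)%E.
  rewrite L2_sqnormE; last exact: torus_L2B.
  rewrite lee_fin E1 E2 mulr_natl mulr2n; apply: lerD; rewrite -etaE.
    apply: (near_sum su1 (smooth_sqint Q1) (smooth_sqint Qw1)); [|exact: ltW|].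
      by apply: HN1; rewrite !leq_max leqnn.
    by move=> p; have := bnd0 B1 (I : setT p); rewrite -/(relift f p) f1.
  apply: (near_sum su2 (smooth_sqint Q2) (smooth_sqint Qw2)); [|exact: ltW|].
    by apply: HN2; rewrite !leq_max leqnn orbT.
  by move=> p; have := bnd0 B2 (I : setT p); rewrite -/(imlift f p) f2.
have bnd2 i : (L2_sqnorm (weak_derivative i (u - w)%R) <= (4 * t)%:E)%E.
  have [sg1 sg2] := sg i; have [rg1 rg2] := rg i.
  have [P1 P2] := pderiv_lift i sw.
  have [_ Lp wp] := pderivP i sw; have [Lgi wgi] := Hgi i.
  have Luw := torus_L2B Lu Lw; have Lgp := torus_L2B Lgi Lp.
  have [G1 G2] := reliftB (g i) (pderiv i w); rewrite P1 P2 in G1 G2.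
  have d1 := smooth_dpar_sqint i Qw1; have d2 := smooth_dpar_sqint i Qw2.
  have wd : weak_partial i (u - w) (g i - pderiv i w).
    apply/weak_partialP => //; rewrite E1 E2 G1 G2; split.
      apply: (real_weak_partialB su1 sg1 (smooth_sqint Qw1)) => //.
      exact: real_weak_partial_smooth.
    apply: (real_weak_partialB su2 sg2 (smooth_sqint Qw2)) => //.
    exact: real_weak_partial_smooth.
  have [Ld wdd] : torus_L2 (weak_derivative i (u - w)) /\
      weak_partial i (u - w) (weak_derivative i (u - w)).
    exact: (@getPex _ [set g | torus_L2 g /\ weak_partial i (u - w) g]
      (ex_intro _ _ (conj Lgp wd))).
  move: (weak_derivative i (u - w)) Ld wdd => d Ld wdd.
  have [D1 D2] := (weak_partialP i Luw Ld).1 wdd.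
  have [D1' D2'] := (weak_partialP i Luw Lgp).1 wd.
  have /torus_L2P[sd1 sd2] := Ld; have /torus_L2P[se1 se2] := Lgp.
  have /torus_L2P[sv1 sv2] := Luw.
  have uniq0 (h h' : P -> R) : sqint h -> sqint h' -> nsq (fun p => h p - h' p) = 0 ->
      nsq h <= 2 * nsq h'.
    move=> sh sh' h0; have := nsqD (sqintB sh sh') sh'; rewrite h0 mulr0 add0r.
    by congr (nsq _ <= _); apply/funext => p; rewrite subrK.
  have U1 := uniq0 _ _ sd1 se1 (weak_partial_unique sv1 sd1 se1 D1 D1').
  have U2 := uniq0 _ _ sd2 se2 (weak_partial_unique sv2 sd2 se2 D2 D2').
  have nN : (N i <= n)%N by rewrite leq_max leq_bigmax orbT.
  have [H1 H2] := HN i n nN.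
  have S1 := dpar_smoothing n su1 sg1 rg1; have S2 := dpar_smoothing n su2 sg2 rg2.
  have dQ (F H : P -> R) : Q F -> Q H -> bnd setT 1 eta (fun p => F p - H p) ->
      forall p, `|dpar i F p - dpar i H p| <= eta.
    move=> [_ rF] [_ rH] HB p; have := bnd0 (bnd_dpar i HB) (I : setT p).
    by rewrite dparB// => z; [exact: (Creg_der (rF 1))|exact: (Creg_der (rH 1))].
  have T1 : nsq (relift (g i - pderiv i w)) <= t.
    rewrite G1 -etaE; apply: (near_sum sg1 _ d1 H1 (ltW eta0)).
      by apply: smooth_sqint; exact: smoothing_smooth.
    by move=> p; rewrite -S1 -f1; apply: dQ => //; rewrite f1.
  have T2 : nsq (imlift (g i - pderiv i w)) <= t.
    rewrite G2 -etaE; apply: (near_sum sg2 _ d2 H2 (ltW eta0)).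
      by apply: smooth_sqint; exact: smoothing_smooth.
    by move=> p; rewrite -S2 -f2; apply: dQ => //; rewrite f2.
  by rewrite L2_sqnormE// lee_fin; lra.
rewrite /H1_sqnorm; apply: (@le_lt_trans _ _ ((2 * t)%:E + \sum_(i < 3) (4 * t)%:E)%E).
  by apply: leeD => //; apply: lee_sum => i _; exact: bnd2.
rewrite sumEFin -EFinD lte_fin sumr_const card_ord -[_ *+ 3]mulr_natl /t.
by have := exprn_gt0 2 e0; lra.
Qed.

Theorem embedding_saturating : cubic_saturating b.
Proof.
split=> [w Ww|u Hu e e0]; last exact: sat_limit_H1_approx.
by apply: smooth_torus_H1; exact: (sat_limit_smooth b_smooth Ww).
Qed.

End SaturationDense.

End SobolevDensity.

Theorem theorem4p12 (R : realType) (m : nat)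
    (b : 'I_m -> torus3 R -> Rcomplex R)
    (b_smooth : forall j : 'I_m, torus_Cinfty (b j)) :
  [/\ sat_limit b =
        [set f : torus3 R -> Rcomplex R |
          exists A : 'I_m -> torus3 R -> Rcomplex R -> Rcomplex R,
            (forall j : 'I_m, Tfield_algebra b (A j)) /\
            f = (fun x => \sum_(j < m) A j x (b j x))],
      forall k : nat, (1 <= k)%N ->
        (closure_C k (sat_limit b) = @torus_C R k <->
         smooth_embedding (Gamma b)) &
      smooth_embedding (Gamma b) -> cubic_saturating b].
Proof.
split.
- exact: sat_limitE.
- by move=> k k1; split=> [|emb]; [exact: embedding_of_dense|exact: embedding_dense].
- exact: embedding_saturating.
Qed.
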